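(* Let $n\ge2$, $m\ge1$, $I=[t_0,+\infty)$, $A\in\mathbb R^{n\times n}$, let a class $\mathcal K_1(A)$ be given, $f\in\mathcal K_1^{n\times1}(A)$, and let $\varphi_0(t,c_0)$ (parameter $c_0\in\mathbb R^{n_0}$, $0\le n_0\le n$) be some particular solution of class $\mathcal K_1^{n\times1}(A)\cap C^1(I)$ of $\frac{d\varphi}{dt}=A\varphi+f(t)$. Let $a>0$, $D:=\{(t,y):t\in I,\ y\in\mathbb R^{n\times1},\ \|y-\varphi_0(t,c_0)\|\le a\}$, and consider $$\frac{dy}{dt}=Ay+f(t)+\sum_{l=1}^m\varepsilon_l(t)f_l(t,y),\qquad(t,y)\in D.\qquad( * )$$ Let ranks $\varrho_1\le\dots\le\varrho_m$ ($\varrho_l\in\mathbb R^+$) of the $\varepsilon_l$ be given, let $k\in\mathbb N$, $p_{kl}:=\max\{0,[\rho_k-\varrho_l]+1\}$, $q_{kl}:=\left[\frac{\rho_k-\varrho_l}{\varrho_1}\right]$ ($l=1,\dots,m$), and suppose: 1. $\varepsilon_l:I\to\mathbb R$, $\varepsilon_l\in C^{p_{kl}}(I)$, $\frac{d^r\varepsilon_l(t)}{dt^r}=O\bigl((\varepsilon_1(t))^{(\varrho_l+r)/\varrho_1}\bigr)$, $\varepsilon_1(t)\ge0$, $\varepsilon_1(t)=o(1)$ ($l=1,\dots,m$, $r=0,\dots,p_{kl}$, $t\to+\infty$); 2. $f_l:D\to\mathbb R^{n\times1}$, $f_l\in C^{0,\max\{2,q_{kl}+1\}}_{t,y}(D)$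 ($l=1,\dots,m$); 3. $\sup_{(t,y)\in D}\|\partial_y^\wp f_l(t,y)\|<+\infty$ for $\wp\in\mathbb N_0^n$, $0\le|\wp|\le\max\{2,q_{kl}+1\}$, $l=1,\dots,m$; 4. $\partial_y^\wp f_l(t,\varphi_0(t,c_0))\in\mathcal K_1^{n\times1}(A)$ for $\wp\in\mathbb N_0^n$, $0\le|\wp|\le q_{kl}$ and all $l$ with $\rho_k\ge\varrho_l$; 5. $\Re\lambda_j(A)\ne0$ for $j=1,\dots,n$; 6. $\varepsilon_1(t)>0$ for $t\in I$. Then for sufficiently large $t_0$ equation $( * )$ has on $I$ at least one particular solution of the form $y=s(t)+r$, where $$s(t)=\varphi_0(t,c_0)+\sum_{s=1}^k\sum_{p=1}^{\varkappa_s}\nu_{sp}(t)\varphi_{sp}(t,c_{sp}),$$ $\varphi_0(t,c_0),\varphi_{sp}(t,c_{sp})\in\mathcal K_1^{n\times1}(A)\cap C^1(I)$ ($s=1,\dots,k$, $p=1,\dots,\varkappa_s$), and the error satisfies $$r=O\bigl((\varepsilon_1(t))^{\rho_{k+1}/\varrho_1}\bigr)\qquad(t\to+\infty).$$ Moreover, on an interval $[t_1,+\infty)$ the error $r$ depends on as many arbitrary scalar constants as there are indices $j\in\{1,\dots,n\}$ with $\Re\lambda_j(A)<0$; here $t_1\in\mathbb R$, $t_1\ge t_0$, is a sufficiently large number determined by these constants. (The family of solutions of the form $y=s(t)+r$ can depend on no more than $n$ arbitrary scalar parameters.)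
   Context: Notation: $\mathbb N_0=\{0\}\cup\mathbb N$; $\mathbb R^+=(0,+\infty)$; $[x]$ is the integer part (floor); $\|\cdot\|$ is the maximum modulus of the entries; $S^{n\times1}$ denotes $n$-vectors with entries in the class $S$; $\lambda_1(A),\dots,\lambda_n(A)$ are the eigenvalues of $A$ and $\Lambda(A)$ its spectrum; for $\wp\in\mathbb N_0^n$, $|\wp|=\sum_j\wp_j$, $\wp!=\prod_j\wp_j!$, $y^\wp=\prod_jy_j^{\wp_j}$, $\partial_y^\wp$ is the corresponding partial derivative. $C^{0,q}_{t,y}(D)$: partial $y$-derivatives up to order $q$ exist and are continuous on $D$. Empty sums are $0$, empty products $1$. A parameter in $\mathbb R^0$ means no parameter. ''For sufficiently large $t_0$'' means after replacing $t_0$ by a larger number and restricting everything to the new $I=[t_0,+\infty)$. Class $\mathcal K_1(A)$: some nonempty class of functions $f:I\to\mathbb R$ such that (1) every $f$ in it is continuous and bounded on $I$; (2) if $f_1,f_2\in\mathcal K_1(A)$, $\alpha\in\mathbb R$, then $\alpha f_1,\ f_1+f_2,\ f_1f_2\in\mathcal K_1(A)$; (3) for every $\tilde f:I\to\mathbb C$ with $\Re\tilde f,\Im\tilde f\in\mathcal K_1(A)$ and every $\lambda\in\Lambda(A)$, the equation $\frac{dy}{dt}=\lambda y+\tilde f(t)$ ($y:I\to\mathbb C$) has at least one particular solution $y(t,\tilde c)$ on $I$ (parameter $\tilde c\in\mathbb C^{\tilde n}$, $0\le\tilde n\le1$) with $\Re y,\Im y\in\mathcal K_1(A)\cap C^1(I)$.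 Ranks: $\operatorname{Rank}(\varepsilon_l)=\varrho_l$. A product $\prod_{l=1}^m\prod_{r=0}^{k_l}\bigl(\frac{d^r\varepsilon_l(t)}{dt^r}\bigr)^{\beta_{lr}}$ with $k_l,\beta_{lr}\in\mathbb N_0$, not all $\beta_{lr}$ zero, has rank $\sum_{l}\sum_{r}(\varrho_l+r)\beta_{lr}$ (products are regarded as formal monomials in the $\varepsilon_l$ and their derivatives). The set of all ranks (over all such exponents) is discrete and is enumerated increasingly as $\rho_1<\rho_2<\dots$ (so $\rho_1=\varrho_1$). For each $s$, $\nu_{s1},\dots,\nu_{s\varkappa_s}$ enumerates the products of rank $\rho_s$, with $\nu_{1p}=\varepsilon_p$ for $p=1,\dots,\varkappa_1$. Coefficients: $\varphi_{sp}(t,c_{sp})$ (parameters $c_{sp}\in\mathbb R^{n_{sp}}$, $0\le n_{sp}\le n$) are, recursively in $s=1,\dots,k$, particular solutions of class $\mathcal K_1^{n\times1}(A)\cap C^1(I)$ of $\frac{d\varphi_{sp}}{dt}=A\varphi_{sp}+g_{sp}$, where, with $\tilde\delta=\sum_{s\ge1}\sum_p\nu_{sp}\varphi_{sp}$, $g_{sp}$ is the coefficient of $\nu_{sp}$ in the formal expansion of $$-\sum_{s',p'}\frac{d\nu_{s'p'}}{dt}\varphi_{s'p'}+\sum_{l=1}^m\varepsilon_l\sum_{\wp\in\mathbb N_0^n}\frac1{\wp!}\partial_y^\wp f_l(t,\varphi_0(t,c_0))\tilde\delta^\wp$$ ($d\nu_{s'p'}/dt$ being expanded by the product rule as a combination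 of products of rank $\rho_{s'}+1$). The function $g_{sp}$ involves only $\varphi_0$ and the $\varphi_{s'p'}$ with $s'<s$, and for $s\le k$ only the derivatives $\partial_y^\wp f_l(t,\varphi_0)$ with $\rho_k\ge\varrho_l$, $|\wp|\le q_{kl}$. The sum $s(t)$ is thus a truncation of the formal solution $\varphi_0+\sum_{s\ge1}\sum_p\nu_{sp}\varphi_{sp}$ of $( * )$. Standing assumption: the function $g(t):=-\frac{ds(t)}{dt}+As(t)+f(t)+\sum_{l=1}^m\varepsilon_l(t)f_l(t,s(t))$ is not identically zero on $I$ (otherwise $y\equiv s(t)$ is an exact solution). *)

(* Defs.v *)
From HB Require Import structures.
From mathcomp Require Import all_boot all_order all_algebra.
From mathcomp Require Import finmap multiset.
From mathcomp Require Import complex.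
From mathcomp Require Import all_classical all_reals all_analysis.

Set Implicit Arguments.
Unset Strict Implicit.
Unset Printing Implicit Defensive.

Import Order.TTheory GRing.Theory Num.Theory.
Import numFieldNormedType.Exports.

Local Open Scope classical_set_scope.
Local Open Scope ring_scope.

(* Lets the Landau notations be used at +oo. *)
Canonical pinfty_filter_on (R : realType) :=
  FilterType (pinfty_nbhs R) (@filter_filter _ _ proper_pinfty_nbhs).

(* Functions on I = [t0, +oo[ are represented by total functions R -> V of which
   only the values on I matter, so derivatives are taken within I: at t0 they
   are one-sided. *)
Definition has_deriv_in (R : realType) (V : normedModType R) (I : set R)
    (f : R -> V) (t : R) (l : V) : Prop :=
  (u - t)^-1 *: (f u - f t) @[u --> within I t^'] --> l.

Definition deriv_in (R : realType) (V : normedModType R) (I : set R)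
    (f : R -> V) (t : R) : V :=
  lim ((u - t)^-1 *: (f u - f t) @[u --> within I t^']).

Definition derivn_in (R : realType) (V : normedModType R) (I : set R)
    (r : nat) (f : R -> V) : R -> V :=
  iter r (deriv_in I) f.

Definition Cn_in (R : realType) (V : normedModType R) (I : set R)
    (p : nat) (f : R -> V) : Prop :=
  (forall r t, (r < p)%N -> I t ->
     exists l : V, has_deriv_in I (derivn_in I r f) t l) /\
  (forall r, (r <= p)%N -> {within I, continuous (derivn_in I r f)}).

(* A class K_1(A) of functions on [t0, +oo[.  The clause class_ext says that
   membership only depends on the restriction to [t0, +oo[.  In class_solve, the
   family of solutions is only required to be nonempty, so its parameter does
   not appear. *)
Record classK1 (R : realType) (n : nat) (t0 : R) (A : 'M[R]_n)
    (K : set (R -> R)) : Prop := ClassK1 {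
  class_nonempty : K !=set0 ;
  class_ext : forall f g : R -> R,
    (forall t, t0 <= t -> f t = g t) -> K f -> K g ;
  class_continuous : forall f, K f -> {within `[t0, +oo[, continuous f} ;
  class_bounded : forall f, K f ->
    exists M : R, forall t, t0 <= t -> `|f t| <= M ;
  class_scale : forall (al : R) f, K f -> K (fun t => al * f t) ;
  class_add : forall f g, K f -> K g -> K (fun t => f t + g t) ;
  class_mul : forall f g, K f -> K g -> K (fun t => f t * g t) ;
  class_solve : forall (lam : R[i]) (f : R -> R[i]),
    eigenvalue (map_mx (real_complex R) A) lam ->
    K (fun t => complex.Re (f t)) -> K (fun t => complex.Im (f t)) ->
    exists y : R -> R[i],
      [/\ K (fun t => complex.Re (y t)) /\ K (fun t => complex.Im (y t)),
          Cn_in `[t0, +oo[ 1 (fun t => complex.Re (y t)),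
          Cn_in `[t0, +oo[ 1 (fun t => complex.Im (y t)) &
          forall t, t0 <= t ->
            has_deriv_in `[t0, +oo[ (fun u => complex.Re (y u)) t
              (complex.Re (lam * y t + f t)) /\
            has_deriv_in `[t0, +oo[ (fun u => complex.Im (y u)) t
              (complex.Im (lam * y t + f t))] }.

Definition classK1v (R : realType) (n : nat) (K : set (R -> R))
    (v : R -> 'cV[R]_n) : Prop :=
  forall i, K (fun t => v t i 0).

(* The norm on 'cV[R]_n is the maximum modulus of the entries. *)
Definition tube (R : realType) (n : nat) (t0 a : R) (phi0 : R -> 'cV[R]_n) :
    set (R * 'cV[R]_n) :=
  [set ty | t0 <= ty.1 /\ `|ty.2 - phi0 ty.1| <= a].

(* Partial y-derivatives within D, hence one-sided on the faces of the cubes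
   {y | D (t, y)}. *)
Definition pquot (R : realType) (n : nat) (g : R -> 'cV[R]_n -> 'cV[R]_n)
    (j : 'I_n) (t : R) (y : 'cV[R]_n) (h : R) : 'cV[R]_n :=
  h^-1 *: (g t (y + h *: delta_mx j 0) - g t y).

Definition pdir (R : realType) (n : nat) (D : set (R * 'cV[R]_n)) (j : 'I_n)
    (t : R) (y : 'cV[R]_n) : set R :=
  [set h | D (t, y + h *: delta_mx j 0)].

Definition pderiv (R : realType) (n : nat) (D : set (R * 'cV[R]_n))
    (j : 'I_n) (g : R -> 'cV[R]_n -> 'cV[R]_n) : R -> 'cV[R]_n -> 'cV[R]_n :=
  fun t y => lim (pquot g j t y h @[h --> within (pdir D j t y) 0^']).

Definition pderivs (R : realType) (n : nat) (D : set (R * 'cV[R]_n))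
    (js : seq 'I_n) (g : R -> 'cV[R]_n -> 'cV[R]_n) : R -> 'cV[R]_n -> 'cV[R]_n :=
  foldr (pderiv D) g js.

(* C^{0,q}_{t,y}(D); iterated derivatives are taken in every order. *)
Definition C0q (R : realType) (n : nat) (D : set (R * 'cV[R]_n)) (q : nat)
    (g : R -> 'cV[R]_n -> 'cV[R]_n) : Prop :=
  (forall (js : seq 'I_n) (j : 'I_n) t y, (size js < q)%N -> D (t, y) ->
     cvg (pquot (pderivs D js g) j t y h @[h --> within (pdir D j t y) 0^'])) /\
  (forall js : seq 'I_n, (size js <= q)%N ->
     {within D, continuous (fun ty => pderivs D js g ty.1 ty.2)}).

Definition midx (n : nat) := {ffun 'I_n -> nat}.

Definition msize (n : nat) (w : midx n) : nat := (\sum_(j < n) w j)%N.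

Definition mfact (n : nat) (w : midx n) : nat := (\prod_(j < n) (w j)`!)%N.

Definition mderiv (R : realType) (n : nat) (D : set (R * 'cV[R]_n))
    (w : midx n) (g : R -> 'cV[R]_n -> 'cV[R]_n) : R -> 'cV[R]_n -> 'cV[R]_n :=
  pderivs D (flatten [seq nseq (w j) j | j <- enum 'I_n]) g.

(* Formal monomials in the symbols (l, r), standing for d^r eps_l / dt^r: the
   multiplicity of (l, r) is the exponent beta_{lr}.  The indices l = 1, ..., m
   are 'I_m.+1 starting from 0. *)
Local Open Scope mset_scope.

Definition monom (m : nat) := {mset ('I_m.+1 * nat)%type}.

Definition mon_eps (m : nat) (l : 'I_m.+1) : monom m := [mset (l, 0%N)].

Definition mon_rank (R : realType) (m : nat) (vr : 'I_m.+1 -> R)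
    (mu : monom m) : R :=
  \sum_(x <- finsupp mu) (vr x.1 + x.2%:R) * (mu x)%:R.

Definition mon_eval (R : realType) (m : nat) (I : set R)
    (eps : 'I_m.+1 -> R -> R) (mu : monom m) (t : R) : R :=
  \prod_(x <- finsupp mu) derivn_in I x.2 (eps x.1) t ^+ mu x.

(* The coefficient of mu in d mu'/dt, by the product rule. *)
Definition mon_dcoef (m : nat) (mu' mu : monom m) : nat :=
  (\sum_(x <- finsupp mu')
     mu' x * (mu == (mu' `\ x) `+` [mset (x.1, x.2.+1)]))%N.

(* rho_1 < rho_2 < ... enumerates the ranks, and for s >= 1 the monomials of
   rank rho_s are nu s 0, ..., nu s (kappa s - 1); the values at s = 0 are
   irrelevant. *)
Record rank_enum (R : realType) (m : nat) (vr : 'I_m.+1 -> R)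
    (rho : nat -> R) (kappa : nat -> nat) (nu : nat -> nat -> monom m) : Prop :=
  RankEnum {
  rho_incr : forall s s', (1 <= s)%N -> (s < s')%N -> rho s < rho s' ;
  rhoP : forall x : R,
    (exists mu, mu <> mset0 /\ mon_rank vr mu = x) <->
    (exists s, (1 <= s)%N /\ rho s = x) ;
  nu_inj : forall s p p', (1 <= s)%N -> (p < kappa s)%N -> (p' < kappa s)%N ->
    nu s p = nu s p' -> p = p' ;
  nuP : forall s mu, (1 <= s)%N ->
    (mu <> mset0 /\ mon_rank vr mu = rho s) <->
    (exists p, (p < kappa s)%N /\ nu s p = mu) ;
  nu1E : forall l : 'I_m.+1, (l < kappa 1)%N -> nu 1%N l = mon_eps l }.

(* Formal series in the monomials, with the Cauchy product.  The sums over \in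
   are finite: a monomial has finitely many divisors. *)
Definition fseries (R : realType) (m : nat) := monom m -> R.

Definition fs_one (R : realType) (m : nat) : fseries R m :=
  fun mu => (mu == mset0)%:R.

Definition fs_eps (R : realType) (m : nat) (l : 'I_m.+1) : fseries R m :=
  fun mu => (mu == mon_eps l)%:R.

Definition fs_mul (R : realType) (m : nat) (a b : fseries R m) : fseries R m :=
  fun mu => \sum_(p \in [set p : monom m * monom m | p.1 `+` p.2 = mu])
              a p.1 * b p.2.

Definition fs_exp (R : realType) (m : nat) (a : fseries R m) (j : nat) :
    fseries R m :=
  iter j (fs_mul a) (@fs_one R m).

Definition fs_mexp (R : realType) (m n : nat) (a : 'I_n -> fseries R m)
    (w : midx n) : fseries R m :=
  \big[@fs_mul R m/@fs_one R m]_(j < n) fs_exp (a j) (w j).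

(* The coefficients phi_{sp} are indexed by the monomial nu_{sp}. *)
Definition fs_delta (R : realType) (m n : nat)
    (phi : monom m -> R -> 'cV[R]_n) (t : R) (j : 'I_n) : fseries R m :=
  fun mu => if mu == mset0 then 0 else phi mu t j 0.

(* The coefficient g of the monomial mu.  For given mu only finitely many mu'
   and w contribute: a monomial of total degree d has coefficient 0 in
   eps_l * delta^w as soon as d <= |w|. *)
Definition gcoef (R : realType) (m n : nat) (D : set (R * 'cV[R]_n))
    (phi0 : R -> 'cV[R]_n) (fl : 'I_m.+1 -> R -> 'cV[R]_n -> 'cV[R]_n)
    (phi : monom m -> R -> 'cV[R]_n) (mu : monom m) (t : R) : 'cV[R]_n :=
  - (\sum_(mu' \in [set mu' : monom m | mu' <> mset0])
        (mon_dcoef mu' mu)%:R *: phi mu' t)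
  + \sum_(l < m.+1) \sum_(w \in [set: midx n])
      ((mfact w)%:R^-1 * fs_mul (fs_eps R l) (fs_mexp (fs_delta phi t) w) mu)
        *: mderiv D w (fl l) t (phi0 t).

Definition is_coefs (R : realType) (m n : nat) (t0 a : R) (A : 'M[R]_n)
    (K : set (R -> R)) (phi0 : R -> 'cV[R]_n)
    (fl : 'I_m.+1 -> R -> 'cV[R]_n -> 'cV[R]_n)
    (kappa : nat -> nat) (nu : nat -> nat -> monom m) (k : nat)
    (phi : monom m -> R -> 'cV[R]_n) : Prop :=
  forall s p, (1 <= s <= k)%N -> (p < kappa s)%N ->
    [/\ classK1v K (phi (nu s p)), Cn_in `[t0, +oo[ 1 (phi (nu s p)) &
        forall t, t0 <= t ->
          has_deriv_in `[t0, +oo[ (phi (nu s p)) t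
            (A *m phi (nu s p) t + gcoef (tube t0 a phi0) phi0 fl phi (nu s p) t)].

Definition partial_sum (R : realType) (m n : nat) (t0 : R)
    (phi0 : R -> 'cV[R]_n) (eps : 'I_m.+1 -> R -> R)
    (kappa : nat -> nat) (nu : nat -> nat -> monom m) (k : nat)
    (phi : monom m -> R -> 'cV[R]_n) (t : R) : 'cV[R]_n :=
  phi0 t + \sum_(1 <= s < k.+1) \sum_(0 <= p < kappa s)
             mon_eval `[t0, +oo[ eps (nu s p) t *: phi (nu s p) t.

Definition rhs (R : realType) (m n : nat) (A : 'M[R]_n) (f : R -> 'cV[R]_n)
    (eps : 'I_m.+1 -> R -> R) (fl : 'I_m.+1 -> R -> 'cV[R]_n -> 'cV[R]_n)
    (t : R) (y : 'cV[R]_n) : 'cV[R]_n :=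
  A *m y + f t + \sum_(l < m.+1) eps l t *: fl l t y.

Definition is_solution (R : realType) (m n : nat) (D : set (R * 'cV[R]_n))
    (A : 'M[R]_n) (f : R -> 'cV[R]_n) (eps : 'I_m.+1 -> R -> R)
    (fl : 'I_m.+1 -> R -> 'cV[R]_n -> 'cV[R]_n) (T : R) (y : R -> 'cV[R]_n) :
    Prop :=
  forall t, T <= t ->
    D (t, y t) /\ has_deriv_in `[T, +oo[ y t (rhs A f eps fl t (y t)).

(* A family of functions Y c on [T c, +oo[ which depends genuinely on the N
   scalar constants c_1, ..., c_N, ranging over E: it is continuous in c, and
   distinct constants give distinct functions.  Without continuity, the number
   N of constants would be meaningless. *)
Definition parameter_family (R : realType) (n N : nat) (E : set 'cV[R]_N)
    (T : 'cV[R]_N -> R) (Y : 'cV[R]_N -> R -> 'cV[R]_n) : Prop :=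
  (forall c t, E c -> T c < t ->
     (\forall c' \near within E (nbhs c), T c' <= t) /\
     (Y c' t @[c' --> within E (nbhs c)] --> Y c t)) /\
  (forall c c', E c -> E c' ->
     (forall t, T c <= t -> T c' <= t -> Y c t = Y c' t) -> c = c').

(* Main.v *)
Require Import Defs.
From HB Require Import structures.
From mathcomp Require Import all_boot all_order all_algebra.
From mathcomp Require Import finmap multiset.
From mathcomp Require Import complex.
From mathcomp Require Import all_classical all_reals all_analysis.
From mathcomp Require Import ring lra zify.

(* Write y = s + r and let w = eps_1 ^ (rho_(k+1) / varrho_1).  Along phi0,
   Taylor's formula for f_l turns eps_l f_l(t, s) into its formal expansion up to
   O(w), and the recursion for the coefficients cancels all the terms of rank at
   most rho_k; so the residual of s is O(w), and r solves r' = A r + F(t, r) where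
   F(t, 0) = O(w) and F is Lipschitz in r with a small constant, as eps_l -> 0.
   Since w' / w -> 0, a scalar equation z' = lambda z + g with Re lambda <> 0 and
   g = O(w) has a solution z = O(w), obtained by integrating from T if
   Re lambda < 0 and from +oo if Re lambda > 0.  Putzer's formula, which avoids
   Jordan forms, reduces a system with matrix A to such scalar equations one
   after the other.  The Lyapunov-Perron iteration then yields r = O(w), with one
   free constant for each eigenvalue of negative real part.  The coefficients are
   constructed by the same formula, the scalar equations being solved within the
   class K_1(A).  Gronwall's inequality shows that a solution depends
   continuously on its value at T and is determined by it. *)

Set Implicit Arguments.
Unset Strict Implicit.
Unset Printing Implicit Defensive.

Import Order.TTheory GRing.Theory Num.Theory.
Import numFieldNormedType.Exports.

Local Open Scope classical_set_scope.
Local Open Scope ring_scope.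

(** * Derivatives within an interval *)

Section DerivativeWithin.
Context {R : realType}.
Implicit Types (I J : set R) (t : R).

(** The bound of the linear solver must not depend on the left end [T], because [T] is chosen last:
    the radius [B] of the ball for r and the admissible Lipschitz constant are computed from it, and
    only then is [T] moved out until [eps_l], w and w'/w are small enough. The condition |w'| <= |Re
    lambda| w / 2 achieves this: each scalar solver has norm at most 8 / |Re lambda| in the norm
    weighted by w. Solutions picked by an existence statement need not depend linearly on the
    forcing; here the bound O(w), together with y(T) = 0 for stable roots, singles out one solution,
    so the solver is linear and the Picard map contracts. To count the constants, stable eigenvalues
    come first among Putzer's factors: a vector killed by the product of the first d factors, d the
    number of stable eigenvalues, starts a solution with stable modes only. A rank count gives d
    independent complex vectors of this kind; since the constants are real, d vectors with
    independent real parts are extracted. *)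

Lemma has_deriv_inP (V : normedModType R) I (f : R -> V) t l :
  has_deriv_in I f t l <->
  forall e : R, 0 < e -> exists2 d : R, 0 < d & forall u, I u -> `|u - t| < d ->
    `|f u - f t - (u - t) *: l| <= e * `|u - t|.
Proof.
split=> [/cvgrPdist_le h e e0|h].
  have := h _ e0; rewrite !near_withinE => -[d /= d0 hd].
  exists d => // u Iu utd; have [->|ut] := eqVneq u t.
    by rewrite !subrr scale0r subr0 !normr0 mulr0.
  have ut0 : u - t != 0 by rewrite subr_eq0.
  have := hd u; rewrite /ball_ /= distrC => /(_ utd ut Iu).
  move=> hl; rewrite -(scalerKV ut0 (f u - f t)) -scalerBr normrZ mulrC.
  by rewrite ler_wpM2r// distrC.
apply/cvgrPdist_le => e e0; rewrite !near_withinE; have [d d0 hd] := h _ e0.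
exists d => //= u /=; rewrite distrC => utd ut Iu.
have ut0 : u - t != 0 by rewrite subr_eq0.
have := hd u Iu utd.
rewrite -(scalerKV ut0 (f u - f t)) -scalerBr normrZ mulrC ler_pM2r ?normr_gt0//.
by rewrite (scalerKV ut0) distrC.
Qed.

Lemma within_continuousP (V : normedModType R) I (f : R -> V) :
  {within I, continuous f} <-> forall t, I t -> forall e : R, 0 < e ->
    exists2 d : R, 0 < d & forall u, I u -> `|u - t| < d -> `|f u - f t| <= e.
Proof.
split=> [/subspace_continuousP h t It e e0|h].
  have /cvgrPdist_le/(_ _ e0) := h t It.
  rewrite near_withinE => -[d /= d0 hd]; exists d => // u Iu ut.
  by rewrite distrC; apply: hd => //=; rewrite distrC.
apply/subspace_continuousP => t It; apply/cvgrPdist_le => e e0.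
rewrite near_withinE; have [d d0 hd] := h t It e e0.
by exists d => //= u /=; rewrite distrC => ut Iu; rewrite distrC; exact: hd.
Qed.

Lemma has_deriv_in_continuous (V : normedModType R) I (f : R -> V) df :
  (forall t, I t -> has_deriv_in I f t (df t)) -> {within I, continuous f}.
Proof.
move=> h; apply/within_continuousP => t It e e0.
have /has_deriv_inP/(_ 1 ltr01)[d d0 hd] := h t It.
pose M := 1 + `|df t|; have M0 : 0 < M by rewrite ltr_wpDr.
exists (Num.min d (e / M)); first by rewrite lt_min d0 divr_gt0.
move=> u Iu; rewrite lt_min => /andP[ud ue].
have := hd u Iu ud; rewrite mul1r => hu.
have : `|f u - f t| <= M * `|u - t|.
  rewrite -[f u - f t](subrK ((u - t) *: df t)).
  rewrite (le_trans (ler_normD _ _))// normrZ mulrDl mul1r.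
  by rewrite lerD// mulrC.
move=> /le_trans; apply; rewrite mulrC -ler_pdivlMr//; exact: ltW.
Qed.

Lemma has_deriv_in_sub (V : normedModType R) I J (f : R -> V) t l :
  J `<=` I -> has_deriv_in I f t l -> has_deriv_in J f t l.
Proof.
move=> JI /has_deriv_inP h; apply/has_deriv_inP => e e0.
by have [d d0 hd] := h e e0; exists d => // u /JI; exact: hd.
Qed.

Lemma has_deriv_in_ext (V : normedModType R) I (f g : R -> V) t l :
  I t -> (forall u, I u -> f u = g u) -> has_deriv_in I f t l -> has_deriv_in I g t l.
Proof.
move=> It fg /has_deriv_inP h; apply/has_deriv_inP => e e0.
by have [d d0 hd] := h e e0; exists d => // u Iu; rewrite -!fg//; exact: hd.
Qed.

Lemma has_deriv_in_cst (V : normedModType R) I (c : V) t :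
  has_deriv_in I (fun=> c) t 0.
Proof.
apply/has_deriv_inP => e e0; exists 1 => // u _ _.
by rewrite subrr scaler0 subr0 normr0 mulr_ge0// ltW.
Qed.

Lemma has_deriv_inD (V : normedModType R) I (f g : R -> V) t l k :
  has_deriv_in I f t l -> has_deriv_in I g t k ->
  has_deriv_in I (fun u => f u + g u) t (l + k).
Proof.
move=> /has_deriv_inP hf /has_deriv_inP hg; apply/has_deriv_inP => e e0.
have e20 : 0 < e / 2 by rewrite divr_gt0.
have [d d0 hd] := hf _ e20; have [d' d'0 hd'] := hg _ e20.
exists (Num.min d d'); first by rewrite lt_min d0.
move=> u Iu; rewrite lt_min => /andP[ud ud'].
have -> : f u + g u - (f t + g t) - (u - t) *: (l + k) =
  (f u - f t - (u - t) *: l) + (g u - g t - (u - t) *: k).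
  rewrite scalerDr !opprD !addrA; congr (_ + _).
  rewrite -!addrA; congr (_ + _); rewrite addrC -!addrA; congr (_ + _).
  by rewrite addrC -!addrA.
rewrite (le_trans (ler_normD _ _))// [e in leRHS](splitr e) mulrDl.
by rewrite lerD ?hd ?hd'.
Qed.

Lemma has_deriv_inZ (V : normedModType R) I (f : R -> V) t l (c : R) :
  has_deriv_in I f t l -> has_deriv_in I (fun u => c *: f u) t (c *: l).
Proof.
move=> /has_deriv_inP hf; apply/has_deriv_inP => e e0.
have c0 : 0 < `|c| + 1 by rewrite ltr_wpDl.
have [d d0 hd] := hf _ (divr_gt0 e0 c0); exists d => // u Iu ud.
rewrite scalerA mulrC -scalerA -!scalerBr normrZ.
rewrite (le_trans (ler_wpM2l (normr_ge0 _) (hd u Iu ud)))// mulrA.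
rewrite ler_wpM2r// mulrCA ger_pMr// ler_pdivrMr// mul1r.
by rewrite lerDl.
Qed.

Lemma has_deriv_inN (V : normedModType R) I (f : R -> V) t l :
  has_deriv_in I f t l -> has_deriv_in I (fun u => - f u) t (- l).
Proof.
move=> /(has_deriv_inZ (c := -1)); rewrite scaleN1r.
by under eq_fun do rewrite scaleN1r.
Qed.

Lemma has_deriv_inB (V : normedModType R) I (f g : R -> V) t l k :
  has_deriv_in I f t l -> has_deriv_in I g t k ->
  has_deriv_in I (fun u => f u - g u) t (l - k).
Proof. by move=> hf /has_deriv_inN; exact: has_deriv_inD. Qed.

Lemma has_deriv_in_sum (V : normedModType R) I (T : Type) (r : seq T)
    (P : pred T) (f : T -> R -> V) t (l : T -> V) :
  (forall i, P i -> has_deriv_in I (f i) t (l i)) ->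
  has_deriv_in I (fun u => \sum_(i <- r | P i) f i u) t (\sum_(i <- r | P i) l i).
Proof.
move=> h; elim: r => [|x r IH].
  rewrite big_nil; under eq_fun do rewrite big_nil.
  exact: has_deriv_in_cst.
rewrite big_cons; under eq_fun do rewrite big_cons.
by case: ifPn => // Px; apply: has_deriv_inD => //; exact: h.
Qed.

(** Limits within [I] are unique only at a point that other points of [I] approach, whence the
    second hypothesis; [itvcy_cluster] provides it on half-lines. *)
Lemma has_deriv_in_unique (V : normedModType R) I (f : R -> V) t l k :
  I t -> (forall d : R, 0 < d -> exists u, [/\ I u, u != t & `|u - t| < d]) ->
  has_deriv_in I f t l -> has_deriv_in I f t k -> l = k.
Proof.
move=> It hI /has_deriv_inP hl /has_deriv_inP hk; apply/eqP; rewrite -subr_eq0.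
rewrite -normr_le0; apply/ler_addgt0Pl => e e0; rewrite addr0.
have e20 : 0 < e / 2 by rewrite divr_gt0.
have [d d0 hd] := hl _ e20; have [d' d'0 hd'] := hk _ e20.
have [|u [Iu ut]] := hI (Num.min d d'); first by rewrite lt_min d0.
rewrite lt_min => /andP[ud ud'].
have E : (f u - f t - (u - t) *: k) - (f u - f t - (u - t) *: l) = (u - t) *: (l - k).
  by rewrite scalerBr opprB addrC addrA subrK.
have := le_trans (ler_normB _ _) (lerD (hd' _ Iu ud') (hd _ Iu ud)).
by rewrite E -mulrDl -splitr normrZ mulrC ler_pM2r// normr_gt0 subr_eq0.
Qed.

Lemma has_deriv_in_is_derive (V : normedModType R) I (f : R -> V) t l :
  is_derive t 1 f l -> has_deriv_in I f t l.
Proof.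
move=> [fd <-]; apply/has_deriv_inP => e e0.
have /cvgrPdist_le/(_ _ e0) := fd.
rewrite near_withinE => -[d /= d0 hd]; exists d => // u Iu ud.
have [->|ut] := eqVneq u t.
  by rewrite !subrr scale0r subr0 !normr0 mulr0.
have ut0 : u - t != 0 by rewrite subr_eq0.
have := hd (u - t); rewrite /= sub0r normrN => /(_ ud ut0).
rewrite [(u - t)%:A]mulr1 subrK distrC.
rewrite -[X in _ -> X <= _](normrN) opprB.
move=> hl; rewrite -(scalerKV ut0 (f u - f t)) -scalerBr normrZ mulrC.
by rewrite ler_wpM2r// distrC.
Qed.

Lemma is_derive_has_deriv_in (V : normedModType R) I (f : R -> V) t l :
  nbhs t I -> has_deriv_in I f t l -> is_derive t 1 f l.
Proof.
move=> nI /has_deriv_inP h.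
have c : h^-1 *: (f (h *: 1 + t) - f t) @[h --> 0^'] --> l.
  apply/cvgrPdist_le => e e0; rewrite near_withinE.
  have [d d0 hd] := h e e0; have [d' /= d'0 hd'] := nI.
  exists (Num.min d d'); first by rewrite /= lt_min d0.
  move=> x /=; rewrite sub0r normrN lt_min => /andP[xd xd'] x0.
  have := hd (x *: 1 + t); rewrite addrK [x%:A]mulr1 => /(_ _ xd).
  rewrite -(scalerKV x0 (f _ - f t)) -scalerBr normrZ mulrC.
  rewrite ler_pM2r ?normr_gt0// (scalerKV x0) distrC; apply.
  by apply: hd'; rewrite /= opprD addrCA subrr addr0 normrN.
apply: DeriveDef; first by apply/cvg_ex; exists l.
exact: cvg_lim c.
Qed.

Lemma has_deriv_in_mx (m n : nat) I (f : R -> 'M[R]_(m, n)) t l :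
  has_deriv_in I f t l <->
  forall i j, has_deriv_in I (fun u => f u i j) t (l i j).
Proof.
split=> [/has_deriv_inP h i j|h].
  apply/has_deriv_inP => e e0; have [d d0 hd] := h e e0.
  exists d => // u Iu ud; have := hd u Iu ud; apply: le_trans.
  rewrite [leRHS]/Num.Def.normr/= mx_normrE.
  apply: le_trans; last exact: (le_bigmax _ _ (i, j)).
  by rewrite !mxE.
apply/has_deriv_inP => e e0.
have {}h (ij : 'I_m * 'I_n) : exists d : R, 0 < d /\ forall u, I u -> `|u - t| < d ->
    `|f u ij.1 ij.2 - f t ij.1 ij.2 - (u - t) *: l ij.1 ij.2| <= e * `|u - t|.
  have /has_deriv_inP/(_ _ e0)[d d0 hd] := h ij.1 ij.2; by exists d.
have /choice[d hd] := h.
exists (\big[Num.min/1]_ij d ij).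
  by apply/bigmin_gtP; split=> // ij _; exact: (hd ij).1.
move=> u Iu ud; rewrite [X in X <= _]/Num.Def.normr/= mx_normrE bigmax_le//=.
  by rewrite mulr_ge0// ltW.
move=> ij _; rewrite !mxE; apply: (hd ij).2 => //.
by rewrite (lt_le_trans ud)// bigmin_le_cond.
Qed.

Lemma has_deriv_inM I (f g : R -> R) t l k :
  I t -> has_deriv_in I f t l -> has_deriv_in I g t k ->
  has_deriv_in I (fun u => f u * g u) t (l * g t + f t * k).
Proof.
move=> It /has_deriv_inP hf /has_deriv_inP hg; apply/has_deriv_inP => e e0.
(* [M] bounds the coefficients of the error terms below, whose total is [e' * (|g t| + |f t| + |l| +
   2 e') * |u - t|]; the bracket is at most [3 * M] because [e' <= e]. *)
pose M := `|f t| + `|g t| + `|l| + e + 1.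
have M0 : 0 < M by rewrite ltr_wpDl// !addr_ge0// ltW.
pose e' := e / (3 * M); have e'0 : 0 < e' by rewrite divr_gt0// mulr_gt0.
have [d d0 hd] := hf _ e'0; have [d' d'0 hd'] := hg _ e'0.
have [d2 d20 hd2] := hg _ ltr01.
(* For [|u - t| < e / K] both [(|k| + 1) * |u - t| <= e'] and [|u - t| <= 1] hold; the second one
   controls the product of [f t + a] with the error of [g]. *)
pose K := 3 * M * (`|k| + 1); have K0 : 0 < K by rewrite !mulr_gt0// ltr_wpDl.
exists (Num.min (Num.min d d') (Num.min d2 (e / K))).
  by rewrite !lt_min d0 d'0 d20 divr_gt0.
move=> u Iu; rewrite !lt_min => /andP[/andP[ud ud'] /andP[ud2 ue]].
have hu := hd u Iu ud; have hu' := hd' u Iu ud'; have hu2 := hd2 u Iu ud2.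
have gu : `|g u - g t| <= (`|k| + 1) * `|u - t|.
  rewrite -[g u - g t](subrK ((u - t) *: k)).
  by rewrite (le_trans (ler_normD _ _))// normrZ addrC mulrDl lerD// mulrC.
have -> : f u * g u - f t * g t - (u - t) *: (l * g t + f t * k) =
  (f u - f t - (u - t) *: l) * g t + (f t + (f u - f t - (u - t) *: l)) * (g u - g t - (u - t) *: k)
   + (u - t) * l * (g u - g t) + (f u - f t - (u - t) *: l) * ((u - t) *: k).
  by rewrite /GRing.scale /=; ring.
set a := f u - f t - (u - t) *: l in hu *.
set b := g u - g t - (u - t) *: k in hu' *.
set c := g u - g t in gu *.
have ut0 := normr_ge0 (u - t).
have p1 : `|a * g t| <= e' * `|u - t| * `|g t| by rewrite normrM ler_wpM2r.
have p3 : `|(u - t) * l * c| <= `|u - t| * `|l| * (e / (3 * M)).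
  rewrite !normrM ler_wpM2l ?mulr_ge0//.
  rewrite (le_trans gu)//.
  have -> : e / (3 * M) = (`|k| + 1) * (e / K).
    rewrite /K invfM; field; apply/andP; split.
      by rewrite gt_eqF// ltr_wpDl.
    by rewrite gt_eqF.
  by rewrite ler_wpM2l ?ltW// ltr_wpDl.
have p4 : `|a * ((u - t) *: k)| <= e' * `|u - t| * (e / (3 * M)).
  rewrite normrM ler_pM// normrZ.
  have -> : e / (3 * M) = (`|k| + 1) * (e / K).
    rewrite /K invfM; field; apply/andP; split.
      by rewrite gt_eqF// ltr_wpDl.
    by rewrite gt_eqF.
  by rewrite mulrC; apply: ler_pM => //; [rewrite lerDl|exact: ltW].
have p2 : `|(f t + a) * b| <= (`|f t| + e') * (e' * `|u - t|) + 0.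
  rewrite addr0 normrM; have [ut1|ut1] := leP `|u - t| 1.
    rewrite ler_pM// (le_trans (ler_normD _ _))// lerD2l (le_trans hu)//.
    by rewrite ler_piMr// ltW.
  exfalso; move: ut1; apply/negP; rewrite -leNgt.
  rewrite (le_trans (ltW ue))// ler_pdivrMr// mul1r /K.
  have : e <= M by rewrite /M; move: (normr_ge0 (f t)) (normr_ge0 (g t)) (normr_ge0 l); lra.
  have : 0 <= M * `|k| by rewrite mulr_ge0// ltW.
  by move: M0; lra.
rewrite (le_trans (ler_normD _ _))//.
rewrite (le_trans (lerD (ler_normD _ _) p4))//.
rewrite (le_trans (lerD (lerD (ler_normD _ _) p3) (lexx _)))//.
rewrite (le_trans (lerD (lerD (lerD p1 p2) (lexx _)) (lexx _)))// addr0.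
rewrite -/e'.
have -> : e' * `|u - t| * `|g t| + (`|f t| + e') * (e' * `|u - t|) + `|u - t| * `|l| * e' + e' * `|u - t| * e'
  = e' * (`|g t| + `|f t| + `|l| + 2 * e') * `|u - t| by ring.
rewrite ler_wpM2r//.
have -> : e = e' * (3 * M).
  by rewrite /e' mulfVK// gt_eqF// mulr_gt0.
rewrite ler_wpM2l ?ltW//.
have e'e : e' <= e.
  by rewrite /e' ler_piMr ?ltW// invf_lte1 ?mulr_gt0// /M; move: (normr_ge0 (f t)) (normr_ge0 (g t)) (normr_ge0 l); lra.
by rewrite /M; move: (normr_ge0 (f t)) (normr_ge0 (g t)) (normr_ge0 l); lra.
Qed.

End DerivativeWithin.

(** * Mean value theorem and primitives on intervals *)

Section DerivativeWithinIntervals.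
Context {R : realType}.
Implicit Types (I : set R) (t : R).

Lemma cV_norm_le (n : nat) (v : 'cV[R]_n) (c : R) : 0 <= c ->
  (`|v| <= c) <-> forall i, `|v i 0| <= c.
Proof.
move=> c0; split=> [vc i|h].
  apply: le_trans vc; rewrite [leRHS]/Num.Def.normr/= mx_normrE.
  exact: (le_bigmax _ (fun x : 'I_n * 'I_1 => `|v x.1 x.2|) (i, 0)).
rewrite [X in X <= _]/Num.Def.normr/= mx_normrE bigmax_le//= => -[i j] _ /=.
by rewrite ord1.
Qed.

Lemma cV_coord_le (n : nat) (v : 'cV[R]_n) i : `|v i 0| <= `|v|.
Proof. exact: (iffLR (cV_norm_le v (normr_ge0 v)) (lexx _)). Qed.

Lemma within_continuous_cV (n : nat) (T : topologicalType) (I : set T)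
    (f : T -> 'cV[R]_n) :
  {within I, continuous f} <-> forall i, {within I, continuous (fun t : T => f t i 0)}.
Proof.
split=> [/subspace_continuousP h i|h].
  apply/subspace_continuousP => t It; apply/cvgrPdist_le => e e0.
  have /cvgrPdist_le/(_ _ e0) := h t It.
  apply: filterS => u; apply: le_trans.
  by have := cV_coord_le (f t - f u) i; rewrite !mxE.
apply/subspace_continuousP => t It; apply/cvgrPdist_le => e e0.
near=> u; apply/(cV_norm_le _ (ltW e0)) => i; rewrite !mxE.
move: i; near: u; apply: filter_forall => i.
have /subspace_continuousP/(_ t It)/cvgrPdist_le/(_ _ e0) := h i.
by [].
Unshelve. all: by end_near. Qed.

Lemma has_deriv_in_cV (n : nat) I (f : R -> 'cV[R]_n) t l :
  has_deriv_in I f t l <->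
  forall i, has_deriv_in I (fun u => f u i 0) t (l i 0).
Proof.
split=> [/has_deriv_in_mx h i //|h]; apply/has_deriv_in_mx => i j.
by rewrite ord1.
Qed.

Lemma has_deriv_in_cVZ (n : nat) I (g : R -> R) (f : R -> 'cV[R]_n) t k l :
  I t -> has_deriv_in I g t k -> has_deriv_in I f t l ->
  has_deriv_in I (fun u => g u *: f u) t (k *: f t + g t *: l).
Proof.
move=> It hg /has_deriv_in_cV hf; apply/has_deriv_in_cV => i; rewrite !mxE.
under eq_fun do rewrite mxE.
exact: has_deriv_inM.
Qed.

Lemma nbhs_itvoo (a b t : R) I :
  (forall u, a <= u <= b -> I u) -> a < t < b -> nbhs t I.
Proof.
move=> hI tab.
have : t \in `]a, b[ by rewrite in_itv/=.
move=> /near_in_itvoo; apply: filterS => u; rewrite in_itv /= => /andP[au ub].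
by apply: hI; rewrite !ltW.
Qed.

(** At an interior point of [[a, b]] the set [I] is a neighbourhood, so the derivative within [I] is
    the two-sided one; at the end points continuity is enough. *)
Lemma has_deriv_in_mvt I (f df : R -> R) (a b : R) : a < b ->
  (forall t, a <= t <= b -> I t) ->
  (forall t, a <= t <= b -> has_deriv_in I f t (df t)) ->
  exists2 c, a < c < b & f b - f a = df c * (b - a).
Proof.
move=> ab hI h; have [| |c] := @MVT R f df a b ab; last first.
- by rewrite in_itv /= => cab e; exists c.
- apply: (has_deriv_in_continuous (df := df)) => t /=; rewrite in_itv /= => tab.
  apply: has_deriv_in_sub (h t tab) => u /=; rewrite in_itv /=; exact: hI.
- move=> t; rewrite in_itv /= => tab.
  apply: (is_derive_has_deriv_in (nbhs_itvoo hI tab)); apply: h.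
  by case/andP: tab => *; rewrite !ltW.
Qed.

Lemma has_deriv_in_ge0 I (f df : R -> R) (a b : R) : a <= b ->
  (forall t, a <= t <= b -> I t) ->
  (forall t, a <= t <= b -> has_deriv_in I f t (df t)) ->
  (forall t, a < t < b -> 0 <= df t) -> f a <= f b.
Proof.
rewrite le_eqVlt => /predU1P[->//|ab] hI h h0.
have [c cab e] := has_deriv_in_mvt ab hI h.
by rewrite -subr_ge0 e mulr_ge0 ?subr_ge0 ?h0// ltW.
Qed.

Lemma has_deriv_in_bound I (f df : R -> R) (M a b : R) : a <= b ->
  (forall t, a <= t <= b -> I t) ->
  (forall t, a <= t <= b -> has_deriv_in I f t (df t)) ->
  (forall t, a < t < b -> `|df t| <= M) -> `|f b - f a| <= M * (b - a).
Proof.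
rewrite le_eqVlt => /predU1P[->|ab] hI h h0; first by rewrite !subrr normr0 mulr0.
have [c cab ->] := has_deriv_in_mvt ab hI h.
by rewrite normrM (gtr0_norm (x := b - a)) ?subr_gt0// ler_wpM2r ?h0// subr_ge0 ltW.
Qed.

Lemma has_deriv_in_cst_eq I (f : R -> R) (a b : R) : a <= b ->
  (forall t, a <= t <= b -> I t) ->
  (forall t, a <= t <= b -> has_deriv_in I f t 0) -> f b = f a.
Proof.
move=> ab hI h; apply/eqP; rewrite -subr_eq0 -normr_le0.
rewrite (le_trans (has_deriv_in_bound (M := 0) ab hI h _)) ?mul0r// => t _.
by rewrite normr0.
Qed.

Lemma has_deriv_in_deriv (V : normedModType R) I (f : R -> V) t l :
  has_deriv_in I f t l -> has_deriv_in I f t (deriv_in I f t).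
Proof. by move=> h; apply: cvgP h. Qed.

Lemma itvcy_cluster (T t : R) : T <= t -> forall d : R, 0 < d ->
  exists u, [/\ `[T, +oo[%classic u, u != t & `|u - t| < d].
Proof.
move=> Tt d d0; exists (t + d / 2); rewrite /= in_itv /= andbT.
have d20 : 0 < d / 2 by rewrite divr_gt0.
split; first by rewrite (le_trans Tt)// lerDl ltW.
  by rewrite -subr_eq0 addrC addKr gt_eqF.
rewrite addrC addKr gtr0_norm// ltr_pdivrMr// ltr_pMr//.
by rewrite ltr1n.
Qed.

Lemma itvcyP (T t : R) : `[T, +oo[%classic t <-> T <= t.
Proof. by rewrite /= in_itv /= andbT. Qed.

Lemma itvcy_sub (T T' : R) : T <= T' -> `[T', +oo[%classic `<=` `[T, +oo[%classic.
Proof. by move=> TT' t /itvcyP h; apply/itvcyP; exact: le_trans h. Qed.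

Lemma deriv_inE (V : normedModType R) (T : R) (f : R -> V) t l : T <= t ->
  has_deriv_in `[T, +oo[ f t l -> deriv_in `[T, +oo[ f t = l.
Proof.
move=> Tt h; apply: (has_deriv_in_unique _ _ (has_deriv_in_deriv h) h).
  exact/itvcyP.
exact: itvcy_cluster.
Qed.

Lemma nbhs_itvcy (T t : R) : T < t -> nbhs t `[T, +oo[%classic.
Proof.
move=> Tt; apply: (@nbhs_itvoo T (t + 1)); last by rewrite Tt ltrDl /=.
by move=> u /andP[Tu _]; apply/itvcyP.
Qed.

Lemma has_primitive (T : R) (k : R -> R) : {within `[T, +oo[, continuous k} ->
  exists K : R -> R, K T = 0 /\
    forall t, T <= t -> has_deriv_in `[T, +oo[ K t (k t).
Proof.
(* [h] continues [k] by the constant [k T] to the left of [T]; integrating from [T - 1] then gives a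
   two-sided derivative at [T] as well. *)
move=> hk; pose h t := k (Num.max T t).
have hc : continuous h.
  move=> t; apply/cvgrPdist_le => e e0.
  have /within_continuousP/(_ (Num.max T t) _ e e0) := hk.
  case; first by apply/itvcyP; rewrite le_max lexx.
  move=> d d0 hd; exists d => //= u /= ut; rewrite distrC.
  apply: hd; first by apply/itvcyP; rewrite le_max lexx.
  rewrite distrC in ut; apply: le_lt_trans ut.
  have := ler_norm (u - t); have := ler_norm (- (u - t)); rewrite normrN ler_norml.
  by have [] := leP T u; have [] := leP T t => *; apply/andP; split; lra.
pose F x := (\int[lebesgue_measure]_(t in `[T - 1, x]) h t)%R.
have hF t : T <= t -> is_derive t 1 F (h t).
  move=> Tt; have [||||+ <-] := @continuous_FTC1_closed R h (T - 1) t (t + 1).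
  - by rewrite ltrDl.
  - apply: continuous_compact_integrable; first exact: segment_compact.
    exact: continuous_subspaceT.
  - by lra.
  - exact: hc.
  by move=> Fd; rewrite derive1E; exact/derivableP.
exists (fun t => F t - F T); split; first by rewrite subrr.
move=> t Tt; rewrite -[k t]subr0; apply: has_deriv_inB; last exact: has_deriv_in_cst.
apply: has_deriv_in_is_derive; have := hF t Tt.
by rewrite /h max_r.
Qed.

End DerivativeWithinIntervals.

(** * Scalar linear equations *)

Section ScalarExponentials.
Context {R : realType}.
Variables (T : R) (w dw : R -> R) (al : R).
Hypothesis w_gt0 : forall t, T <= t -> 0 < w t.
Hypothesis w_deriv : forall t, T <= t -> has_deriv_in `[T, +oo[ w t (dw t).
Hypothesis dw_le : forall t, T <= t -> `|dw t| <= `|al| / 2 * w t.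

Let I : set R := `[T, +oo[%classic.

Lemma has_deriv_in_expR (b t : R) :
  has_deriv_in I (fun u => expR (b * (u - T))) t (b * expR (b * (t - T))).
Proof.
apply: has_deriv_in_is_derive.
have -> : b * expR (b * (t - T)) = (b * (1 - 0)) * expR (b * (t - T)).
  by rewrite subr0 mulr1.
have h : is_derive t 1 (fun u : R => b * (u - T)) (b *: (1 - 0)).
  exact: is_deriveZ.
have := @is_derive1_comp R expR _ t _ _ (is_derive_expR _) h.
by rewrite mulrC; apply.
Qed.

Lemma has_deriv_in_cos (b t : R) :
  has_deriv_in I (fun u => cos (b * u)) t (- b * sin (b * t)).
Proof.
apply: has_deriv_in_is_derive.
have h : is_derive t 1 (fun u : R => b * u) (b *: 1) by exact: is_deriveZ.
have := @is_derive1_comp R cos _ t _ _ (is_derive_cos _) h.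
by rewrite mulNr -mulrN mulrC [b *: 1]mulr1; apply.
Qed.

Lemma has_deriv_in_sin (b t : R) :
  has_deriv_in I (fun u => sin (b * u)) t (b * cos (b * t)).
Proof.
apply: has_deriv_in_is_derive.
have h : is_derive t 1 (fun u : R => b * u) (b *: 1) by exact: is_deriveZ.
have := @is_derive1_comp R sin _ t _ _ (is_derive_sin _) h.
by rewrite mulrC [b *: 1]mulr1; apply.
Qed.

Let E t := expR (- al * (t - T)).

Let E_gt0 t : 0 < E t. Proof. exact: expR_gt0. Qed.

Let dwE t : T <= t -> (- (`|al| / 2) * w t <= dw t) * (dw t <= `|al| / 2 * w t).
Proof. by move=> /dw_le; rewrite ler_norml mulNr => /andP[]. Qed.

Let Iab a b : T <= a -> forall t, a <= t <= b -> I t.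
Proof. by move=> Ta t /andP[at_ _]; apply/itvcyP; exact: le_trans at_. Qed.

Let Ew_deriv c t : T <= t ->
  has_deriv_in I (fun u => c * (E u * w u)) t
    (c * (E t * (dw t - al * w t))).
Proof.
move=> Tt.
have h := has_deriv_inM ((itvcyP T t).2 Tt) (@has_deriv_in_expR (- al) t) (w_deriv Tt).
have := has_deriv_inZ (c := c) h; congr (has_deriv_in _ _ _ _).
by rewrite /E /GRing.scale /=; ring.
Qed.

(** The slow weight makes [E * w] nondecreasing when [al < 0]: w loses at most the relative rate
    [|al| / 2], while [E] gains [|al|]. *)
Lemma stable_exp_le (t : R) : al < 0 -> T <= t ->
  expR (al * (t - T)) <= w t / w T.
Proof.
move=> al0 Tt; have wT := w_gt0 (lexx T).
have : 1 * (E T * w T) <= 1 * (E t * w t).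
  apply: (has_deriv_in_ge0 (f := fun u => 1 * (E u * w u))
    (df := fun u => 1 * (E u * (dw u - al * w u))) Tt (Iab (lexx T))).
    by move=> u /andP[Tu _]; apply: Ew_deriv.
  move=> u /andP[/ltW Tu _]; rewrite mul1r; apply: mulr_ge0; first exact/ltW/E_gt0.
  have [] := dwE Tu; rewrite ltr0_norm//.
  have : 0 <= - al * w u by rewrite mulr_ge0 ?oppr_ge0 ?ltW// w_gt0.
  lra.
rewrite !mul1r /E subrr mulr0 expR0 mul1r mulNr expRN => h.
by rewrite ler_pdivlMr// mulrC -ler_pdivlMr ?expR_gt0// mulrC.
Qed.

Section Forced.
Variables (k : R -> R) (M : R).
Hypothesis k_cont : {within `[T, +oo[, continuous k}.
Hypothesis k_le : forall t, T <= t -> `|k t| <= M * w t.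
Hypothesis al_neq0 : al != 0.

Let M_ge0 : 0 <= M.
Proof.
have := le_trans (normr_ge0 _) (k_le (lexx T)).
by rewrite pmulr_lge0// w_gt0.
Qed.

(** The weight uses up at most half of the rate [|al|]; the other half has to absorb the forcing
    [M * w], which dictates [C * (|al| / 2) = M]. *)
Let C := M * 2 / `|al|.

Let C_ge0 : 0 <= C.
Proof. by rewrite divr_ge0// mulr_ge0. Qed.

Let CE : C * (`|al| / 2) = M.
Proof. by rewrite /C; field; rewrite normr_eq0. Qed.

Let primE : exists K, K T = 0 /\ forall t, T <= t -> has_deriv_in I K t (E t * k t).
Proof.
apply: has_primitive; apply/subspace_continuousP => t /itvcyP Tt.
apply: cvgM; last by move/subspace_continuousP: k_cont; apply; apply/itvcyP.
have /subspace_continuousP : {within I, continuous E}.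
  by apply: has_deriv_in_continuous => u _; exact: has_deriv_in_expR.
by apply; apply/itvcyP.
Qed.

Let sol_of K l : (forall t, T <= t -> has_deriv_in I K t (E t * k t)) ->
  forall t, T <= t ->
    has_deriv_in I (fun u => (K u - l) * expR (al * (u - T))) t
      (al * ((K t - l) * expR (al * (t - T))) + k t).
Proof.
move=> hK t Tt.
have h := has_deriv_inM ((itvcyP T t).2 Tt)
  (has_deriv_inB (hK t Tt) (@has_deriv_in_cst _ _ I l t)) (@has_deriv_in_expR al t).
move: h; congr (has_deriv_in _ _ _ _).
have -> : E t = (expR (al * (t - T)))^-1 by rewrite /E mulNr expRN.
by field; rewrite gt_eqF// expR_gt0.
Qed.

Let Ee t x y : (`|x| <= y * (E t * w t)) -> `|x * expR (al * (t - T))| <= y * w t.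
Proof.
rewrite normrM (gtr0_norm (expR_gt0 _)) /E mulNr expRN => h.
rewrite -ler_pdivlMr ?expR_gt0// (le_trans h)//.
by rewrite mulrA mulrAC.
Qed.

(** Variation of constants with a primitive [K] of [E * k]. Instead of estimating an integral,
    [C * (E * w) - s * K] is shown to be nondecreasing for [s = 1] and [s = -1], which bounds
    [|K|]. *)
Lemma stable_forced : al < 0 -> exists v : R -> R, [/\ v T = 0,
  forall t, T <= t -> has_deriv_in `[T, +oo[ v t (al * v t + k t) &
  forall t, T <= t -> `|v t| <= C * w t].
Proof.
move=> al0; have [K [KT hK]] := primE.
exists (fun t => (K t - 0) * expR (al * (t - T))); split.
- by rewrite KT subrr mul0r.
- exact: sol_of.
move=> t Tt; apply: Ee; rewrite subr0.
have aux s : `|s| = 1 -> s * K t <= C * (E t * w t).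
  move=> s1; rewrite -subr_ge0.
  have /le_trans : 0 <= C * (E T * w T) - s * K T.
    by rewrite KT mulr0 subr0 mulr_ge0// mulr_ge0// ltW// w_gt0.
  apply; apply: (has_deriv_in_ge0 (f := fun u => C * (E u * w u) - s * K u)
    (df := fun u => C * (E u * (dw u - al * w u)) - s * (E u * k u)) Tt (Iab (lexx T))).
    move=> u /andP[Tu _]; apply: has_deriv_inB; first exact: Ew_deriv.
    exact: has_deriv_inZ (hK u Tu).
  move=> u /andP[/ltW Tu _].
  have -> : C * (E u * (dw u - al * w u)) - s * (E u * k u) =
    E u * (C * (dw u - al * w u) - s * k u) by ring.
  apply: mulr_ge0; [exact/ltW/E_gt0|rewrite subr_ge0].
  have : s * k u <= M * w u.
    by rewrite (le_trans (ler_norm _))// normrM s1 mul1r k_le.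
  move=> /le_trans; apply; rewrite -CE -mulrA ler_wpM2l//.
  by have [] := dwE Tu; rewrite ltr0_norm//; lra.
rewrite ler_norml; have := aux 1 (normr1 _); have := aux (-1).
by rewrite normrN1 mul1r mulN1r lerNl => /(_ erefl) -> ->.
Qed.

(** The small solution needs the value of [K] at infinity. Since [K - Phi] is nondecreasing and
    [K + Phi] is nonincreasing, the supremum of [K - Phi] lies between them at every [t];
    subtracting it gives [|K t - sup A| <= Phi t], which is the desired bound after multiplication
    by the exponential. *)
Lemma unstable_forced : 0 < al -> exists v : R -> R,
  (forall t, T <= t -> has_deriv_in `[T, +oo[ v t (al * v t + k t)) /\
  (forall t, T <= t -> `|v t| <= C * w t).
Proof.
move=> al0; have [K [KT hK]] := primE.
pose Phi t := C * (E t * w t).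
have Phi0 t : T <= t -> 0 <= Phi t.
  by move=> Tt; rewrite mulr_ge0// mulr_ge0// ltW// w_gt0.
have mono s a b : `|s| = 1 -> T <= a -> a <= b -> s * K b + Phi b <= s * K a + Phi a.
  move=> s1 Ta ab; rewrite -lerN2.
  apply: (has_deriv_in_ge0 (f := fun u => - (s * K u + Phi u))
    (df := fun u => - (s * (E u * k u) + C * (E u * (dw u - al * w u)))) ab (Iab Ta)).
    move=> u /andP[au _]; have Tu := le_trans Ta au.
    apply: has_deriv_inN; apply: has_deriv_inD; last exact: Ew_deriv.
    exact: has_deriv_inZ (hK u Tu).
  move=> u /andP[/ltW au _]; have Tu := le_trans Ta au.
  have -> : - (s * (E u * k u) + C * (E u * (dw u - al * w u))) =
    E u * (C * (al * w u - dw u) - s * k u) by ring.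
  apply: mulr_ge0; [exact/ltW/E_gt0|rewrite subr_ge0].
  have : s * k u <= M * w u.
    by rewrite (le_trans (ler_norm _))// normrM s1 mul1r k_le.
  move=> /le_trans; apply; rewrite -CE -mulrA ler_wpM2l//.
  by have [] := dwE Tu; rewrite gtr0_norm//; lra.
have monoD := mono 1 _ _ (normr1 _).
have monoB a b : T <= a -> a <= b -> K a - Phi a <= K b - Phi b.
  by move=> Ta ab; have := mono (-1) a b (normrN1 _) Ta ab; lra.
have cross a b : T <= a -> T <= b -> K a - Phi a <= K b + Phi b.
  move=> Ta Tb; have [ab|ba] := leP a b.
    by have := monoB a b Ta ab; have := Phi0 b Tb; lra.
  by have := monoD b a Tb (ltW ba); have := Phi0 a Ta; lra.
pose A := [set K t - Phi t | t in I].
have hA : has_sup A.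
  split; first by exists (K T - Phi T), T => //; apply/itvcyP.
  exists (K T + Phi T) => _ [t /itvcyP Tt <-]; exact: cross.
exists (fun t => (K t - sup A) * expR (al * (t - T))); split.
  exact: sol_of.
move=> t Tt; apply: Ee; rewrite ler_norml; apply/andP; split.
  rewrite lerBrDl; have : sup A <= K t + Phi t; last by rewrite /Phi; lra.
  by apply: ge_sup; [exact: hA.1|move=> _ [u /itvcyP Tu <-]; exact: cross].
rewrite lerBlDl; have : K t - Phi t <= sup A; last by rewrite /Phi; lra.
by apply: ub_le_sup; [exact: hA.2|exists t => //; apply/itvcyP].
Qed.

End Forced.

End ScalarExponentials.

(** * Complex scalar equations in the norm weighted by w *)

Section ComplexScalarEquation.
Context {R : realType}.
Implicit Types (I : set R) (y z g : R -> R[i]).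

Definition has_cderiv_in I y t (l : R[i]) : Prop :=
  has_deriv_in I (fun u => complex.Re (y u)) t (complex.Re l) /\
  has_deriv_in I (fun u => complex.Im (y u)) t (complex.Im l).

Lemma ReM (a b : R[i]) : complex.Re (a * b) =
  complex.Re a * complex.Re b - complex.Im a * complex.Im b.
Proof. by case: a b => ? ? []. Qed.

Lemma ImM (a b : R[i]) : complex.Im (a * b) =
  complex.Re a * complex.Im b + complex.Im a * complex.Re b.
Proof. by case: a b => ? ? []. Qed.

Lemma ReD (a b : R[i]) : complex.Re (a + b) = complex.Re a + complex.Re b.
Proof. by case: a b => ? ? []. Qed.

Lemma ImD (a b : R[i]) : complex.Im (a + b) = complex.Im a + complex.Im b.
Proof. by case: a b => ? ? []. Qed.

Lemma has_cderiv_inD I y z t l k : has_cderiv_in I y t l -> has_cderiv_in I z t k ->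
  has_cderiv_in I (fun u => y u + z u) t (l + k).
Proof.
move=> [yr yi] [zr zi]; split; rewrite ?ReD ?ImD.
  by under eq_fun do rewrite ReD; exact: has_deriv_inD.
by under eq_fun do rewrite ImD; exact: has_deriv_inD.
Qed.

Lemma has_cderiv_inZ I y t l (c : R[i]) : has_cderiv_in I y t l ->
  has_cderiv_in I (fun u => c * y u) t (c * l).
Proof.
move=> [yr yi]; split; rewrite ?ReM ?ImM.
  under eq_fun do rewrite ReM; apply: has_deriv_inB; exact: has_deriv_inZ.
by under eq_fun do rewrite ImM; apply: has_deriv_inD; exact: has_deriv_inZ.
Qed.

Lemma has_cderiv_in0 I t : has_cderiv_in I (fun=> 0) t 0.
Proof. by split; exact: has_deriv_in_cst. Qed.

Lemma has_cderiv_in_sum I (S : Type) (r : seq S) (y : S -> R -> R[i]) t l :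
  (forall i, has_cderiv_in I (y i) t (l i)) ->
  has_cderiv_in I (fun u => \sum_(i <- r) y i u) t (\sum_(i <- r) l i).
Proof.
move=> h; elim: r => [|x r IH].
  rewrite big_nil; under [X in has_cderiv_in _ X]eq_fun do rewrite big_nil.
  exact: has_cderiv_in0.
rewrite big_cons; under [X in has_cderiv_in _ X]eq_fun do rewrite big_cons.
exact: has_cderiv_inD.
Qed.

Definition cabs (c : R[i]) : R := `|complex.Re c| + `|complex.Im c|.

Section Weighted.
Variables (T : R) (w : R -> R).

Definition cweighted (M : R) g : Prop :=
  [/\ {within `[T, +oo[, continuous (fun t => complex.Re (g t))},
      {within `[T, +oo[, continuous (fun t => complex.Im (g t))} &
      forall t, T <= t ->
        `|complex.Re (g t)| <= M * w t /\ `|complex.Im (g t)| <= M * w t].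

Lemma cweightedD M N g h : cweighted M g -> cweighted N h ->
  cweighted (M + N) (fun t => g t + h t).
Proof.
move=> [gr gi gb] [hr hi hb]; split.
- rewrite (_ : (fun t => _) = (fun t => complex.Re (g t) + complex.Re (h t))).
    exact: within_continuousD.
  by apply/funext => t; rewrite ReD.
- rewrite (_ : (fun t => _) = (fun t => complex.Im (g t) + complex.Im (h t))).
    exact: within_continuousD.
  by apply/funext => t; rewrite ImD.
move=> t Tt; rewrite ReD ImD mulrDl; have [? ?] := gb t Tt; have [? ?] := hb t Tt.
by split; rewrite (le_trans (ler_normD _ _))// lerD.
Qed.

Lemma within_continuous_scale (I : set R) (f : R -> R) (c : R) :
  {within I, continuous f} -> {within I, continuous (fun t => c * f t)}.
Proof.
move=> /subspace_continuousP h; apply/subspace_continuousP => t It.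
by apply: cvgM; [exact: cvg_cst|exact: h].
Qed.

Lemma cweightedZ M g c : cweighted M g -> cweighted (cabs c * M) (fun t => c * g t).
Proof.
move=> [gr gi gb]; split.
- rewrite (_ : (fun t => _) = (fun t => complex.Re c * complex.Re (g t) - complex.Im c * complex.Im (g t))).
    by apply: within_continuousB; exact: within_continuous_scale.
  by apply/funext => t; rewrite ReM.
- rewrite (_ : (fun t => _) = (fun t => complex.Re c * complex.Im (g t) + complex.Im c * complex.Re (g t))).
    by apply: within_continuousD; exact: within_continuous_scale.
  by apply/funext => t; rewrite ImM.
move=> t Tt; rewrite ReM ImM -mulrA mulrDl; have [? ?] := gb t Tt.
by split; [rewrite (le_trans (ler_normB _ _))// | rewrite (le_trans (ler_normD _ _))//];
  rewrite !normrM lerD// ler_wpM2l.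
Qed.

Lemma cweighted0 : cweighted 0 (fun=> 0).
Proof.
split; [exact/continuous_subspaceT/cst_continuous..|].
by move=> t _; rewrite normr0 mul0r.
Qed.

Variables (dw : R -> R) (lam : R[i]).
Let al := complex.Re lam.
Let be := complex.Im lam.
Hypothesis w_gt0 : forall t, T <= t -> 0 < w t.
Hypothesis w_deriv : forall t, T <= t -> has_deriv_in `[T, +oo[ w t (dw t).
Hypothesis dw_le : forall t, T <= t -> `|dw t| <= `|al| / 2 * w t.
Hypothesis al_neq0 : al != 0.

(** The conditions single out one solution: for [al < 0] every homogeneous solution is O(w), so the
    value at [T] is fixed; for [al > 0] the bound alone excludes the nonzero ones. *)
Definition decaying_solution g y : Prop :=
  [/\ forall t, T <= t -> has_cderiv_in `[T, +oo[ y t (lam * y t + g t),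
      exists M, cweighted M y & al < 0 -> y T = 0].

(** Passing to the rotating frame doubles the bound of the forcing, the real equation multiplies it
    by [2 / |al|], and rotating back doubles it again. Neither [T] nor [w] enters. *)
Definition solver_cst : R := 8 / `|al|.

Let Itp t : T <= t -> `[T, +oo[%classic t. Proof. by move=> Tt; apply/itvcyP. Qed.

(* In the rotating frame e^(- i be t) y the real and imaginary parts decouple. *)
Lemma decaying_solution_exists M g : cweighted M g ->
  exists y, decaying_solution g y /\ cweighted (solver_cst * M) y.
Proof.
move=> [gr gi gb].
pose c t : R := cos (be * t); pose s t : R := sin (be * t).
pose G t := complex.Re (g t); pose H t := complex.Im (g t).
have cc : {within `[T, +oo[, continuous c}.
  by apply: has_deriv_in_continuous => t _; exact: has_deriv_in_cos.
have sc : {within `[T, +oo[, continuous s}.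
  by apply: has_deriv_in_continuous => t _; exact: has_deriv_in_sin.
have cM (f h : R -> R) : {within `[T, +oo[, continuous f} ->
    {within `[T, +oo[, continuous h} -> {within `[T, +oo[, continuous (fun t => f t * h t)}.
  move=> /subspace_continuousP hf /subspace_continuousP hh.
  by apply/subspace_continuousP => t It; apply: cvgM; [exact: hf|exact: hh].
have c1 t : `|c t| <= 1 by exact: cos_max.
have s1 t : `|s t| <= 1 by exact: sin_max.
have mix (x y p q N : R) : `|x| <= 1 -> `|y| <= 1 -> `|p| <= N -> `|q| <= N ->
    `|x * p + y * q| <= 2 * N.
  move=> x1 y1 pN qN; rewrite (le_trans (ler_normD _ _))// !normrM mulr2n mulrDl mul1r.
  by rewrite lerD// -[N]mul1r ler_pM.
pose k1 t := c t * G t + s t * H t; pose k2 t := c t * H t + - s t * G t.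
have Ns1 t : `|- s t| <= 1 by rewrite normrN.
have k1b t : T <= t -> `|k1 t| <= (2 * M) * w t.
  by move=> Tt; have [? ?] := gb t Tt; rewrite -mulrA mix.
have k2b t : T <= t -> `|k2 t| <= (2 * M) * w t.
  by move=> Tt; have [? ?] := gb t Tt; rewrite -mulrA mix.
have k1c : {within `[T, +oo[, continuous k1} by apply: within_continuousD; exact: cM.
have k2c : {within `[T, +oo[, continuous k2}.
  apply: within_continuousD; first exact: cM.
  apply: cM => //; rewrite (_ : (fun t => _) = (fun t => (-1) * s t)).
    exact: within_continuous_scale.
  by apply/funext => t; rewrite mulN1r.
have sol k : {within `[T, +oo[, continuous k} -> (forall t, T <= t -> `|k t| <= (2 * M) * w t) ->
  exists v : R -> R, [/\ forall t, T <= t -> has_deriv_in `[T, +oo[ v t (al * v t + k t),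
    forall t, T <= t -> `|v t| <= 4 / `|al| * M * w t & al < 0 -> v T = 0].
  move=> kc kb; have E t : 2 * M * 2 / `|al| * w t = 4 / `|al| * M * w t.
    by field; rewrite normr_eq0.
  have [al0|al0|/eqP] := ltgtP al 0; last by rewrite (negPf al_neq0).
    have [v [v1 v2 v3]] := stable_forced w_gt0 w_deriv dw_le kc kb al_neq0 al0.
    by exists v; split=> // t Tt; rewrite -E v3.
  have [v [v2 v3]] := unstable_forced w_gt0 w_deriv dw_le kc kb al_neq0 al0.
  by exists v; split=> // t Tt; rewrite -E v3.
have [v [v1 v2 v3]] := sol k1 k1c k1b.
have [v' [v1' v2' v3']] := sol k2 k2c k2b.
pose y t : R[i] := Complex (c t * v t + - s t * v' t) (c t * v' t + s t * v t).
have dy t : T <= t -> has_cderiv_in `[T, +oo[ y t (lam * y t + g t).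
  move=> Tt; have cs : c t * c t + s t * s t = 1 by rewrite -!expr2 cos2Dsin2.
  have hc := @has_deriv_in_cos R T be t; have hs := @has_deriv_in_sin R T be t.
  split; rewrite ?ReD ?ImD ?ReM ?ImM /y /=.
    have := has_deriv_inB (has_deriv_inM (Itp Tt) hc (v1 t Tt))
                          (has_deriv_inM (Itp Tt) hs (v1' t Tt)).
    under [X in has_deriv_in _ X _ _]eq_fun do rewrite -mulNr.
    congr (has_deriv_in _ _ _ _); rewrite -[complex.Re (g t)]mul1r -cs -/al -/be.
    by rewrite /k1 /k2 /G /H -/(c t) -/(s t); ring.
  have := has_deriv_inD (has_deriv_inM (Itp Tt) hc (v1' t Tt))
                        (has_deriv_inM (Itp Tt) hs (v1 t Tt)).
  congr (has_deriv_in _ _ _ _); rewrite -[complex.Im (g t)]mul1r -cs -/al -/be.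
  by rewrite /k1 /k2 /G /H -/(c t) -/(s t); ring.
have wy : cweighted (solver_cst * M) y.
  split.
  - by apply: (@has_deriv_in_continuous _ _ _ _ (fun t => complex.Re (lam * y t + g t))) => t /itvcyP Tt; case: (dy t Tt).
  - by apply: (@has_deriv_in_continuous _ _ _ _ (fun t => complex.Im (lam * y t + g t))) => t /itvcyP Tt; case: (dy t Tt).
  move=> t Tt; have -> : solver_cst * M * w t = 2 * (4 / `|al| * M * w t).
    by rewrite /solver_cst; field; rewrite normr_eq0.
  by split; rewrite /y /= mix ?v2 ?v2'.
exists y; split=> //; split=> //; first by exists (solver_cst * M).
by move=> al0; rewrite /y v3// v3'// !mulr0 addr0.
Qed.

Lemma decaying_solutionB g h y z : decaying_solution g y -> decaying_solution h z ->
  decaying_solution (fun t => g t - h t) (fun t => y t - z t).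
Proof.
move=> [dy [M wy] y0] [dz [N wz] z0].
have E t : y t - z t = y t + (-1) * z t by rewrite mulN1r.
split.
- move=> t Tt; have := has_cderiv_inD (dy t Tt) (has_cderiv_inZ (-1) (dz t Tt)).
  by under [X in has_cderiv_in _ X]eq_fun do rewrite mulN1r;
    congr (has_cderiv_in _ _ _ _); ring.
- exists (M + cabs (-1) * N).
  by under eq_fun do rewrite E; apply: cweightedD => //; exact: cweightedZ.
- by move=> al0; rewrite y0// z0// subrr.
Qed.

(** Along a homogeneous solution [|y|^2 * exp(- 2 al (u - T))] is constant. For [al < 0] it vanishes
    at [T]; for [al > 0] a nonzero value would make [|y|] grow like [exp(al u)], whereas [w] grows
    at most like [exp(al u / 2)]. *)
Lemma decaying_solution_unique0 y : decaying_solution (fun=> 0) y ->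
  forall t, T <= t -> y t = 0.
Proof.
move=> [dy [M [_ _ wy]] y0] t Tt.
pose q u := complex.Re (y u) * complex.Re (y u) + complex.Im (y u) * complex.Im (y u).
pose e u : R := expR (- 2 * al * (u - T)).
have he u : T <= u -> has_deriv_in `[T, +oo[ (fun u => q u * e u) u 0.
  move=> Tu; have [hr hi] := dy u Tu.
  have := has_deriv_inM (Itp Tu) (has_deriv_inD (has_deriv_inM (Itp Tu) hr hr)
     (has_deriv_inM (Itp Tu) hi hi)) (@has_deriv_in_expR R T (- 2 * al) u).
  congr (has_deriv_in _ _ _ _); rewrite !addr0 ReM ImM -/al -/be /q.
  ring.
have qE u : T <= u -> q u * e u = q T.
  move=> Tu; have /= := has_deriv_in_cst_eq Tu (fun v (h : T <= v <= u) =>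
    (itvcyP T v).2 (proj1 (andP h))) (fun v (h : T <= v <= u) => he v (proj1 (andP h))).
  by move=> ->; rewrite /e subrr mulr0 expR0 mulr1.
have q0 u : 0 <= q u by rewrite addr_ge0// -expr2 sqr_ge0.
suff qT : q T = 0.
  have : q t = 0.
    have /eqP := qE t Tt; rewrite qT mulf_eq0 => /orP[/eqP//|].
    by rewrite gt_eqF// expR_gt0.
  move/eqP; rewrite paddr_eq0 -?expr2 ?sqr_ge0// !sqrf_eq0 => /andP[/eqP a /eqP b].
  by apply/eqP; rewrite eq_complex a b !eqxx.
have [al0|al0|/eqP] := ltgtP al 0; last by rewrite (negPf al_neq0).
  by rewrite /q y0//= mul0r addr0.
apply/eqP; rewrite eq_le q0 andbT leNgt; apply/negP => qT0.
pose e1 u : R := expR (- al / 2 * (u - T)).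
have we u : T <= u -> e1 u * w u <= w T.
  move=> Tu; have -> : w T = e1 T * w T by rewrite /e1 subrr mulr0 expR0 mul1r.
  rewrite -lerN2.
  apply: (@has_deriv_in_ge0 _ _ (fun v => - (e1 v * w v))
   (fun v => - (- al / 2 * e1 v * w v + e1 v * dw v)) _ _ Tu
   (fun v (h : T <= v <= u) => (itvcyP T v).2 (proj1 (andP h)))).
    move=> v /andP[Tv _]; apply: has_deriv_inN.
    exact: has_deriv_inM (Itp Tv) (@has_deriv_in_expR R T _ v) (w_deriv Tv).
  move=> v /andP[/ltW Tv _].
  have -> : - (- al / 2 * e1 v * w v + e1 v * dw v) = e1 v * (al / 2 * w v - dw v) by ring.
  apply: mulr_ge0; first exact/ltW/expR_gt0.
  by rewrite subr_ge0 -[al]gtr0_norm// (le_trans (ler_norm _))// dw_le.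
have qle u : T <= u -> q T * expR (al * (u - T)) <= 2 * (M * w T) ^+ 2.
  move=> Tu; rewrite -(qE u Tu) -mulrA.
  have -> : e u * expR (al * (u - T)) = e1 u * e1 u.
    by rewrite /e /e1 -!expRD; congr expR; field.
  have [rb ib] := wy u Tu.
  have M0 : 0 <= M.
    by have := le_trans (normr_ge0 _) rb; rewrite pmulr_lge0// w_gt0.
  have b x : `|x| <= M * w u -> x * x * (e1 u * e1 u) <= (M * w T) ^+ 2.
    move=> xb; have -> : x * x * (e1 u * e1 u) = (x * e1 u) ^+ 2 by ring.
    rewrite -[leLHS]ger0_norm ?sqr_ge0// normrX ler_sqr ?nnegrE ?normr_ge0// ?mulr_ge0// ?(ltW (w_gt0 _))//.
    rewrite normrM (gtr0_norm (expR_gt0 _)) (le_trans (ler_wpM2r (ltW (expR_gt0 _)) xb))//.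
    rewrite -[leLHS]mulrA; apply: ler_wpM2l => //; rewrite mulrC; exact: we.
  by rewrite /q mulrDl mulr2n mulrDl mul1r lerD ?b.
pose D := 2 * (M * w T) ^+ 2.
have D0 : 0 <= D by rewrite mulr_ge0// sqr_ge0.
(* At [T + x] the inequality [exp z >= 1 + z] with [z = al * x = D / q T] already contradicts the
   upper bound [D]. *)
pose x := D / q T / al; have x0 : 0 <= x by do 2 (apply: divr_ge0; last exact: ltW).
have := qle (T + x); rewrite lerDl [T + x]addrC addrK => /(_ x0); apply/negP.
rewrite -ltNge -ltr_pdivrMl//; apply: lt_le_trans (expR_ge1Dx _).
rewrite /x mulrC [al * _]mulrC mulfVK ?gt_eqF// -/D.
by rewrite ltrDr.
Qed.

(** Chosen among the decaying solutions, with the zero function as default. Uniqueness on [[T, +oo[]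
    gives linearity there in spite of the choice. *)
Definition csolve g : R -> R[i] := xget (fun=> 0) (decaying_solution g).

(** [decaying_solution] asserts only some bound; the explicit one holds for the constructed solution
    and is carried over to the chosen one by uniqueness. *)
Lemma csolveP M g : cweighted M g ->
  decaying_solution g (csolve g) /\ cweighted (solver_cst * M) (csolve g).
Proof.
move=> wg; have [y [dy wy]] := decaying_solution_exists wg.
have dc : decaying_solution g (csolve g) by apply: xgetPex; exists y.
split=> //.
have yE t : T <= t -> csolve g t = y t.
  move=> Tt; apply/eqP; rewrite -subr_eq0; apply/eqP.
  apply: (decaying_solution_unique0 (y := fun t => csolve g t - y t)) => //.
  have := decaying_solutionB dc dy; under eq_fun do rewrite subrr.
  exact.
have [_ [N [? ? _]] _] := dc; split=> // t Tt; rewrite yE//.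
by have [_ _ /(_ t Tt)] := wy.
Qed.

Lemma csolveB M N g h : cweighted M g -> cweighted N h -> forall t, T <= t ->
  csolve (fun u => g u - h u) t = csolve g t - csolve h t.
Proof.
move=> wg wh t Tt; apply/eqP; rewrite -subr_eq0; apply/eqP.
have wgh : cweighted (M + cabs (-1) * N) (fun u => g u - h u).
  have := cweightedD wg (cweightedZ (-1) wh).
  by under eq_fun do rewrite mulN1r.
have [dg _] := csolveP wg; have [dh _] := csolveP wh; have [dgh _] := csolveP wgh.
have := decaying_solutionB dgh (decaying_solutionB dg dh).
under eq_fun do rewrite subrr.
by move=> /decaying_solution_unique0; exact.
Qed.

End Weighted.

End ComplexScalarEquation.

(** * Putzer's formula *)

Section Putzer.
Context {R : realType} {n : nat}.
Local Notation C := R[i].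
Variables (A : 'M[R]_n) (l : nat -> C).

Definition cplx_mx (m p : nat) (B : 'M[R]_(m, p)) : 'M[C]_(m, p) :=
  map_mx (real_complex R) B.

Definition Re_mx (m p : nat) (B : 'M[C]_(m, p)) : 'M[R]_(m, p) :=
  map_mx (@complex.Re R) B.

Fixpoint putzer_mx (j : nat) : 'M[C]_n :=
  if j is j'.+1 then (cplx_mx A - (l j')%:M) *m putzer_mx j' else 1%:M.

Definition cv_deriv_in (I : set R) (Z : R -> 'cV[C]_n) t (L : 'cV[C]_n) : Prop :=
  forall i, has_cderiv_in I (fun u => Z u i 0) t (L i 0).

Lemma cv_deriv_inD I Y Z t L M : cv_deriv_in I Y t L -> cv_deriv_in I Z t M ->
  cv_deriv_in I (fun u => Y u + Z u) t (L + M).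
Proof.
move=> hY hZ i; rewrite mxE.
under [X in has_cderiv_in _ X]eq_fun do rewrite mxE.
exact: has_cderiv_inD.
Qed.

Lemma cv_deriv_in_mulmx I (B : 'M[C]_n) Z t L : cv_deriv_in I Z t L ->
  cv_deriv_in I (fun u => B *m Z u) t (B *m L).
Proof.
move=> hZ i; rewrite mxE.
under [X in has_cderiv_in _ X]eq_fun do rewrite mxE.
by apply: has_cderiv_in_sum => k; exact: has_cderiv_inZ.
Qed.

Lemma Re_sum (S : Type) (r : seq S) (F : S -> C) :
  complex.Re (\sum_(i <- r) F i) = \sum_(i <- r) complex.Re (F i).
Proof. by elim: r => [|x r IH]; rewrite ?big_nil// !big_cons ReD IH. Qed.

Lemma Re_mx_mul (B : 'M[R]_n) (z : 'cV[C]_n) :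
  Re_mx (cplx_mx B *m z) = B *m Re_mx z.
Proof.
apply/matrixP => i j; rewrite !mxE Re_sum; apply: eq_bigr => k _.
by rewrite ReM !mxE /= mul0r subr0.
Qed.

Lemma Re_mxD (m p : nat) (y z : 'M[C]_(m, p)) : Re_mx (y + z) = Re_mx y + Re_mx z.
Proof. by apply/matrixP => i j; rewrite !mxE ReD. Qed.

Lemma Re_mxN (m p : nat) (y : 'M[C]_(m, p)) : Re_mx (- y) = - Re_mx y.
Proof. by apply/matrixP => i j; rewrite !mxE; case: (y i j). Qed.

Lemma cv_deriv_in_Re I Z t L : cv_deriv_in I Z t L ->
  has_deriv_in I (fun u => Re_mx (Z u)) t (Re_mx L).
Proof.
move=> hZ; apply/has_deriv_in_cV => i; rewrite !mxE.
by under [X in has_deriv_in _ X]eq_fun do rewrite mxE; case: (hZ i).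
Qed.

(** From [A P_j = P_(j+1) + l_j P_j] the sum telescopes and leaves the defect [P_(N+1) U_N]. It is
    kept in the statement because it vanishes in two ways: by Cayley-Hamilton for the full product,
    and on special vectors for a shorter one. *)
Lemma putzer_deriv I (U : nat -> R -> 'cV[C]_n) (G : 'cV[C]_n) (N : nat) t :
  cv_deriv_in I (U 0%N) t (l 0%N *: U 0%N t + G) ->
  (forall j, (j < N)%N -> cv_deriv_in I (U j.+1) t (l j.+1 *: U j.+1 t + U j t)) ->
  cv_deriv_in I (fun u => \sum_(j < N.+1) putzer_mx j *m U j u) t
    (cplx_mx A *m (\sum_(j < N.+1) putzer_mx j *m U j t) + G
     - putzer_mx N.+1 *m U N t).
Proof.
move=> h0; elim: N => [|N IH] hS.
  under [X in cv_deriv_in _ X]eq_fun do rewrite big_ord1 mul1mx.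
  rewrite big_ord1 mul1mx /= mulmx1 mulmxBl mul_scalar_mx opprB.
  suff -> : cplx_mx A *m U 0%N t + G + (l 0%N *: U 0%N t - cplx_mx A *m U 0%N t) =
    l 0%N *: U 0%N t + G by [].
  by rewrite addrC addrA subrK.
under [X in cv_deriv_in _ X]eq_fun do rewrite big_ord_recr.
rewrite big_ord_recr.
have := cv_deriv_inD (IH (fun j jN => hS j (ltnW jN)))
  (cv_deriv_in_mulmx (putzer_mx N.+1) (hS N (ltnSn N))).
congr (cv_deriv_in _ _ _ _).
rewrite mulmxDr mulmxDr -!addrA; congr (_ + _).
rewrite [putzer_mx N.+2]/= -/(putzer_mx N.+1) !mulmxBl mul_scalar_mx.
set X := cplx_mx A *m _; set Y := putzer_mx N.+1 *m U N t.
rewrite -scalemxAr -scalemxAl mulmxA -/X opprB.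
rewrite [- Y + _]addrC addrK [in RHS]addrC -!addrA; congr (_ + _).
by rewrite /X /= !mulmxA addNr addr0.
Qed.

Section Solver.
Variables (T : R) (Kc : R -> (R -> C) -> Prop) (cst : nat -> R)
  (S : nat -> (R -> C) -> (R -> C)) (N : nat).
Hypothesis KcD : forall M M' g h, Kc M g -> Kc M' h -> Kc (M + M') (fun t => g t + h t).
Hypothesis KcZ : forall M g c, Kc M g -> Kc (cabs c * M) (fun t => c * g t).
Hypothesis Kc0 : Kc 0 (fun=> 0).
Hypothesis S_class : forall j M g, (j <= N)%N -> Kc M g -> Kc (cst j * M) (S j g).
Hypothesis S_sol : forall j M g, (j <= N)%N -> Kc M g -> forall t, T <= t ->
  has_cderiv_in `[T, +oo[ (S j g) t (l j * S j g t + g t).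

(** The predicate [Kc] has two readings: continuity with the bound [M * w], or membership in K_1(A),
    where [M] is a dummy. The construction relies only on closure under sums and complex multiples
    and on the scalar solvers. *)
Definition Kcv (M : R) (G : R -> 'cV[C]_n) : Prop :=
  forall i, Kc M (fun t => G t i 0).

Definition entrywise (s : (R -> C) -> (R -> C)) (G : R -> 'cV[C]_n) (t : R) : 'cV[C]_n :=
  \col_i s (fun u => G u i 0) t.

Fixpoint putzer_fun (G : R -> 'cV[C]_n) (j : nat) : R -> 'cV[C]_n :=
  entrywise (S j) (if j is j'.+1 then putzer_fun G j' else G).

Definition putzer_sol (G : R -> 'cV[C]_n) (t : R) : 'cV[C]_n :=
  \sum_(j < N.+1) putzer_mx j *m putzer_fun G j t.

Definition putzer_cst (i : 'I_n) : R :=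
  \sum_(j < N.+1) \sum_k cabs (putzer_mx j i k) * \prod_(q < j.+1) cst q.

Lemma Kc_sum (J : Type) (r : seq J) (M : J -> R) (g : J -> R -> C) :
  (forall j, Kc (M j) (g j)) ->
  Kc (\sum_(j <- r) M j) (fun t => \sum_(j <- r) g j t).
Proof.
move=> h; elim: r => [|x r IH].
  by rewrite big_nil; under [X in Kc _ X]eq_fun do rewrite big_nil.
by rewrite big_cons; under [X in Kc _ X]eq_fun do rewrite big_cons; exact: KcD.
Qed.

Lemma Kcv_entrywise M G j : (j <= N)%N -> Kcv M G -> Kcv (cst j * M) (entrywise (S j) G).
Proof.
by move=> jN KG i; under eq_fun do rewrite mxE; exact: S_class.
Qed.

Lemma putzer_fun_class M G j : (j <= N)%N -> Kcv M G ->
  Kcv (\prod_(q < j.+1) cst q * M) (putzer_fun G j).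
Proof.
move=> + KG; elim: j => [|j IH] jN.
  by rewrite big_ord1; exact: Kcv_entrywise.
rewrite big_ord_recr /= [X in X * M]mulrC -mulrA.
exact/Kcv_entrywise/IH/ltnW.
Qed.

Lemma putzer_sol_class M G : Kcv M G ->
  forall i, Kc (putzer_cst i * M) (fun t => putzer_sol G t i 0).
Proof.
move=> KG i; rewrite /putzer_cst mulr_suml /putzer_sol.
under [X in Kc _ X]eq_fun do rewrite summxE; apply: (Kc_sum (J := 'I_N.+1)) => j.
rewrite mulr_suml; under [X in Kc _ X]eq_fun do rewrite mxE.
apply: (Kc_sum (J := 'I_n)) => k; rewrite -mulrA; apply: KcZ.
by apply: putzer_fun_class => //; rewrite -ltnS.
Qed.

Lemma putzer_sol_deriv M G t : Kcv M G -> T <= t -> putzer_mx N.+1 = 0 ->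
  cv_deriv_in `[T, +oo[ (putzer_sol G) t (cplx_mx A *m putzer_sol G t + G t).
Proof.
move=> KG Tt P0.
have := @putzer_deriv `[T, +oo[%classic (putzer_fun G) (G t) N t.
rewrite P0 mul0mx subr0; apply.
  move=> i; rewrite !mxE; under [X in has_cderiv_in _ X]eq_fun do rewrite mxE.
  exact: (S_sol (M := M)).
move=> j jN i; rewrite !mxE; under [X in has_cderiv_in _ X]eq_fun do rewrite mxE.
by apply: (S_sol (M := \prod_(q < j.+1) cst q * M)) => //; exact: (putzer_fun_class (ltnW jN)).
Qed.

Hypothesis S_ext : forall j g h, (forall t, T <= t -> g t = h t) -> S j g = S j h.
Hypothesis S_sub : forall j M M' g h, (j <= N)%N -> Kc M g -> Kc M' h ->
  forall t, T <= t -> S j (fun u => g u - h u) t = S j g t - S j h t.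

(** The scalar solvers are linear only on [[T, +oo[], so before this is applied at the next level
    the forcing is replaced, through [S_ext], by the difference that it equals there. *)
Lemma putzer_solB M M' G H t : Kcv M G -> Kcv M' H -> T <= t ->
  putzer_sol (fun u => G u - H u) t = putzer_sol G t - putzer_sol H t.
Proof.
move=> KG KH Tt; rewrite /putzer_sol -sumrB; apply: eq_bigr => j _.
rewrite -mulmxBr; congr (_ *m _).
have : (j <= N)%N by rewrite -ltnS.
elim: (j : nat) t Tt => [|k IH] t Tt kN /=.
  apply/matrixP => i j'; rewrite !mxE.
  under [X in S _ X]eq_fun do rewrite !mxE.
  exact: (S_sub (M := M) (M' := M')).
apply/matrixP => i j'; rewrite !mxE.
rewrite (S_ext _ (h := fun u => putzer_fun G k u i 0 - putzer_fun H k u i 0)).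
  apply: (S_sub (M := \prod_(q < k.+1) cst q * M) (M' := \prod_(q < k.+1) cst q * M')) => //.
    exact: (putzer_fun_class (ltnW kN)).
  exact: (putzer_fun_class (ltnW kN)).
by move=> u Tu; rewrite IH// ?(ltnW kN)// !mxE.
Qed.

End Solver.

End Putzer.

(** * The stable subspace and a real basis of initial values *)

Section StableSubspace.
Context {R : realType} {n : nat}.
Local Notation C := R[i].

Definition stable_root (z : C) : bool := complex.Re z < 0.

(** Adding [E], of rank at most the number of rows outside [D], turns these rows into unit rows; the
    sum is triangular with nonzero diagonal, hence invertible. *)
Lemma trig_mxsub_rank (B : 'M[C]_n) (D : pred 'I_n) :
  is_trig_mx B -> (forall i, D i -> B i i != 0) -> (#|D| <= \rank B)%N.
Proof.
move=> /is_trig_mxP Bt hD.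
pose E : 'M[C]_n := \sum_(i | ~~ D i) delta_mx i i *m (1%:M - B).
have rkE : (\rank E <= #|predC D|)%N.
  rewrite -sum1_card; apply: (big_ind2 (fun (X : 'M[C]_n) k => \rank X <= k)%N).
  - by rewrite mxrank0.
  - by move=> X x Y y hX hY; apply: leq_trans (mxrank_add _ _) (leq_add hX hY).
  - by move=> i _; rewrite (leq_trans (mxrankM_maxl _ _))// mxrank_delta.
have EB : E + B = \matrix_(i, j) if D i then B i j else (i == j)%:R.
  apply/matrixP => i j; rewrite !mxE /E summxE.
  have term k : (delta_mx k k *m (1%:M - B)) i j =
      if i == k then (i == j)%:R - B i j else 0.
    rewrite mxE (bigD1 k)//= big1 => [|q qk]; last first.
      by rewrite mxE (negPf qk) andbF mul0r.
    rewrite !mxE eqxx andbT addr0; case: eqP => [->|_]; last by rewrite mul0r.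
    by rewrite mul1r.
  under eq_bigr do rewrite term.
  rewrite -big_mkcondr /=; case: ifPn => Di.
    by rewrite big1 ?add0r// => k /andP[+ /eqP ki]; rewrite -ki Di.
  rewrite (big_pred1 i) ?subrK// => k /=.
  by rewrite [i == k]eq_sym; case: eqP => [->|]; rewrite ?Di ?andbF.
have : \rank (E + B)%R = n.
  apply/eqP; rewrite -[_ == _]/(row_free _) row_free_unit unitmxE det_trig.
    rewrite unitfE; apply/prodf_neq0 => i _; rewrite EB mxE.
    by case: ifPn => [/hD//|_]; rewrite eqxx oner_eq0.
  apply/is_trig_mxP => i j ij; rewrite EB mxE Bt//.
  by case: ifP => // _; rewrite -val_eqE /= ltn_eqF.
have := leq_trans (mxrank_add E B) (leq_add rkE (leqnn _)).
have := cardC D; rewrite card_ord => h + h2.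
by rewrite h2 -[X in (X <= _)%N]h addnC leq_add2l.
Qed.

Variables (A : 'M[R]_n) (lam : 'I_n -> C).
Hypothesis charA : char_poly (cplx_mx A) = \prod_(j < n) ('X - (lam j)%:P).

(** Stable roots come first so that the first [d] factors of Putzer's product are exactly the stable
    ones. *)
Definition sorted_spectrum : seq C :=
  [seq z <- codom lam | stable_root z] ++ [seq z <- codom lam | ~~ stable_root z].

Let l := nth 0 sorted_spectrum.
Let d := #|[pred j | stable_root (lam j)]|.

Lemma perm_sorted_spectrum : perm_eq sorted_spectrum (codom lam).
Proof. by rewrite perm_filterC. Qed.

Lemma size_sorted_spectrum : size sorted_spectrum = n.
Proof. by rewrite (perm_size perm_sorted_spectrum) size_codom card_ord. Qed.

Lemma size_stable_spectrum : size [seq z <- codom lam | stable_root z] = d.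
Proof. by rewrite size_filter /codom /image_mem count_map /d cardE size_filter enumT. Qed.

Lemma sorted_spectrum_codom j : (j < n)%N -> exists i, l j = lam i.
Proof.
move=> jn; have : l j \in codom lam.
  by rewrite -(perm_mem perm_sorted_spectrum) mem_nth ?size_sorted_spectrum.
by move=> /codomP[i ->]; exists i.
Qed.

Lemma sorted_spectrum_stable j : (j < d)%N -> stable_root (l j).
Proof.
move=> jd; rewrite /l /sorted_spectrum nth_cat size_stable_spectrum jd.
have := mem_nth 0 (s := [seq z <- codom lam | stable_root z]) (n := j).
by rewrite size_stable_spectrum => /(_ jd); rewrite mem_filter => /andP[].
Qed.

Lemma sorted_spectrum_unstable j : (d <= j < n)%N -> ~~ stable_root (l j).
Proof.
move=> /andP[dj jn]; rewrite /l /sorted_spectrum nth_cat size_stable_spectrum ltnNge dj /=.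
have := mem_nth 0 (s := [seq z <- codom lam | ~~ stable_root z]) (n := (j - d)%N).
have : size sorted_spectrum = n by exact: size_sorted_spectrum.
rewrite size_cat size_stable_spectrum => szn.
have -> : (j - d < size [seq z <- codom lam | ~~ stable_root z])%N by lia.
by move=> /(_ isT); rewrite mem_filter => /andP[].
Qed.

Lemma stable_le : (d <= n)%N.
Proof. by rewrite -[X in (_ <= X)%N]card_ord max_card. Qed.

Lemma charA_seq : char_poly (cplx_mx A) = \prod_(z <- sorted_spectrum) ('X - z%:P).
Proof.
rewrite charA (perm_big _ perm_sorted_spectrum) /codom /image_mem big_map.
by rewrite /index_enum enumT.
Qed.

Lemma charA_sorted : char_poly (cplx_mx A) = \prod_(j < n) ('X - (l j)%:P).
Proof. by rewrite charA_seq (big_nth 0) size_sorted_spectrum big_mkord. Qed.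

Lemma putzer_mxE (j : nat) : putzer_mx A l j.+1 = (cplx_mx A - (l j)%:M) *m putzer_mx A l j.
Proof. by []. Qed.

Lemma putzer_mx_full : putzer_mx A l n = 0.
Proof.
case: n A lam charA @l @d charA_sorted => [|n'] A' lam' _ l' _ cA.
  by apply/matrixP => -[].
rewrite -[RHS](Cayley_Hamilton (cplx_mx A')) cA.
have gen j : putzer_mx A' l' j = horner_mx (cplx_mx A') (\prod_(0 <= i < j) ('X - (l' i)%:P)).
  elim: j => [|j IH]; first by rewrite big_geq// rmorph1.
  have -> : \prod_(0 <= i < j.+1) ('X - (l' i)%:P) =
      ('X - (l' j)%:P) * \prod_(0 <= i < j) ('X - (l' i)%:P).
    by rewrite big_nat_recr//= mulrC.
  rewrite (rmorphM (horner_mx (cplx_mx A'))) [X in _ * X](esym IH).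
  by rewrite rmorphB /= horner_mx_X horner_mx_C.
by rewrite gen big_mkord.
Qed.

(* The trailing factors (A - l_(n-1)) ... (A - l_d). *)
Let tail_mx (B : 'M[C]_n) (k : nat) : 'M[C]_n :=
  iteri k (fun j M => (B - (l (d + j)%N)%:M) *m M) 1%:M.

Lemma putzer_mx_tail k : putzer_mx A l (d + k) = tail_mx (cplx_mx A) k *m putzer_mx A l d.
Proof.
elim: k => [|k IH]; first by rewrite addn0 mul1mx.
by rewrite addnS putzer_mxE IH mulmxA.
Qed.

(** In a Schur basis the product is triangular, with diagonal entries [prod_j (J i i - l (d + j))].
    They do not vanish where [J i i] is stable, since every [l (d + j)] is unstable, and there are
    [d] such places. *)
Lemma rank_tail : (d <= \rank (tail_mx (cplx_mx A) (n - d)))%N.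
Proof.
have [n0|n_gt0] := posnP n.
  by have := stable_le; lia.
have [P /unitarymx_unit Pu] := Schur (cplx_mx A) n_gt0.
rewrite /similar_to conjumx// => Jt; set J := P *m cplx_mx A *m invmx P in Jt.
have tailJ k : tail_mx J k = P *m tail_mx (cplx_mx A) k *m invmx P.
  elim: k => [|k IH]; first by rewrite /= mulmx1 mulmxV.
  rewrite /= -/(tail_mx J k) IH -/(tail_mx _ k) !mulmxA; congr (_ *m _ *m _).
  rewrite /J mulmxBl mul_scalar_mx mulmxBr mul_mx_scalar mulmxKV//.
have Pf : row_full P by rewrite row_full_unit.
have P'f : row_free (invmx P) by rewrite row_free_unit unitmx_inv.
rewrite -(mxrankMfree _ P'f) -(eqmxMfull _ Pf) mulmxA -tailJ.
have charJ : char_poly (cplx_mx A) = \prod_(z <- [seq J i i | i <- enum 'I_n]) ('X - z%:P).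
  rewrite big_map big_enum -char_poly_trig// /char_poly /char_poly_mx.
  pose Q := map_mx (polyC : C -> {poly C}) P; pose Q' := map_mx (polyC : C -> {poly C}) (invmx P).
  have QQ : Q *m Q' = 1%:M by rewrite -map_mxM mulmxV// map_mx1.
  have -> : 'X%:M - map_mx polyC J = Q *m ('X%:M - map_mx polyC (cplx_mx A)) *m Q'.
    rewrite mulmxBr mulmxBl /J !map_mxM -/Q -/Q'; congr (_ - _).
    by rewrite mul_mx_scalar -scalemxAl QQ scalemx1.
  by rewrite !det_mulmx mulrAC -det_mulmx QQ det1 mul1r.
have dE : #|[pred i | stable_root (J i i)]| = d.
  have := charA_seq; rewrite charJ => /prod_XsubC_eq/permP/(_ stable_root).
  rewrite (permP perm_sorted_spectrum) /codom /image_mem !count_map.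
  by rewrite /d !cardE /enum_mem !size_filter.
have [tt td] : is_trig_mx (tail_mx J (n - d)) /\
    forall i, stable_root (J i i) -> tail_mx J (n - d) i i != 0.
  have tail_trig k : is_trig_mx (tail_mx J k) /\ forall i,
      tail_mx J k i i = \prod_(j < k) (J i i - l (d + j)%N).
    elim: k => [|k [/is_trig_mxP IHt IHd]].
      split; first exact: scalar_mx_is_trig.
      by move=> i; rewrite /= mxE eqxx big_ord0.
    have /is_trig_mxP Jlt : is_trig_mx (J - (l (d + k)%N)%:M).
      apply/is_trig_mxP => i j ij; have /is_trig_mxP Jt' := Jt; rewrite mxE [X in _ + X]mxE [X in - X]mxE Jt'// -val_eqE /=.
      by rewrite ltn_eqF// mulr0n subrr.
    rewrite /= -/(tail_mx J k); split.
      apply/is_trig_mxP => i j ij; rewrite mxE big1// => q _.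
      have [qj|jq] := ltnP q j; first by rewrite IHt// mulr0.
      by rewrite Jlt ?mul0r// (leq_trans ij).
    move=> i; rewrite mxE (bigD1 i)//= big1 => [|q qi].
      by rewrite addr0 IHd big_ord_recr /= mulrC !mxE eqxx.
    have [qi'|iq|/val_inj/eqP] := ltngtP q i; last by rewrite (negPf qi).
      by rewrite IHt// mulr0.
    by rewrite Jlt// mul0r.
  split; first by case: (tail_trig (n - d)%N).
  move=> i Ji; rewrite (tail_trig _).2; apply/prodf_neq0 => j _.
  rewrite subr_eq0; apply/eqP => Jl; have := @sorted_spectrum_unstable (d + j)%N.
  rewrite leq_addr -ltn_subRL ltn_ord => /(_ isT).
  by rewrite -/(l _) -Jl Ji.
by rewrite -[X in (X <= _)%N]dE; apply: trig_mxsub_rank => // i; exact: td.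
Qed.

(** The tail times [putzer_mx A l d] is the full product, which is zero, so the rank of the tail
    limits that of the stable factors. Equivalently, the kernel of the product of the stable factors
    has dimension at least [d]. *)
Lemma rank_putzer : (\rank (putzer_mx A l d) <= n - d)%N.
Proof.
have : tail_mx (cplx_mx A) (n - d) *m putzer_mx A l d = 0.
  by rewrite -putzer_mx_tail subnKC ?stable_le// putzer_mx_full.
by move=> /mulmx0_rank_max; have := rank_tail; have := stable_le; lia.
Qed.

(** Real and imaginary parts of kernel vectors are both real parts of kernel vectors, because
    [Im z = Re (- i z)]; together they span a real space of dimension at least [d], from which [d]
    independent rows are taken. *)
Lemma stable_real_basis : exists V : 'M[C]_(d, n),
  V *m (putzer_mx A l d)^T = 0 /\ row_free (Re_mx V).
Proof.
have [Kr [Kr0 rkK]] : exists Kr : 'M[C]_n, Kr *m (putzer_mx A l d)^T = 0 /\ (d <= \rank Kr)%N.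
  exists (kermx (putzer_mx A l d)^T); split; first exact: mulmx_ker.
  by rewrite mxrank_ker mxrank_tr; have := rank_putzer; have := stable_le; lia.
pose ReK := Re_mx Kr; pose ImK := map_mx (@complex.Im R) Kr.
pose W := col_mx ReK ImK.
(* Over C the rows of [W] generate those of [Kr], and the rank of a real matrix does not change
   under extension to C. *)
have KW : Kr = row_mx 1%:M ('i%C)%:M *m cplx_mx W.
  rewrite /cplx_mx map_col_mx mul_row_col mul1mx mul_scalar_mx.
  apply/matrixP => i j; rewrite !mxE; exact: complexE.
have rkW : (d <= \rank W)%N.
  by rewrite (leq_trans rkK)// KW (leq_trans (mxrankM_maxr _ _))// mxrank_map.
have /submxP[D DW] : (row_base W <= W)%MS by rewrite eq_row_base.
pose X := (pid_mx d : 'M[R]_(d, \rank W)) *m row_base W.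
have Xf : row_free X.
  by rewrite /row_free mxrankMfree ?row_base_free// rank_pid_mx.
pose E := (pid_mx d : 'M[R]_(d, \rank W)) *m D.
have XE : X = lsubmx E *m ReK + rsubmx E *m ImK.
  by rewrite -mul_row_col hsubmxK -mulmxA -DW.
(* For [z = x + i y] the real part of [(E1 - i E2) z] is [E1 x + E2 y], the combination that defines
   [X]. *)
exists ((cplx_mx (lsubmx E) - 'i%C *: cplx_mx (rsubmx E)) *m Kr); split.
  by rewrite -mulmxA Kr0 mulmx0.
suff -> : Re_mx ((cplx_mx (lsubmx E) - 'i%C *: cplx_mx (rsubmx E)) *m Kr) = X by [].
rewrite XE; apply/matrixP => i j; rewrite !mxE Re_sum -big_split /=.
apply: eq_bigr => k _; rewrite !mxE; case: (Kr k j) => x y /=.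
by ring.
Qed.

End StableSubspace.

(** * The hyperbolic system: forced solutions and decaying homogeneous ones *)

Section HyperbolicLinearSystem.
Context {R : realType} {n : nat}.
Local Notation C := R[i].

(** The defining predicate reads the forcing only on [[T, +oo[], so the chosen solutions agree as
    functions and not merely on that half-line. *)
Lemma csolve_ext (T : R) (w : R -> R) (lam : C) (g h : R -> C) :
  (forall t, T <= t -> g t = h t) -> csolve T w lam g = csolve T w lam h.
Proof.
move=> gh; rewrite /csolve; congr (xget _ _); apply/funext => y; apply/propext.
split=> -[dy wy y0]; split=> // t Tt; have := dy t Tt; by rewrite gh.
Qed.

Definition rweighted (T : R) (w : R -> R) (M : R) (G : R -> 'cV[R]_n) : Prop :=
  {within `[T, +oo[, continuous G} /\ forall t, T <= t -> `|G t| <= M * w t.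

Section FixedInterval.
Variables (A : 'M[R]_n) (lam : 'I_n -> C).
Hypothesis charA : char_poly (cplx_mx A) = \prod_(j < n) ('X - (lam j)%:P).
Hypothesis hyp : forall j, complex.Re (lam j) != 0.
Hypothesis n_gt0 : (0 < n)%N.
Variables (T : R) (w dw : R -> R).
Hypothesis w_gt0 : forall t, T <= t -> 0 < w t.
Hypothesis w_deriv : forall t, T <= t -> has_deriv_in `[T, +oo[ w t (dw t).
Hypothesis dw_le : forall j t, T <= t -> `|dw t| <= `|complex.Re (lam j)| / 2 * w t.

Let l := nth 0 (sorted_spectrum lam).
Let d := #|[pred j | stable_root (lam j)]|.

Let l_neq0 j : (j < n)%N -> complex.Re (l j) != 0.
Proof. by move=> jn; have [i E] := sorted_spectrum_codom lam jn; rewrite /l E. Qed.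

Let dw_l j : (j < n)%N -> forall t, T <= t -> `|dw t| <= `|complex.Re (l j)| / 2 * w t.
Proof.
by move=> jn; have [i E] := sorted_spectrum_codom lam jn; rewrite /l E => t; exact: dw_le.
Qed.

Let S j := csolve T w (l j).

Definition hyperbolic_sol (G : R -> 'cV[R]_n) (t : R) : 'cV[R]_n :=
  Re_mx (putzer_sol A l S n.-1 (fun u => cplx_mx (G u)) t).

(** Built from [A] and the eigenvalues alone; this independence of [T] and [w] permits [T] to be
    chosen afterwards. *)
Definition hyperbolic_cst : R :=
  \sum_i `|putzer_cst A l (fun j => solver_cst (l j)) n.-1 i|.

Let jn j : (j <= n.-1)%N -> (j < n)%N. Proof. by rewrite -ltnS prednK. Qed.

Let S_class j M g : (j <= n.-1)%N -> cweighted T w M g ->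
  cweighted T w (solver_cst (l j) * M) (S j g).
Proof.
by move=> /jn jn' wg; case: (csolveP w_gt0 w_deriv (dw_l jn') (l_neq0 jn') wg).
Qed.

Let S_sol j M g : (j <= n.-1)%N -> cweighted T w M g -> forall t, T <= t ->
  has_cderiv_in `[T, +oo[ (S j g) t (l j * S j g t + g t).
Proof.
by move=> /jn jn' wg; case: (csolveP w_gt0 w_deriv (dw_l jn') (l_neq0 jn') wg) => -[].
Qed.

Let Kcv_cplx M G : rweighted T w M G ->
  Kcv (cweighted T w) M (fun u => cplx_mx (G u)).
Proof.
move=> [/within_continuous_cV Gc Gb] i; split.
- rewrite (_ : (fun t => _) = (fun t => G t i 0)); first exact: Gc.
  by apply/funext => t; rewrite mxE.
- rewrite (_ : (fun t => _) = fun=> 0); last by apply/funext => t; rewrite mxE.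
  exact/continuous_subspaceT/cst_continuous.
move=> t Tt; rewrite mxE /=; split; last by rewrite normr0 (le_trans _ (Gb t Tt)).
by rewrite (le_trans (cV_coord_le _ _))// Gb.
Qed.

Lemma hyperbolic_sol_deriv M G t : rweighted T w M G -> T <= t ->
  has_deriv_in `[T, +oo[ (hyperbolic_sol G) t (A *m hyperbolic_sol G t + G t).
Proof.
move=> wG Tt; have := putzer_sol_deriv (A := A) S_class S_sol (Kcv_cplx wG) Tt.
rewrite prednK// => /(_ (putzer_mx_full charA)) /cv_deriv_in_Re.
congr (has_deriv_in _ _ _ _); rewrite Re_mxD Re_mx_mul; congr (_ + _).
by apply/matrixP => i j; rewrite !mxE.
Qed.

Lemma hyperbolic_sol_class M G : rweighted T w M G ->
  rweighted T w (hyperbolic_cst * M) (hyperbolic_sol G).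
Proof.
move=> wG; split.
  apply: (has_deriv_in_continuous (df := fun t => A *m hyperbolic_sol G t + G t)) => t.
  by move=> /itvcyP Tt; exact: hyperbolic_sol_deriv wG Tt.
move=> t Tt.
have Mw : 0 <= M * w t by case: wG => _ /(_ t Tt); exact: le_trans.
rewrite -mulrA; have K0 : 0 <= hyperbolic_cst by apply: sumr_ge0.
apply/cV_norm_le; first by rewrite mulr_ge0.
move=> i; rewrite mxE.
have [_ _ /(_ t Tt)[+ _]] := putzer_sol_class A l (@cweightedD _ T w) (@cweightedZ _ T w)
  (@cweighted0 _ T w) S_class (Kcv_cplx wG) i.
move=> /le_trans; apply; rewrite -mulrA ler_wpM2r// (le_trans (ler_norm _))//.
by rewrite /hyperbolic_cst (bigD1 i)//= lerDl sumr_ge0.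
Qed.

Lemma hyperbolic_solB M M' G H t : rweighted T w M G -> rweighted T w M' H -> T <= t ->
  hyperbolic_sol (fun u => G u - H u) t = hyperbolic_sol G t - hyperbolic_sol H t.
Proof.
move=> wG wH Tt; rewrite /hyperbolic_sol -Re_mxN -Re_mxD; congr (Re_mx _).
rewrite -(putzer_solB A l S_class _ _ (Kcv_cplx wG) (Kcv_cplx wH) Tt).
- congr (putzer_sol _ _ _ _ _ _); apply/funext => u.
  by rewrite /cplx_mx map_mxB.
- by move=> j g h gh; exact: csolve_ext.
- move=> j N N' g h /jn jn' wg wh u Tu.
  exact: (csolveB w_gt0 w_deriv (dw_l jn') (l_neq0 jn') wg wh Tu).
Qed.

(** The factor [exp(- i be T)], with [be] the imaginary part of [l 0]. It makes [expo] equal to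
    [exp(l_0 (t - T))], with value 1 at [T]. *)
Let phase : C := Complex (cos (complex.Im (l 0%N) * T)) (- sin (complex.Im (l 0%N) * T)).
Let expo (t : R) : C := phase *
  Complex (expR (complex.Re (l 0%N) * (t - T)) * cos (complex.Im (l 0%N) * t))
          (expR (complex.Re (l 0%N) * (t - T)) * sin (complex.Im (l 0%N) * t)).

Let expoT : expo T = 1.
Proof.
rewrite /expo /phase subrr mulr0 expR0 !mul1r; apply/eqP; rewrite eq_complex; apply/andP.
split; apply/eqP; rewrite ?ReM ?ImM /=; last by ring.
by rewrite mulNr opprK -!expr2 cos2Dsin2.
Qed.

Let expo_deriv t : T <= t -> has_cderiv_in `[T, +oo[ expo t (l 0%N * expo t).
Proof.
move=> Tt; rewrite /expo mulrCA; apply: has_cderiv_inZ.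
have It := (itvcyP T t).2 Tt.
have he := @has_deriv_in_expR R T (complex.Re (l 0%N)) t.
split; rewrite ?ReM ?ImM /=.
  have := has_deriv_inM It he (@has_deriv_in_cos R T (complex.Im (l 0%N)) t).
  by congr (has_deriv_in _ _ _ _); ring.
have := has_deriv_inM It he (@has_deriv_in_sin R T (complex.Im (l 0%N)) t).
by congr (has_deriv_in _ _ _ _); ring.
Qed.

Let expo_class : (0 < d)%N -> exists M, cweighted T w M expo.
Proof.
move=> d0; exists (cabs phase * (w T)^-1); apply: cweightedZ.
have n0 : (0 < n)%N := n_gt0.
have al0 : complex.Re (l 0%N) < 0 by exact: (@sorted_spectrum_stable _ _ lam 0%N d0).
have hc : {within `[T, +oo[, continuous (fun t => complex.Re
  (Complex (expR (complex.Re (l 0%N) * (t - T)) * cos (complex.Im (l 0%N) * t))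
    (expR (complex.Re (l 0%N) * (t - T)) * sin (complex.Im (l 0%N) * t))))}.
  apply: (@has_deriv_in_continuous _ _ _ _ (fun t =>
    complex.Re (l 0%N) * expR (complex.Re (l 0%N) * (t - T)) * cos (complex.Im (l 0%N) * t)
    + expR (complex.Re (l 0%N) * (t - T)) * (- complex.Im (l 0%N) * sin (complex.Im (l 0%N) * t)))) => t /itvcyP Tt /=.
  exact: has_deriv_inM ((itvcyP T t).2 Tt) (@has_deriv_in_expR R T _ t) (@has_deriv_in_cos R T _ t).
have hs : {within `[T, +oo[, continuous (fun t => complex.Im
  (Complex (expR (complex.Re (l 0%N) * (t - T)) * cos (complex.Im (l 0%N) * t))
    (expR (complex.Re (l 0%N) * (t - T)) * sin (complex.Im (l 0%N) * t))))}.
  apply: (@has_deriv_in_continuous _ _ _ _ (fun t =>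
    complex.Re (l 0%N) * expR (complex.Re (l 0%N) * (t - T)) * sin (complex.Im (l 0%N) * t)
    + expR (complex.Re (l 0%N) * (t - T)) * (complex.Im (l 0%N) * cos (complex.Im (l 0%N) * t)))) => t /itvcyP Tt /=.
  exact: has_deriv_inM ((itvcyP T t).2 Tt) (@has_deriv_in_expR R T _ t) (@has_deriv_in_sin R T _ t).
split=> // t Tt /=.
have /(_ al0 Tt) ew := @stable_exp_le R T w dw (complex.Re (l 0%N)) w_gt0 w_deriv (dw_l n0) t.
have b x : `|x| <= 1 -> `|expR (complex.Re (l 0%N) * (t - T)) * x| <= (w T)^-1 * w t.
  move=> x1; rewrite normrM (gtr0_norm (expR_gt0 _)) mulrC [_^-1 * _]mulrC.
  by rewrite (le_trans _ ew)// ler_piMl// ltW// expR_gt0.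
by split; apply: b; [exact: cos_max|exact: sin_max].
Qed.

(** Putzer's scalar functions for the homogeneous system. For a stable root the solver already
    returns a function that vanishes at [T], as Putzer's initial conditions demand. *)
Let coeff := fix coeff (j : nat) : R -> C :=
  if j is j'.+1 then S j (coeff j') else expo.

Let coeff_class j : (j < d)%N -> exists M, cweighted T w M (coeff j).
Proof.
elim: j => [/expo_class//|j IH jd]; have [M wM] := IH (ltnW jd).
exists (solver_cst (l j.+1) * M); apply: S_class => //.
by rewrite -ltnS prednK// (leq_trans jd (stable_le lam)).
Qed.

(** When the product of the stable factors kills [v], Putzer's formula stops exactly after [d]
    terms, and only stable roots occur in these. At [T] all terms but the first vanish, which leaves
    [v]. *)
Lemma stable_solution (v : 'cV[C]_n) : putzer_mx A l d *m v = 0 ->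
  exists h : R -> 'cV[R]_n, [/\ h T = Re_mx v,
    forall t, T <= t -> has_deriv_in `[T, +oo[ h t (A *m h t) &
    exists M, forall t, T <= t -> `|h t| <= M * w t].
Proof.
move=> Pv; have [d0|d_gt0] := posnP d.
  move: Pv; rewrite d0 mul1mx => ->.
  exists (fun=> 0); split; first by apply/matrixP => i j; rewrite !mxE.
    by move=> t _; rewrite mulmx0; exact: has_deriv_in_cst.
  by exists 0 => t _; rewrite normr0 mul0r.
pose z t := \sum_(j < d.-1.+1) putzer_mx A l j *m (coeff j t *: v).
have dn j : (j < d)%N -> (j <= n.-1)%N.
  by move=> jd; rewrite -ltnS prednK// (leq_trans jd (stable_le lam)).
have csol j : (j.+1 < d)%N ->
    (forall t, T <= t -> has_cderiv_in `[T, +oo[ (coeff j.+1) t (l j.+1 * coeff j.+1 t + coeff j t))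
    /\ coeff j.+1 T = 0.
  move=> jd; have [M wM] := coeff_class (ltnW jd).
  have jn' := jn (dn _ jd).
  have [[c1 _ c2] _] := csolveP w_gt0 w_deriv (dw_l jn') (l_neq0 jn') wM.
  split=> //; apply: c2; exact: (sorted_spectrum_stable jd).
have scal (q : R -> C) t L : has_cderiv_in `[T, +oo[ q t L ->
    cv_deriv_in `[T, +oo[ (fun u => q u *: v) t (L *: v).
  move=> hq i; rewrite !mxE; under [X in has_cderiv_in _ X]eq_fun do rewrite mxE mulrC.
  by rewrite mulrC; exact: has_cderiv_inZ.
have zd t : T <= t -> cv_deriv_in `[T, +oo[ z t (cplx_mx A *m z t).
  move=> Tt; rewrite /z prednK//; have := @putzer_deriv R n A l `[T, +oo[%classic
    (fun j u => coeff j u *: v) 0 d.-1 t.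
  rewrite prednK// -[in X in _ - X]scalemxAr Pv scaler0 subr0 addr0 addr0.
  apply; first by rewrite scalerA; apply: scal; exact: expo_deriv.
  move=> j jd; rewrite scalerA -scalerDl; apply: scal; apply: (csol j _).1 => //.
  by rewrite -ltn_predRL.
exists (fun t => Re_mx (z t)); split.
- congr (Re_mx _); rewrite /z big_ord_recl mul1mx /= expoT scale1r big1 ?addr0// => j _.
  have jd : (j.+1 < d)%N by rewrite -ltn_predRL.
  by have := (csol j jd).2; rewrite /= add0n => ->; rewrite scale0r mulmx0.
- by move=> t Tt; rewrite -Re_mx_mul; apply: cv_deriv_in_Re; exact: zd.
have /choice[M hM] (i : 'I_n) : exists M, cweighted T w M (fun t => z t i 0).
  have /choice[M' hM'] (j : 'I_d.-1.+1) : exists M, cweighted T w M (coeff j).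
    by apply: coeff_class; rewrite -[X in (_ < X)%N](prednK d_gt0).
  exists (\sum_(j < d.-1.+1) \sum_k cabs (putzer_mx A l j i k) * (cabs (v k 0) * M' j)).
  rewrite /z; under [X in cweighted _ _ _ X]eq_fun do rewrite summxE.
  apply: (Kc_sum (@cweightedD _ T w) (@cweighted0 _ T w) (J := 'I_d.-1.+1)) => j.
  under [X in cweighted _ _ _ X]eq_fun do rewrite mxE.
  apply: (Kc_sum (@cweightedD _ T w) (@cweighted0 _ T w) (J := 'I_n)) => k.
  apply: cweightedZ; under [X in cweighted _ _ _ X]eq_fun do rewrite mxE mulrC.
  exact: cweightedZ.
exists (\sum_i `|M i|) => t Tt; have wt := ltW (w_gt0 Tt).
apply/cV_norm_le; first by rewrite mulr_ge0// sumr_ge0.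
move=> i; rewrite mxE; have [_ _ /(_ t Tt)[+ _]] := hM i.
move=> /le_trans; apply; rewrite ler_wpM2r// (le_trans (ler_norm _))//.
by rewrite (bigD1 i)//= lerDl sumr_ge0.
Qed.

Lemma stable_family : exists h : 'I_d -> R -> 'cV[R]_n, [/\
  forall i t, T <= t -> has_deriv_in `[T, +oo[ (h i) t (A *m h i t),
  exists M, forall i t, T <= t -> `|h i t| <= M * w t &
  forall c : 'cV[R]_d, \sum_i c i 0 *: h i T = 0 -> c = 0].
Proof.
have [V [V0 Vf]] := stable_real_basis charA.
have /choice[h hh] (i : 'I_d) : exists h : R -> 'cV[R]_n, [/\ h T = Re_mx (row i V)^T,
    forall t, T <= t -> has_deriv_in `[T, +oo[ h t (A *m h t) &
    exists M, forall t, T <= t -> `|h t| <= M * w t].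
  apply: stable_solution; apply/trmx_inj.
  by rewrite trmx_mul trmxK trmx0 -row_mul V0 row0.
exists h; split=> [i t Tt||c h0]; first by case: (hh i) => _ + _; apply.
  have /choice[M hM] (i : 'I_d) : exists M, forall t, T <= t -> `|h i t| <= M * w t.
    by case: (hh i).
  exists (\sum_i `|M i|) => i t Tt; apply: le_trans (hM i t Tt) _.
  rewrite ler_wpM2r ?(ltW (w_gt0 Tt))// (le_trans (ler_norm _))//.
  by rewrite (bigD1 i)//= lerDl sumr_ge0.
apply/trmx_inj; rewrite trmx0; apply: (row_free_inj Vf); rewrite mul0mx.
apply/rowP => k; have /matrixP/(_ k 0) E := h0; rewrite mxE [RHS]mxE.
rewrite summxE [RHS]mxE in E; rewrite -[RHS]E.
by apply: eq_bigr => i _; case: (hh i) => -> _ _; rewrite !mxE.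
Qed.

End FixedInterval.

End HyperbolicLinearSystem.

(** * The Lyapunov-Perron iteration *)

Section LyapunovPerron.
Context {R : realType}.

Lemma exp2_small (X e : R) : 0 < e -> exists k : nat, X / 2 ^+ k <= e.
Proof.
move=> e0; have x0 : 0 <= `|X| / e by rewrite divr_ge0// ltW.
exists (Num.bound (`|X| / e)); have := archi_boundP x0.
set k := Num.bound _ => hk; rewrite ler_pdivrMr ?exprn_gt0//.
rewrite (le_trans (ler_norm _))// -ler_pdivrMl// mulrC (le_trans (ltW hk))//.
by rewrite -natrX ler_nat ltnW// ltn_expl.
Qed.

(** The intervals [[u k - r k, u k + r k]] are nested, [r k] being the sum of the bounds on the
    remaining steps; [l] is the supremum of the left ends. *)
Lemma dyadic_limit (u : nat -> R) (C : R) :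
  (forall k, `|u k.+1 - u k| <= C / 2 ^+ k) ->
  exists l, forall k, `|l - u k| <= 2 * C / 2 ^+ k.
Proof.
move=> uC; have C0 : 0 <= C.
  by have := le_trans (normr_ge0 _) (uC 0%N); rewrite expr0 divr1.
pose r k := 2 * C / 2 ^+ k.
have r0 k : 0 <= r k by rewrite !(divr_ge0, mulr_ge0)// exprn_ge0.
have rS k : C / 2 ^+ k = r k - r k.+1.
  by rewrite /r exprS; field; rewrite expf_neq0.
have mono k j : u k - r k <= u (k + j)%N - r (k + j)%N /\ u (k + j)%N + r (k + j)%N <= u k + r k.
  elim: j => [|j [IH1 IH2]]; first by rewrite addn0.
  have := uC (k + j)%N; rewrite rS ler_norml addnS => /andP[h1 h2].
  by split; [apply: le_trans IH1 _|apply: le_trans _ IH2]; lra.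
have cross k j : u k - r k <= u j + r j.
  have [h1 _] := mono k j; have [_ h2] := mono j k; rewrite addnC in h2.
  by have := r0 (k + j)%N; lra.
pose S := [set u k - r k | k in setT].
have hS : has_sup S.
  split; first by exists (u 0%N - r 0%N), 0%N.
  by exists (u 0%N + r 0%N) => _ [k _ <-]; exact: cross.
exists (sup S) => k; rewrite ler_norml -/(r k); apply/andP; split.
  suff : u k - r k <= sup S by lra.
  by apply: ub_le_sup; [exact: hS.2|exists k].
suff : sup S <= u k + r k by lra.
by apply: ge_sup; [exact: hS.1|move=> _ [j _ <-]; exact: cross].
Qed.

(* squash maps R injectively into the unit ball: it lets the constants range over
   the whole space although the solutions have to stay in the tube. *)
Definition squash (x : R) : R := x / (1 + `|x|).

Let den_gt0 (x : R) : 0 < 1 + `|x|. Proof. by rewrite ltr_pwDl. Qed.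

Lemma squash_le1 x : `|squash x| <= 1.
Proof.
rewrite normrM normfV (gtr0_norm (den_gt0 x)) ler_pdivrMr// mul1r.
by rewrite lerDr.
Qed.

Lemma squash_lip x y : `|squash x - squash y| <= `|x - y|.
Proof.
have E : squash x - squash y =
    ((x - y) + (x * `|y| - y * `|x|)) / ((1 + `|x|) * (1 + `|y|)).
  by rewrite /squash; field; rewrite !gt_eqF.
rewrite E normrM normfV (gtr0_norm (mulr_gt0 (den_gt0 x) (den_gt0 y))).
rewrite ler_pdivrMr ?mulr_gt0//.
have pos (a b : R) : 0 <= a -> 0 <= b -> a + b + 2 * (a * b) <= (a + b) * ((1 + a) * (1 + b)).
  move=> a0 b0; have ab : 0 <= a * b by rewrite mulr_ge0.
  have : 0 <= a * a by rewrite mulr_ge0.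
  have : 0 <= b * b by rewrite mulr_ge0.
  have : 0 <= (a * b) * (a + b) by rewrite mulr_ge0// addr_ge0.
  lra.
have same : 1 <= (1 + `|x|) * (1 + `|y|).
  have : 0 <= `|x| * `|y| by rewrite mulr_ge0.
  by have := normr_ge0 x; have := normr_ge0 y; lra.
have [x0|x0] := leP 0 x; have [y0|y0] := leP 0 y.
- rewrite (ger0_norm x0) (ger0_norm y0) mulrC subrr addr0 ler_peMr//.
  by move: same; rewrite (ger0_norm x0) (ger0_norm y0).
- rewrite (ger0_norm x0) (ltr0_norm y0) (ger0_norm (x := x - y)); last by lra.
  have := pos x (- y) x0; rewrite oppr_ge0 => /(_ (ltW y0)).
  by rewrite ger0_norm; nra.
- rewrite (ltr0_norm x0) (ger0_norm y0) (ltr0_norm (x := x - y)); last by lra.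
  have := pos (- x) y; rewrite oppr_ge0 => /(_ (ltW x0) y0).
  by rewrite ler0_norm; nra.
- rewrite (ltr0_norm x0) (ltr0_norm y0).
  have -> : x * - y - y * - x = 0 by ring.
  rewrite addr0 ler_peMr//.
  by move: same; rewrite (ltr0_norm x0) (ltr0_norm y0).
Qed.

Lemma squash_inj : injective squash.
Proof.
move=> x y /eqP; have [dx dy] := (lt0r_neq0 (den_gt0 x), lt0r_neq0 (den_gt0 y)).
rewrite /squash eqr_div// => /eqP.
have [x0|x0] := leP 0 x; have [y0|y0] := leP 0 y.
- by rewrite !ger0_norm//; lra.
- have : 0 <= x * - y by rewrite mulr_ge0// oppr_ge0 ltW.
  by rewrite (ger0_norm x0) (ltr0_norm y0); lra.
- have : 0 <= - x * y by rewrite mulr_ge0// oppr_ge0 ltW.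
  by rewrite (ltr0_norm x0) (ger0_norm y0); lra.
- by rewrite !ltr0_norm//; lra.
Qed.

Lemma dyadic_limit_cV (n : nat) (u : nat -> 'cV[R]_n) (C : R) :
  (forall k, `|u k.+1 - u k| <= C / 2 ^+ k) ->
  exists l, forall k, `|l - u k| <= 2 * C / 2 ^+ k.
Proof.
move=> uC; have C0 : 0 <= C.
  by have := le_trans (normr_ge0 _) (uC 0%N); rewrite expr0 divr1.
have /choice[l hl] (i : 'I_n) : exists l : R, forall k, `|l - u k i 0| <= 2 * C / 2 ^+ k.
  apply: dyadic_limit => k; apply: le_trans (uC k).
  by have := cV_coord_le (u k.+1 - u k) i; rewrite !mxE.
exists (\col_i l i) => k; apply/cV_norm_le; first by rewrite divr_ge0 ?mulr_ge0// exprn_ge0.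
by move=> i; rewrite !mxE.
Qed.

Section PicardIteration.
Variable n : nat.
Variables (A : 'M[R]_n) (lam : 'I_n -> R[i]).
Hypothesis charA : char_poly (cplx_mx A) = \prod_(j < n) ('X - (lam j)%:P).
Hypothesis hyp : forall j, complex.Re (lam j) != 0.
Hypothesis n_gt0 : (0 < n)%N.
Variables (T : R) (w dw : R -> R).
Hypothesis w_gt0 : forall t, T <= t -> 0 < w t.
Hypothesis w_deriv : forall t, T <= t -> has_deriv_in `[T, +oo[ w t (dw t).
Hypothesis dw_le : forall j t, T <= t -> `|dw t| <= `|complex.Re (lam j)| / 2 * w t.
Variables (F : R -> 'cV[R]_n -> 'cV[R]_n) (B M L : R).
Hypothesis B_gt0 : 0 < B.
Hypothesis L_ge0 : 0 <= L.

Let tame (r : R -> 'cV[R]_n) := rweighted T w B r.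

Hypothesis F_cont : forall r, tame r -> {within `[T, +oo[, continuous (fun t => F t (r t))}.
Hypothesis F0_le : forall t, T <= t -> `|F t 0| <= M * w t.
Hypothesis F_lip : forall t x y, T <= t -> `|x| <= B * w t -> `|y| <= B * w t ->
  `|F t x - F t y| <= L * `|x - y|.
Hypothesis M_small : hyperbolic_cst A lam * M <= B / 4.
Hypothesis L_small : hyperbolic_cst A lam * L <= 2^-1.

Let w_ge0 t : T <= t -> 0 <= w t. Proof. by move=> Tt; rewrite ltW ?w_gt0. Qed.

Let d := #|[pred j | stable_root (lam j)]|.
Let op r := hyperbolic_sol A lam T w (fun u => F u (r u)).

Let F_class r : tame r -> rweighted T w (M + L * B) (fun t => F t (r t)).
Proof.
move=> tr; split; first exact: F_cont.
move=> t Tt; rewrite -[F t (r t)](subrK (F t 0)) (le_trans (ler_normD _ _))// addrC mulrDl.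
apply: lerD; first exact: F0_le.
have rB := tr.2 t Tt; have wt := ltW (w_gt0 Tt).
rewrite (le_trans (F_lip Tt rB _)) ?normr0 ?mulr_ge0//; first exact: ltW.
by rewrite subr0 -mulrA ler_wpM2l.
Qed.

Let op_class r : tame r -> rweighted T w (B / 4 + B / 2) (op r).
Proof.
move=> tr; have [oc ob] := hyperbolic_sol_class charA hyp n_gt0 w_gt0 w_deriv dw_le (F_class tr).
split=> // t Tt; rewrite (le_trans (ob t Tt))// ler_wpM2r ?w_ge0// mulrDr lerD//.
by rewrite mulrA [B / 2]mulrC ler_wpM2r// ltW.
Qed.

Let op_deriv r t : tame r -> T <= t ->
  has_deriv_in `[T, +oo[ (op r) t (A *m op r t + F t (r t)).
Proof.
by move=> tr Tt; apply: (hyperbolic_sol_deriv charA hyp n_gt0 w_gt0 w_deriv dw_le (F_class tr) Tt).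
Qed.

(** Linearity of the solver reduces the difference to one solve with forcing
    [F u (r u) - F u (s u)]; [L_small] then gives the factor one half. *)
Let op_lip r s X : 0 <= X -> tame r -> tame s ->
  (forall t, T <= t -> `|r t - s t| <= X * w t) ->
  forall t, T <= t -> `|op r t - op s t| <= X / 2 * w t.
Proof.
move=> X0 tr ts rs t Tt.
rewrite -(hyperbolic_solB A hyp n_gt0 w_gt0 w_deriv dw_le (F_class tr) (F_class ts) Tt).
have wD : rweighted T w (L * X) (fun u => F u (r u) - F u (s u)).
  split; first by apply: within_continuousB; exact: F_cont.
  move=> u Tu; rewrite (le_trans (F_lip Tu (tr.2 u Tu) (ts.2 u Tu)))//.
  by rewrite -mulrA ler_wpM2l// rs.
have [_ /(_ t Tt) /le_trans] := hyperbolic_sol_class charA hyp n_gt0 w_gt0 w_deriv dw_le wD.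
apply; rewrite ler_wpM2r ?w_ge0// mulrA [X / 2]mulrC.
by rewrite ler_wpM2r.
Qed.

Section FixedData.
Variable hom : R -> 'cV[R]_n.
Hypothesis hom_deriv : forall t, T <= t -> has_deriv_in `[T, +oo[ hom t (A *m hom t).
Hypothesis hom_le : forall t, T <= t -> `|hom t| <= B / 4 * w t.

Let Phi r t := hom t + op r t.
Let it k := iter k Phi (fun=> 0).

(** The budget [B] is split in three: a quarter for [hom], a quarter for [F t 0] through [M_small],
    a half for the Lipschitz part through [L_small]. *)
Let Phi_tame r : tame r -> tame (Phi r).
Proof.
move=> tr; have [oc ob] := op_class tr; split.
  apply: within_continuousD => //.
  by apply: (has_deriv_in_continuous (df := fun t => A *m hom t)) => t /itvcyP; exact: hom_deriv.
move=> t Tt; rewrite (le_trans (ler_normD _ _))// (le_trans (lerD (hom_le Tt) (ob t Tt)))//.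
by rewrite -mulrDl ler_wpM2r ?w_ge0//; lra.
Qed.

Let it_tame k : tame (it k).
Proof.
elim: k => [|k IH]; last exact: Phi_tame.
split; first exact/continuous_subspaceT/cst_continuous.
by move=> t Tt; rewrite normr0 mulr_ge0 ?w_ge0//; exact: ltW.
Qed.

Let it_step k t : T <= t -> `|it k.+1 t - it k t| <= (B / 2 ^+ k) * w t.
Proof.
elim: k t => [|k IH] t Tt.
  by rewrite subr0 expr0 divr1; case: (it_tame 1) => _; apply.
have -> : it k.+2 t - it k.+1 t = op (it k.+1) t - op (it k) t.
  by rewrite /it !iterS /Phi opprD addrACA subrr add0r.
have X0 : 0 <= B / 2 ^+ k by rewrite divr_ge0 ?exprn_ge0// ltW.
have := op_lip X0 (it_tame k.+1) (it_tame k) IH Tt.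
by rewrite exprSr invfM mulrA.
Qed.

Lemma picard_fixpoint : exists r : R -> 'cV[R]_n, [/\ tame r,
  forall t, T <= t -> r t = hom t + op r t,
  forall t, T <= t -> has_deriv_in `[T, +oo[ r t (A *m r t + F t (r t)) &
  forall k t, T <= t -> `|r t - iter k (fun s u => hom u + op s u) (fun=> 0) t|
     <= 2 * B / 2 ^+ k * w t].
Proof.
have /choice[r hr] (t : R) : exists v : 'cV[R]_n, T <= t ->
    forall k, `|v - it k t| <= 2 * B / 2 ^+ k * w t.
  have [Tt|] := leP T t; last by exists 0.
  have [l hl] := @dyadic_limit_cV n (it^~ t) (B * w t) (fun k => eq_ind _ (fun x => _ <= x)
    (it_step k Tt) _ (mulrAC _ _ _)).
  by exists l => _ k; rewrite (le_trans (hl k))// mulrA mulrAC.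
have near k t : T <= t -> `|r t - it k t| <= 2 * B / 2 ^+ k * w t by move=> /hr; apply.
have rB t : T <= t -> `|r t| <= B * w t.
  move=> Tt; apply/ler_addgt0Pl => e e0.
  have [k hk] := exp2_small (2 * B * w t) e0.
  rewrite -[r t](subrK (it k t)) (le_trans (ler_normD _ _))// lerD ?(it_tame k).2//.
  by rewrite (le_trans (near k t Tt))// mulrAC.
have wc : {within `[T, +oo[, continuous w}.
  by apply: (has_deriv_in_continuous (df := dw)) => t /itvcyP; exact: w_deriv.
have rc : {within `[T, +oo[, continuous r}.
  apply/within_continuousP => t /itvcyP Tt e e0.
  (* Convergence is uniform only relative to [w]; near [t] the weight stays below [w t + 1], which
     gives the local uniformity for the three-epsilon argument. *)
  have [k hk] := exp2_small (2 * B * (w t + 1)) (divr_gt0 e0 (ltr0Sn R 2)).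
  have e30 : 0 < e / 3 by rewrite divr_gt0.
  have [itc _] := it_tame k.
  have /within_continuousP/(_ t ((itvcyP T t).2 Tt) _ e30)[d1 d10 hd1] := itc.
  have /within_continuousP/(_ t ((itvcyP T t).2 Tt) _ ltr01)[d2 d20 hd2] := wc.
  exists (Num.min d1 d2); first by rewrite lt_min d10.
  move=> u /[dup] /itvcyP Tu Iu; rewrite lt_min => /andP[u1 u2].
  have := hd1 u Iu u1; have := hd2 u Iu u2; rewrite ler_norml => /andP[_ wu] itu.
  have small v : T <= v -> w v <= w t + 1 -> `|r v - it k v| <= e / 3.
    move=> Tv wv; rewrite (le_trans (near k v Tv))// (le_trans _ hk)// [leRHS]mulrAC.
    by rewrite ler_wpM2l// divr_ge0 ?exprn_ge0// mulr_ge0// ltW.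
  have -> : r u - r t = (r u - it k u) + (it k u - it k t) - (r t - it k t).
    by rewrite addrA subrK opprB addrA subrK.
  rewrite (le_trans (ler_normB _ _))// (le_trans (lerD (ler_normD _ _) (lexx _)))//.
  have := small u Tu; have := small t Tt; rewrite lerDl ler01 => /(_ isT) h1.
  have -> : w u <= w t + 1 by lra.
  by move=> /(_ isT) h2; lra.
have tr : tame r by split.
have rE t : T <= t -> r t = hom t + op r t.
  move=> Tt; apply/eqP; rewrite -subr_eq0 -normr_le0; apply/ler_addgt0Pl => e e0; rewrite addr0.
  have [k hk] := exp2_small (2 * B * w t) e0.
  have -> : r t - (hom t + op r t) = (r t - it k.+1 t) - (op r t - op (it k) t).
    by rewrite [it k.+1 t](_ : _ = hom t + op (it k) t)// opprB !opprD !addrA subrK.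
  have X0 : 0 <= 2 * B / 2 ^+ k by rewrite divr_ge0 ?exprn_ge0// mulr_ge0// ltW.
  have h1 := op_lip X0 tr (it_tame k) (near k) Tt; have h2 := near k.+1 t Tt.
  rewrite (le_trans (ler_normB _ _))// (le_trans _ hk)// (le_trans (lerD h2 h1))//.
  rewrite exprSr invfM.
  by rewrite le_eqVlt; apply/orP; left; apply/eqP; field; rewrite expf_neq0.
exists r; split=> // t Tt.
apply: (@has_deriv_in_ext _ _ _ (fun t => hom t + op r t)).
- exact/itvcyP.
- by move=> u /itvcyP Tu; rewrite rE.
have := has_deriv_inD (hom_deriv Tt) (op_deriv tr Tt).
by rewrite addrA -mulmxDr -rE.
Qed.

End FixedData.

(** A bound [X * w] on the difference improves to [(D + X / 2) * w]; iterated from the trivial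
    [X = 2 * B], the constant tends to the fixed point [2 * D]. *)
Lemma picard_stability (h1 h2 : R -> 'cV[R]_n) (D : R) : 0 <= D ->
  (forall t, T <= t -> `|h1 t - h2 t| <= D * w t) ->
  forall r1 r2 : R -> 'cV[R]_n, tame r1 -> tame r2 ->
  (forall t, T <= t -> r1 t = h1 t + op r1 t) ->
  (forall t, T <= t -> r2 t = h2 t + op r2 t) ->
  forall t, T <= t -> `|r1 t - r2 t| <= 2 * D * w t.
Proof.
move=> D0 h12 r1 r2 t1 t2 e1 e2.
have key k t : T <= t -> `|r1 t - r2 t| <= (2 * D + 2 * B / 2 ^+ k) * w t.
  elim: k t => [|k IH] t Tt.
    rewrite expr0 divr1 (le_trans (ler_normB _ _))//.
    rewrite (le_trans (lerD (t1.2 t Tt) (t2.2 t Tt)))// -mulrDl ler_wpM2r ?w_ge0//.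
    by lra.
  have -> : r1 t - r2 t = (h1 t - h2 t) + (op r1 t - op r2 t).
    by rewrite e1// e2// opprD addrACA.
  have X0 : 0 <= 2 * D + 2 * B / 2 ^+ k.
    apply: addr_ge0; first exact: mulr_ge0.
    by rewrite divr_ge0 ?exprn_ge0// mulr_ge0// ltW.
  have := op_lip X0 t1 t2 IH Tt => h.
  rewrite (le_trans (ler_normD _ _))// (le_trans (lerD (h12 t Tt) h))//.
  rewrite -mulrDl ler_wpM2r ?w_ge0// exprSr invfM.
  by rewrite le_eqVlt; apply/orP; left; apply/eqP; field; rewrite expf_neq0.
move=> t Tt; apply/ler_addgt0Pl => e e0.
have [k hk] := exp2_small (2 * B * w t) e0.
rewrite (le_trans (key k t Tt))// mulrDl addrC lerD//.
by rewrite mulrAC.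
Qed.

Theorem lyapunov_perron : exists r : 'cV[R]_d -> R -> 'cV[R]_n, [/\
  forall c t, T <= t -> has_deriv_in `[T, +oo[ (r c) t (A *m r c t + F t (r c t)),
  forall c t, T <= t -> `|r c t| <= B * w t &
  parameter_family setT (fun=> T) r].
Proof.
have [h [hd [M0 hM0] hfree]] := stable_family charA hyp n_gt0 w_gt0 w_deriv dw_le.
pose m : R := `|M0|; have m0 : 0 <= m by exact: normr_ge0.
have hm i t : T <= t -> `|h i t| <= m * w t.
  by move=> Tt; rewrite (le_trans (hM0 i t Tt))// ler_wpM2r ?w_ge0// ler_norm.
(* Since [|squash| <= 1], the [d] terms of [hom c] add up to at most [eta * d * m * w], which this
   [eta] keeps below [B / 4 * w] for every [c]; the [+ 1] keeps the denominator positive. *)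
pose eta := B / 4 / (d%:R * m + 1).
have den : 0 < d%:R * m + 1 by rewrite ltr_wpDl// mulr_ge0// ler0n.
have eta0 : 0 < eta by rewrite !divr_gt0.
have em0 : 0 <= eta * (d%:R * m) by rewrite mulr_ge0 ?(ltW eta0)// mulr_ge0// ler0n.
pose hom (c : 'cV[R]_d) t := \sum_i (eta * squash (c i 0)) *: h i t.
have hom_d c t : T <= t -> has_deriv_in `[T, +oo[ (hom c) t (A *m hom c t).
  move=> Tt; have -> : A *m hom c t = \sum_i (eta * squash (c i 0)) *: (A *m h i t).
    by rewrite mulmx_sumr; apply: eq_bigr => i _; rewrite scalemxAr.
  by apply: has_deriv_in_sum => i _; apply: has_deriv_inZ; exact: hd.
have lin (q : 'I_d -> R) X t : T <= t -> (forall i, `|q i| <= X) ->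
    `|\sum_i (eta * q i) *: h i t| <= eta * (d%:R * m) * X * w t.
  move=> Tt qX; rewrite (le_trans (ler_norm_sum _ _ _))//.
  have -> : eta * (d%:R * m) * X * w t = \sum_(i < d) (eta * X * (m * w t)).
    by rewrite sumr_const card_ord -mulr_natl; ring.
  apply: ler_sum => i _; rewrite normrZ normrM (gtr0_norm eta0).
  have e0 := ltW eta0; apply: ler_pM => //; first exact: mulr_ge0.
    exact: ler_wpM2l.
  exact: hm.
have hom_b c t : T <= t -> `|hom c t| <= B / 4 * w t.
  move=> Tt; rewrite (le_trans (lin _ 1 _ Tt (fun i => squash_le1 _)))//.
  rewrite mulr1 ler_wpM2r ?w_ge0// /eta -mulrA ler_piMr//; first by rewrite divr_ge0// ltW.
  by rewrite mulrC ler_pdivrMr// mul1r lerDl.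
have /choice[r hr] c := picard_fixpoint (hom_d c) (hom_b c).
have rlip c c' t : T <= t -> `|r c t - r c' t| <= 2 * (eta * (d%:R * m) * `|c - c'|) * w t.
  move=> Tt; apply: (@picard_stability (hom c) (hom c')) => //.
  - exact: mulr_ge0.
  - move=> u Tu; rewrite /hom -sumrB.
    under eq_bigr do rewrite -scalerBl -mulrBr.
    apply: lin => // i; rewrite (le_trans (squash_lip _ _))//.
    by have := cV_coord_le (c - c') i; rewrite !mxE.
  - by case: (hr c).
  - by case: (hr c').
  - by case: (hr c).
  - by case: (hr c').
exists r; split.
- by move=> c t Tt; case: (hr c) => _ _ + _; apply.
- by move=> c t Tt; case: (hr c) => -[_ +] _ _ _; apply.
split=> [c t _ Tt|c c' _ _ rE].
  split; first by near=> c'; exact: ltW.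
  rewrite withinET; apply/cvgrPdist_le => e e0.
  pose K := 2 * (eta * (d%:R * m)) * w t.
  have K0 : 0 <= K by rewrite mulr_ge0 ?w_ge0 ?(ltW Tt)// mulr_ge0.
  have K1 : 0 < K + 1 by rewrite ltr_wpDl.
  have eK : 0 < e / (K + 1) by exact: divr_gt0.
  near=> c'; rewrite (le_trans (rlip c c' t (ltW Tt)))//.
  have -> : 2 * (eta * (d%:R * m) * `|c - c'|) * w t = K * `|c - c'| by rewrite /K; ring.
  have : `|c - c'| <= e / (K + 1).
    by near: c'; have /cvgrPdist_le/(_ _ eK) := @cvg_id _ (nbhs c).
  rewrite ler_pdivlMr// => h'; rewrite (le_trans _ h')// mulrC ler_wpM2l//.
  by rewrite lerDl.
have TT := lexx T.
(* If the solutions agree, so do their images under [op]; hence the homogeneous parts agree at [T],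
   where the [h i T] are independent. *)
have homE : hom c T = hom c' T.
  have [tc ec _ _] := hr c; have [tc' ec' _ _] := hr c'.
  have := op_lip (lexx 0) tc tc' _ TT; rewrite mul0r mul0r.
  have H0 t : T <= t -> `|r c t - r c' t| <= 0 * w t.
    by move=> Tt; rewrite rE// subrr normr0 mul0r.
  move=> /(_ H0); rewrite normr_le0 subr_eq0 => /eqP oE.
  have := rE T TT TT; rewrite ec// ec'// oE => /eqP.
  by rewrite -subr_eq0 opprD addrACA subrr addr0 subr_eq0 => /eqP.
have /hfree e0 : \sum_i (\col_j (squash (c j 0) - squash (c' j 0))) i 0 *: h i T = 0.
  have : eta *: \sum_i (\col_j (squash (c j 0) - squash (c' j 0))) i 0 *: h i T = 0.
    rewrite -[RHS](subrr (hom c T)) {2}homE /hom -sumrB scaler_sumr.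
    by apply: eq_bigr => i _; rewrite mxE scalerA mulrBr scalerBl.
  by move/eqP; rewrite scaler_eq0 gt_eqF//= => /eqP.
apply/matrixP => i j; rewrite ord1; apply: squash_inj; apply/eqP; rewrite -subr_eq0.
by have /matrixP/(_ i 0) := e0; rewrite !mxE => ->.
Unshelve. all: by end_near. Qed.

End PicardIteration.

End LyapunovPerron.

(** * Taylor's formula in the tube *)

Section Taylor.
Context {R : realType} {n : nat}.
Implicit Types (J : set R) (g : R -> 'cV[R]_n -> 'cV[R]_n) (w : midx n).

Lemma has_deriv_in_bound_cV J (f df : R -> 'cV[R]_n) (M a b : R) : 0 <= M -> a <= b ->
  (forall t, a <= t <= b -> J t) ->
  (forall t, a <= t <= b -> has_deriv_in J f t (df t)) ->
  (forall t, a < t < b -> `|df t| <= M) -> `|f b - f a| <= M * (b - a).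
Proof.
move=> M0 ab hJ hf hM; apply/cV_norm_le; first by rewrite mulr_ge0// subr_ge0.
move=> i; rewrite !mxE.
apply: (has_deriv_in_bound (f := fun t => f t i 0) (df := fun t => df t i 0) ab hJ).
  by move=> t /hf /has_deriv_in_cV.
by move=> t /hM; apply: le_trans; exact: cV_coord_le.
Qed.

Definition tmon (i : nat) (tau : R) : R := tau ^+ i / i`!%:R.

Lemma tmonS i tau : tmon i.+1 tau = i.+1%:R^-1 * (tau * tmon i tau).
Proof. by rewrite /tmon factS natrM invfM exprS; ring. Qed.

Lemma tmon_deriv J i tau : J tau -> has_deriv_in J (tmon i.+1) tau (tmon i tau).
Proof.
move=> Jt.
have h1 : has_deriv_in J (fun u : R => u) tau 1.
  by apply: has_deriv_in_is_derive; exact: is_derive_id.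
elim: i => [|i IH].
  move: h1; rewrite /tmon expr0 fact0 invr1 mulr1; congr (has_deriv_in _ _ _ _).
  by apply/funext => u; rewrite mulr1 expr1.
have := has_deriv_inZ (c := i.+2%:R^-1) (has_deriv_inM Jt h1 IH).
congr (has_deriv_in _ _ _ _); first by apply/funext => u; rewrite [RHS]tmonS.
have -> : tau * tmon i tau = i.+1%:R * tmon i.+1 tau.
  by rewrite tmonS mulVKf// pnatr_eq0.
rewrite /GRing.scale /= -mulrDl nat1r mulrA mulVf ?mul1r//.
Qed.

Lemma tmon0 i : tmon i 0 = (i == 0%N)%:R.
Proof. by case: i => [|i]; rewrite /tmon ?expr0 ?fact0 ?invr1 ?mulr1// expr0n mul0r. Qed.

Lemma tmon_le i tau : `|tmon i tau| <= `|tau| ^+ i.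
Proof.
rewrite normrM normrX normfV normr_nat ler_piMr ?exprn_ge0// invf_le1 ?ltr0n ?fact_gt0//.
by rewrite ler1n fact_gt0.
Qed.

(** Induction on the order: the derivative of the remainder is the remainder of [h 1] of one order
    less, and the mean value inequality gains the factor [|tau|]. The domain is any order-convex [J]
    containing 0, as the tube may leave room on one side only. *)
Lemma taylor_1d J (h : nat -> R -> 'cV[R]_n) (M : R) (q : nat) : 0 <= M ->
  (forall b c u, J b -> J c -> b <= u <= c -> J u) -> J 0 ->
  (forall i u, (i <= q)%N -> J u -> has_deriv_in J (h i) u (h i.+1 u)) ->
  (forall u, J u -> `|h q.+1 u| <= M) ->
  forall tau, J tau ->
  `|h 0%N tau - \sum_(i < q.+1) tmon i tau *: h i 0| <= M * `|tau| ^+ q.+1.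
Proof.
move=> M0 Jc J0; elim: q h => [|q IH] h hd hM tau Jtau.
  rewrite big_ord1 /tmon expr0 fact0 invr1 mulr1 scale1r expr1.
  have [t0|t0] := leP 0 tau.
    rewrite [X in _ <= _ * X](ger0_norm t0) -[X in _ <= _ * X]subr0; apply: (has_deriv_in_bound_cV (J := J) (df := h 1%N)) => //.
    - by move=> u; exact: Jc.
    - by move=> u ut; apply: hd => //; exact: Jc ut.
    - by move=> u /andP[/ltW u0 /ltW ut]; apply: hM; apply: (Jc _ _ _ J0 Jtau); rewrite u0.
  rewrite distrC [X in _ <= _ * X](ltr0_norm t0) -[X in _ <= _ * X]sub0r.
  apply: (has_deriv_in_bound_cV (J := J) (df := h 1%N)) => //; first exact: ltW.
  - by move=> u; exact: Jc.
  - by move=> u ut; apply: hd => //; exact: Jc ut.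
  - by move=> u /andP[/ltW u0 /ltW ut]; apply: hM; apply: (Jc _ _ _ Jtau J0); rewrite u0.
pose psi u := h 0%N u - \sum_(i < q.+2) tmon i u *: h i 0.
pose dpsi u := h 1%N u - \sum_(i < q.+1) tmon i u *: h i.+1 0.
have psi0 : psi 0 = 0.
  rewrite /psi big_ord_recl big1 ?addr0; last by move=> i _; rewrite tmon0 scale0r.
  by rewrite tmon0 scale1r subrr.
have psid u : J u -> has_deriv_in J psi u (dpsi u).
  move=> Ju; apply: has_deriv_inB; first exact: hd.
  have h0 : has_deriv_in J (fun u => tmon 0 u *: h 0%N 0) u 0.
    have -> : (fun u => tmon 0 u *: h 0%N 0) = fun=> h 0%N 0.
      by apply/funext => v; rewrite /tmon expr0 fact0 invr1 mulr1 scale1r.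
    exact: has_deriv_in_cst.
  have hS : has_deriv_in J (fun u => \sum_(i < q.+1) tmon i.+1 u *: h i.+1 0) u
      (\sum_(i < q.+1) tmon i u *: h i.+1 0).
    apply: has_deriv_in_sum => i _.
    have := has_deriv_in_cVZ Ju (@tmon_deriv J i u Ju) (@has_deriv_in_cst _ _ J (h i.+1 0) u).
    by rewrite scaler0 addr0.
  have := has_deriv_inD h0 hS; rewrite add0r; congr (has_deriv_in _ _ _ _).
  by apply/funext => v; rewrite [RHS]big_ord_recl.
have dpsi_le u : J u -> `|dpsi u| <= M * `|u| ^+ q.+1.
  move=> Ju; apply: (IH (fun i => h i.+1)) => //.
  by move=> i v iq; exact: hd.
rewrite -/(psi tau) -[psi tau]subr0 -psi0 exprSr mulrA.
have Mt : 0 <= M * `|tau| ^+ q.+1 by rewrite mulr_ge0// exprn_ge0.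
have le u : J u -> `|u| <= `|tau| -> `|dpsi u| <= M * `|tau| ^+ q.+1.
  move=> Ju ut; rewrite (le_trans (dpsi_le u Ju))// ler_wpM2l//.
  by rewrite lerXn2r ?nnegrE.
have [t0|t0] := leP 0 tau.
  rewrite [X in _ <= _ * X](ger0_norm t0) -[X in _ <= _ * X]subr0.
  apply: (has_deriv_in_bound_cV (J := J) (df := dpsi)) => //.
  - by move=> u; exact: Jc.
  - by move=> u ut; apply: psid; exact: Jc ut.
  - move=> u /andP[/ltW u0 /ltW ut]; apply: le; first by apply: (Jc _ _ _ J0 Jtau); rewrite u0.
    by rewrite !ger0_norm.
rewrite distrC [X in _ <= _ * X](ltr0_norm t0) -[X in _ <= _ * X]sub0r.
apply: (has_deriv_in_bound_cV (J := J) (df := dpsi)) => //; first exact: ltW.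
- by move=> u; exact: Jc.
- by move=> u ut; apply: psid; exact: Jc ut.
move=> u /andP[/ltW u0 /ltW ut]; apply: le; first by apply: (Jc _ _ _ Jtau J0); rewrite u0.
by rewrite !ler0_norm ?lerN2// ltW.
Qed.

Definition upd w (j : 'I_n) (i : nat) : midx n := [ffun k => if k == j then i else w k].

Definition midx0 : midx n := [ffun=> 0%N].

(* The multi-indices of size at most q supported in L. *)
Fixpoint midx_upto (q : nat) (L : seq 'I_n) : seq (midx n) :=
  if L is j :: L' then
    [seq upd w j i | w <- midx_upto q L', i <- iota 0 (q - msize w).+1]
  else [:: midx0].

Lemma midx_upto_cons q j L : midx_upto q (j :: L) =
  [seq upd w j i | w <- midx_upto q L, i <- iota 0 (q - msize w).+1].
Proof. by []. Qed.

Lemma msize_upd w j i : w j = 0%N -> msize (upd w j i) = (msize w + i)%N.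
Proof.
move=> wj; rewrite /msize (bigD1 j)//= [in RHS](bigD1 j)//= wj add0n ffunE eqxx addnC.
by congr (_ + _)%N; apply: eq_bigr => k kj; rewrite ffunE (negPf kj).
Qed.

Lemma mem_midx_upto q L w : uniq L ->
  (w \in midx_upto q L) = (msize w <= q)%N && [forall k, (k \notin L) ==> (w k == 0%N)].
Proof.
elim: L w => [|j L IH] w.
  move=> _; rewrite inE; apply/eqP/andP => [->|[_ /forallP h]].
    split; last by apply/forallP => k; rewrite ffunE.
    by rewrite /msize big1// => k _; rewrite ffunE.
  by apply/ffunP => k; rewrite ffunE; apply/eqP; exact: h.
rewrite cons_uniq midx_upto_cons => /andP[jL uL]; apply/allpairsPdep/andP => [[v [i [vL iq ->]]]|[wq /forallP h]].
  move: vL; rewrite IH// => /andP[vq /forallP hv].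
  have vj : v j = 0%N by apply/eqP; have := hv j; rewrite jL.
  move: iq; rewrite mem_iota /= add0n ltnS => iq.
  split; first by rewrite msize_upd//; lia.
  apply/forallP => k; rewrite inE negb_or; apply/implyP => /andP[kj kL].
  by rewrite ffunE (negPf kj); have := hv k; rewrite kL.
have w0j : upd w j 0 j = 0%N by rewrite ffunE eqxx.
have wE : w = upd (upd w j 0) j (w j).
  by apply/ffunP => k; rewrite !ffunE; case: eqP => // ->.
have sz : msize w = (msize (upd w j 0) + w j)%N by rewrite {1}wE msize_upd.
exists (upd w j 0), (w j); split=> //; last by rewrite mem_iota; lia.
rewrite IH//; apply/andP; split; first by lia.
apply/forallP => k; apply/implyP => kL; rewrite ffunE; have [//|kj] := eqVneq k j.
by have := h k; rewrite inE negb_or kj kL.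
Qed.

Lemma uniq_midx_upto q L : uniq L -> uniq (midx_upto q L).
Proof.
elim: L => [//|j L IH]; rewrite cons_uniq => /andP[jL uL].
rewrite midx_upto_cons; apply: allpairs_uniq_dep.
- exact: IH.
- by move=> w _; exact: iota_uniq.
move=> [w i] [v k] /allpairsPdep[w' [i' [+ _ [-> ->]]]] /allpairsPdep[v' [k' [+ _ [-> ->]]]] /=.
have z u : u \in midx_upto q L -> u j = 0%N.
  by rewrite mem_midx_upto// => /andP[_ /forallP/(_ j)]; rewrite jL => /eqP.
move=> /z wj /z vj /ffunP e.
have -> : w' = v'.
  apply/ffunP => l; have := e l; rewrite !ffunE; case: eqP => // -> _.
  by rewrite wj vj.
by have := e j; rewrite !ffunE eqxx => ->.
Qed.

Definition mterm (del : 'cV[R]_n) w : R := \prod_j tmon (w j) (del j 0).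

Lemma mtermE del w : mterm del w = (mfact w)%:R^-1 * \prod_j del j 0 ^+ w j.
Proof.
rewrite /mterm /tmon big_split /= mulrC; congr (_ * _).
by rewrite prodfV -natr_prod.
Qed.

Lemma mterm_upd del w j i : w j = 0%N -> mterm del (upd w j i) = mterm del w * tmon i (del j 0).
Proof.
move=> wj; rewrite /mterm (bigD1 j)//= [in RHS](bigD1 j)//= ffunE eqxx wj.
rewrite /tmon expr0 fact0 invr1 mulr1 mul1r mulrC; congr (_ * _).
by apply: eq_bigr => k kj; rewrite ffunE (negPf kj).
Qed.

Lemma mterm_le del w : `|mterm del w| <= `|del| ^+ msize w.
Proof.
rewrite normr_prod /msize expr_sum; apply: ler_prod => k _; rewrite normr_ge0 /=.
rewrite (le_trans (tmon_le _ _))// lerXn2r ?nnegrE//.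
exact: cV_coord_le.
Qed.

(** Differentiations restricted to the coordinates in [L]; for [enum 'I_n] this is the list used in
    [mderiv]. *)
Definition midx_seq w (L : seq 'I_n) : seq 'I_n := flatten [seq nseq (w j) j | j <- L].

Lemma size_midx_seq w L : size (midx_seq w L) = (\sum_(j <- L) w j)%N.
Proof.
rewrite /midx_seq size_flatten /shape -map_comp sumnE big_map.
by apply: eq_bigr => j _ /=; rewrite size_nseq.
Qed.

Section Tube.
Variables (t0 a : R) (phi0 : R -> 'cV[R]_n).
Local Notation D := (tube t0 a phi0).

Lemma tube_coordP t y : 0 <= a ->
  D (t, y) <-> t0 <= t /\ forall i, `|y i 0 - phi0 t i 0| <= a.
Proof.
move=> a0; split=> -[tt h]; split=> //.
  by move=> i; have := (cV_norm_le (y - phi0 t) a0).1 h i; rewrite !mxE.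
by apply/(cV_norm_le _ a0) => i; rewrite !mxE.
Qed.

Lemma pderiv_has_deriv g j t y tau :
  cvg (pquot g j t (y + tau *: delta_mx j 0) h
    @[h --> within (pdir D j t (y + tau *: delta_mx j 0)) 0^']) ->
  has_deriv_in (pdir D j t y) (fun u => g t (y + u *: delta_mx j 0)) tau
    (pderiv D j g t (y + tau *: delta_mx j 0)).
Proof.
move=> /cvgrPdist_le h; apply/has_deriv_inP => e e0.
have := h e e0; rewrite !near_withinE => -[d /= d0 hd].
exists d => // u Ju ud; have [->|ut] := eqVneq u tau.
  by rewrite !subrr scale0r subr0 !normr0 mulr0.
have ut0 : u - tau != 0 by rewrite subr_eq0.
have E : y + tau *: delta_mx j 0 + (u - tau) *: delta_mx j 0 = y + u *: delta_mx j 0 :> 'cV[R]_n.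
  by rewrite -addrA -scalerDl [tau + _]addrC subrK.
have := hd (u - tau); rewrite /ball_ /= sub0r normrN => /(_ ud ut0).
rewrite /pdir /= E => /(_ Ju); rewrite /pquot E => hl.
rewrite -(scalerKV ut0 (g t _ - g t _)) -scalerBr normrZ mulrC.
by rewrite ler_wpM2r// distrC.
Qed.

Definition off (L : seq 'I_n) (del : 'cV[R]_n) : 'cV[R]_n :=
  \col_i if i \in L then 0 else del i 0.

(** The expansion proceeds one coordinate at a time, from the last to the first, with [taylor_1d] on
    each; the derivatives then come out in the very order of [mderiv]. The intermediate points stay
    in the tube because its sections are cubes. Each stage adds one remainder per multi-index of the
    coordinates already expanded, whence the constant. *)
Lemma taylor_tube (g : R -> 'cV[R]_n -> 'cV[R]_n) (q : nat) (M : R) (t : R)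
    (y del : 'cV[R]_n) : 0 <= a -> 0 <= M ->
  C0q D q.+1 g ->
  (forall w, msize w = q.+1 -> forall z, D (t, z) -> `|mderiv D w g t z| <= M) ->
  D (t, y) -> D (t, y + del) ->
  `|g t (y + del) - \sum_(w <- midx_upto q (enum 'I_n)) mterm del w *: mderiv D w g t y|
  <= (\sum_(L <- [seq drop i (enum 'I_n) | i <- iota 1 n]) size (midx_upto q L))%:R
     * M * `|del| ^+ q.+1.
Proof.
move=> a0 M0 [gd _] gM Dy Dyd.
have Doff L : D (t, y + off L del).
  move: Dy Dyd => /(tube_coordP t y a0)[tt hy] /(tube_coordP t _ a0)[_ hyd].
  apply/(tube_coordP t _ a0); split=> // i; rewrite !mxE.
  by case: ifP => _; [rewrite addr0 hy|have := hyd i; rewrite mxE].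
(* [E L] is the error once the coordinates in [L] have been expanded; the others keep their full
   increment, as [off L del] records. *)
pose E L := g t (y + del) - \sum_(w <- midx_upto q L)
   mterm del w *: pderivs D (midx_seq w L) g t (y + off L del).
suff main L' L : enum 'I_n = L' ++ L -> `|E L| <=
   (\sum_(K <- [seq drop i L | i <- iota 1 (size L)]) size (midx_upto q K))%:R
     * M * `|del| ^+ q.+1.
  have := main [::] (enum 'I_n) erefl; rewrite size_enum_ord; apply: le_trans.
  have off0 : off (enum 'I_n) del = 0.
    by apply/matrixP => i k; rewrite !mxE mem_enum.
  by rewrite /E off0 addr0.
elim: L L' => [|j L IH] L' eL.
  rewrite /E /= big_nil big_seq1 !mul0r.
  have -> : mterm del midx0 = 1.
    by rewrite /mterm big1// => k _; rewrite ffunE /tmon expr0 fact0 invr1 mulr1.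
  rewrite scale1r /= [off _ _](_ : _ = del) ?subrr ?normr0//.
  by apply/matrixP => i k; rewrite !mxE ord1.
have uL : uniq (j :: L).
  by have := enum_uniq 'I_n; rewrite eL cat_uniq => /and3P[].
have /andP[jL uL'] := uL.
have z w : w \in midx_upto q L -> w j = 0%N.
  by rewrite mem_midx_upto// => /andP[_ /forallP/(_ j)]; rewrite jL => /eqP.
have zL' w k : k \in L' -> w \in midx_upto q L -> w k = 0%N.
  move=> kL'; rewrite mem_midx_upto// => /andP[_ /forallP/(_ k)].
  suff -> : k \notin L by move/eqP.
  have := enum_uniq 'I_n; rewrite eL cat_uniq => /and3P[_ + _].
  by apply: contra => kL; apply/hasP; exists k => //; rewrite inE kL orbT.
have sz w : w \in midx_upto q L -> (msize w <= q)%N.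
  by rewrite mem_midx_upto// => /andP[].
pose y' := y + off (j :: L) del.
have y'E : y + off L del = y' + del j 0 *: delta_mx j 0.
  rewrite /y' -addrA; congr (_ + _); apply/matrixP => i k; rewrite !mxE ord1 inE andbT.
  by case: eqP => [->|_] /=; rewrite ?(negPf jL) ?add0r ?mulr1// mulr0 addr0.
have seqE w i : w \in midx_upto q L ->
    midx_seq (upd w j i) (j :: L) = nseq i j ++ midx_seq w L.
  move=> wL; rewrite /midx_seq /= ffunE eqxx; congr (_ ++ flatten _).
  apply/eq_in_map => k kL; rewrite ffunE; case: eqP => // kj.
  by move: jL; rewrite -kj kL.
(* Remainder from expanding the coefficient of index [w] in the next coordinate [j], to the order
   [q - |w|] still available. *)
pose rem w := pderivs D (midx_seq w L) g t (y + off L del) -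
   \sum_(i < (q - msize w).+1) tmon i (del j 0) *: pderivs D (midx_seq (upd w j i) (j :: L)) g t y'.
have EE : E (j :: L) = E L + \sum_(w <- midx_upto q L) mterm del w *: rem w.
  rewrite /E -addrA -sumrN -[in RHS]sumrN; congr (_ + _).
  rewrite midx_upto_cons big_allpairs_dep -big_split /=.
  rewrite big_seq_cond [in RHS]big_seq_cond; apply: eq_bigr => w /andP[wL _].
  have iotaE m (f : nat -> 'cV[R]_n) : \sum_(i <- iota 0 m) f i = \sum_(i < m) f i.
    by rewrite -(big_mkord xpredT) /index_iota subn0.
  rewrite /rem scalerBr addKr -[0%N :: _]/(iota 0 (q - msize w).+1) iotaE sumrN scaler_sumr.
  congr (- _).
  apply: eq_bigr => i _; rewrite mterm_upd ?z// scalerA.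
  by congr (_ *: _).
have rem_le w : w \in midx_upto q L -> `|rem w| <= M * `|del| ^+ (q - msize w).+1.
  move=> wL; rewrite /rem y'E.
  (* [nseq i j] is prepended, so [h i.+1] is the derivative of [h i] in direction [j]. *)
  pose h i u := pderivs D (nseq i j ++ midx_seq w L) g t (y' + u *: delta_mx j 0).
  have szw : size (midx_seq w L) = msize w.
    rewrite size_midx_seq /msize; rewrite -(big_enum _ _ xpredT) /= eL big_cat big_cons /= z//.
    suff -> : (\sum_(i <- L') w i)%N = 0%N by rewrite !add0n.
    by rewrite big_seq_cond big1// => k /andP[kL' _]; exact: zL'.
  have -> : \sum_(i < (q - msize w).+1) tmon i (del j 0) *: pderivs D (midx_seq (upd w j i) (j :: L)) g t y' =
      \sum_(i < (q - msize w).+1) tmon i (del j 0) *: h i 0.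
    by apply: eq_bigr => i _; rewrite seqE// /h scale0r addr0.
  have J0 : pdir D j t y' 0 by rewrite /pdir /= scale0r addr0; exact: Doff.
  have Jd : pdir D j t y' (del j 0) by rewrite /pdir /= -y'E; exact: Doff.
  have := @taylor_1d (pdir D j t y') h M (q - msize w) M0 _ J0 _ _ _ Jd.
  have -> : h 0%N (del j 0) = pderivs D (midx_seq w L) g t (y' + del j 0 *: delta_mx j 0) by [].
  move=> hT; apply: le_trans (hT _ _ _) _.
  - move=> b c u /(tube_coordP t _ a0)[tt hb] /(tube_coordP t _ a0)[_ hc] /andP[bu uc].
    apply/(tube_coordP t _ a0); split=> // i; have := hb i; have := hc i.
    rewrite !mxE andbT; case: eqP => _; rewrite ?mulr0// !mulr1 !ler_norml.
    by move=> /andP[? ?] /andP[? ?]; apply/andP; split; lra.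
  - move=> i u iq Ju; rewrite /h.
    have := @pderiv_has_deriv (pderivs D (nseq i j ++ midx_seq w L) g) j t y' u.
    apply; apply: gd => //; rewrite size_cat size_nseq szw.
    by have := sz w wL; lia.
  - move=> u Ju; rewrite /h -seqE//.
    have := gM (upd w j (q - msize w).+1) _ _ Ju; rewrite msize_upd ?z//.
    rewrite addnS subnKC ?sz// => /(_ erefl); congr (_ <= _).
    rewrite /mderiv; suff -> : flatten [seq nseq (upd w j (q - msize w).+1 k) k | k <- enum 'I_n] =
        midx_seq (upd w j (q - msize w).+1) (j :: L) by [].
    rewrite eL map_cat flatten_cat -/(midx_seq _ (j :: L)) [X in X ++ _](_ : _ = [::])//.
    have : {in L', forall k, upd w j (q - msize w).+1 k = 0%N}.
      move=> k kL'; rewrite ffunE; case: eqP => [kj|_]; last exact: zL'.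
      have := enum_uniq 'I_n; rewrite eL cat_uniq => /and3P[_ /hasP[]].
      by exists j; rewrite ?mem_head// -kj.
    elim: (L') => //= k s IHs hs; rewrite hs ?mem_head// IHs// => x xs.
    by apply: hs; rewrite inE xs orbT.
  by rewrite ler_wpM2l// lerXn2r ?nnegrE// cV_coord_le.
rewrite EE (le_trans (ler_normD _ _))//= big_cons drop0.
have -> : [seq drop i (j :: L) | i <- iota 2 (size L)] = [seq drop i L | i <- iota 1 (size L)].
  by rewrite (iotaDl 1 1) -map_comp.
rewrite addnC natrD !mulrDl lerD//.
  by apply: (IH (rcons L' j)); rewrite cat_rcons.
rewrite (le_trans (ler_norm_sum _ _ _))//.
have -> : (size (midx_upto q L))%:R * M * `|del| ^+ q.+1 =
    \sum_(w <- midx_upto q L) (M * `|del| ^+ q.+1).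
  by rewrite big_const_seq count_predT iter_addr_0 -[RHS]mulr_natl mulrA.
rewrite big_seq_cond [leRHS]big_seq_cond; apply: ler_sum => w /andP[wL _].
rewrite normrZ (le_trans (ler_pM _ _ (mterm_le _ _) (rem_le w wL)))//.
by rewrite mulrCA -exprD addnS subnKC// sz.
Qed.

End Tube.

End Taylor.

(** * Formal monomials and series *)

Local Open Scope mset_scope.

Section Monomials.
Context {R : realType} {m : nat}.
Implicit Types (mu : monom m) (vr : 'I_m.+1 -> R) (I : set R).

Lemma big_msetD (T : Type) (idx : T) (op : Monoid.com_law idx) (mu1 mu2 : monom m)
    (F : 'I_m.+1 * nat -> T) :
  \big[op/idx]_(x <- enum_mset (mu1 `+` mu2)) F x =
  op (\big[op/idx]_(x <- enum_mset mu1) F x) (\big[op/idx]_(x <- enum_mset mu2) F x).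
Proof.
rewrite -big_cat; apply: perm_big; apply/allP => x _ /=.
by rewrite count_cat !count_mem_mset msetE2.
Qed.

Lemma big_mset1 (T : Type) (idx : T) (op : Monoid.com_law idx) (x : 'I_m.+1 * nat)
    (F : 'I_m.+1 * nat -> T) :
  \big[op/idx]_(y <- enum_mset [mset x]) F y = F x.
Proof. by rewrite enum_msetn big_seq1. Qed.

Lemma big_mset0' (T : Type) (idx : T) (op : Monoid.com_law idx)
    (F : 'I_m.+1 * nat -> T) :
  \big[op/idx]_(y <- enum_mset (mset0 : monom m)) F y = idx.
Proof. by rewrite enum_mset0 big_nil. Qed.

Lemma mset_ind (P : monom m -> Prop) :
  P mset0 -> (forall x mu, P mu -> P (x +` mu)) -> forall mu, P mu.
Proof.
move=> P0 PS mu; rewrite -(seq_mset_id mu); elim: (enum_mset mu) => [|x s IH].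
  by rewrite (_ : seq_mset [::] = mset0)//; apply/msetP => x; rewrite mset_seqE mset0E.
by rewrite mset_cons; exact: PS.
Qed.

Lemma mon_rankE vr mu : mon_rank vr mu = \sum_(x <- enum_mset mu) (vr x.1 + x.2%:R).
Proof.
rewrite big_mset; apply: eq_bigr => x _.
by rewrite Monoid.iteropE iter_addr_0 mulr_natr.
Qed.

Lemma mon_rankD vr mu1 mu2 :
  mon_rank vr (mu1 `+` mu2) = mon_rank vr mu1 + mon_rank vr mu2.
Proof. by rewrite !mon_rankE big_msetD. Qed.

Lemma mon_rank1 vr x : mon_rank vr [mset x] = vr x.1 + x.2%:R.
Proof. by rewrite mon_rankE big_mset1. Qed.

Lemma mon_rank0 vr : mon_rank vr (mset0 : monom m) = 0.
Proof. by rewrite mon_rankE big_mset0'. Qed.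

Lemma mon_rank_ge0 vr mu : (forall l, 0 < vr l) -> 0 <= mon_rank vr mu.
Proof.
move=> vr0; rewrite mon_rankE sumr_ge0// => x _.
by rewrite addr_ge0// ltW.
Qed.

Lemma mon_rank_ge vr mu x : (forall l, 0 < vr l) -> x \in mu ->
  vr x.1 + x.2%:R <= mon_rank vr mu.
Proof.
move=> vr0 xmu; rewrite -(msetB1K xmu) mon_rankD mon_rank1 lerDl.
exact: mon_rank_ge0.
Qed.

Lemma mset_neq0_mem mu : mu <> mset0 -> exists x, x \in mu.
Proof. by case: (mset_0Vmem mu) => [->//|[x xmu] _]; exists x. Qed.

Lemma msetD_eq0 (mu1 mu2 : monom m) : mu1 `+` mu2 = mset0 -> mu1 = mset0 /\ mu2 = mset0.
Proof.
move=> /msetP h; split; apply/msetP => x; have := h x; rewrite msetE2 !mset0E;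
  by move/eqP; rewrite addn_eq0 => /andP[/eqP ? /eqP ?].
Qed.

Lemma mon_evalE I (eps : 'I_m.+1 -> R -> R) mu t :
  mon_eval I eps mu t = \prod_(x <- enum_mset mu) derivn_in I x.2 (eps x.1) t.
Proof.
rewrite big_mset; apply: eq_bigr => x _.
by rewrite Monoid.iteropE iter_mulr_1.
Qed.

Lemma mon_evalD I (eps : 'I_m.+1 -> R -> R) mu1 mu2 t :
  mon_eval I eps (mu1 `+` mu2) t = mon_eval I eps mu1 t * mon_eval I eps mu2 t.
Proof. by rewrite !mon_evalE big_msetD. Qed.

Lemma mon_eval1 I (eps : 'I_m.+1 -> R -> R) x t :
  mon_eval I eps [mset x] t = derivn_in I x.2 (eps x.1) t.
Proof. by rewrite mon_evalE big_mset1. Qed.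

Lemma mon_eval0 I (eps : 'I_m.+1 -> R -> R) t : mon_eval I eps mset0 t = 1.
Proof. by rewrite mon_evalE big_mset0'. Qed.

(** One term of the product rule: a single copy of the symbol [x] moves to the next derivative. *)
Definition mon_diff mu (x : 'I_m.+1 * nat) : monom m := (mu `\ x) `+` [mset (x.1, x.2.+1)].

Lemma mon_dcoefE mu' mu : mon_dcoef mu' mu = (\sum_(x <- enum_mset mu') (mu == mon_diff mu' x))%N.
Proof. by rewrite sum_mset. Qed.

Lemma mon_rank_diff vr mu x : x \in mu ->
  mon_rank vr (mon_diff mu x) = mon_rank vr mu + 1.
Proof.
move=> xmu; rewrite /mon_diff mon_rankD mon_rank1 /= -[in RHS](msetB1K xmu) mon_rankD mon_rank1.
by rewrite -natr1; ring.
Qed.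

Lemma mon_diff_neq0 mu x : mon_diff mu x <> mset0.
Proof.
move=> /msetD_eq0[_ /msetP/(_ (x.1, x.2.+1))].
by rewrite msetnxx mset0E.
Qed.

(** [enum_mset] repeats each symbol with its multiplicity, which accounts for the power rule;
    induction on the multiset with the product rule then suffices. *)
Lemma mon_eval_deriv I (eps : 'I_m.+1 -> R -> R) mu t : I t ->
  (forall x, x \in mu ->
     has_deriv_in I (derivn_in I x.2 (eps x.1)) t (derivn_in I x.2.+1 (eps x.1) t)) ->
  has_deriv_in I (mon_eval I eps mu) t (\sum_(x <- enum_mset mu) mon_eval I eps (mon_diff mu x) t).
Proof.
move=> It; elim/mset_ind: mu => [_|x mu IH h].
  rewrite big_mset0'; have := @has_deriv_in_cst R _ I (1 : R) t.
  by congr (has_deriv_in _ _ _ _); apply/funext => u; rewrite mon_eval0.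
have hx : has_deriv_in I (mon_eval I eps [mset x]) t (derivn_in I x.2.+1 (eps x.1) t).
  have := h x (mset1D1 _ _); congr (has_deriv_in _ _ _ _).
  by apply/funext => u; rewrite mon_eval1.
have {}IH := IH (fun y ymu => h y (mset1Dr _ ymu)).
have := has_deriv_inM It hx IH; congr (has_deriv_in _ _ _ _).
  by apply/funext => u; rewrite mon_evalD.
rewrite big_msetD big_mset1; congr (_ + _).
  by rewrite /mon_diff msetD1K mon_evalD mon_eval1 mulrC.
rewrite big_distrr /= big_seq_cond [RHS]big_seq_cond; apply: eq_bigr => y /andP[ymu _].
rewrite -mon_evalD /mon_diff msetDA; congr (mon_eval _ _ (_ `+` _) _).
by rewrite msetDBA// msub1set.
Qed.

End Monomials.

(** * Enumeration of the ranks *)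

Section RankEnumeration.
Context {R : realType} {m : nat}.
Variables (vr : 'I_m.+1 -> R) (rho : nat -> R) (kappa : nat -> nat)
  (nu : nat -> nat -> monom m) (k : nat).
Hypothesis vr_gt0 : forall l, 0 < vr l.
Hypothesis hrank : rank_enum vr rho kappa nu.

Lemma rho_mono s s' : (1 <= s)%N -> (s <= s')%N -> rho s <= rho s'.
Proof.
move=> s1; rewrite leq_eqVlt => /predU1P[->//|ss'].
by rewrite ltW// (rho_incr hrank).
Qed.

Lemma rho_lt_inj s s' : (1 <= s)%N -> (1 <= s')%N -> rho s < rho s' -> (s < s')%N.
Proof.
move=> s1 s'1; rewrite ltnNge => h; apply/negP => h'.
by move: h; rewrite ltNge rho_mono.
Qed.

Lemma rank_rho (mu : monom m) : mu <> mset0 -> exists s, (1 <= s)%N /\ rho s = mon_rank vr mu.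
Proof. by move=> mu0; apply/(rhoP hrank); exists mu. Qed.

(** Every rank occurs among the [rho s], so none lies strictly between [rho k] and [rho k.+1]. This
    is the source of the exponent in the error. *)
Lemma rank_gap (mu : monom m) : (1 <= k)%N -> mu <> mset0 ->
  ~~ (mon_rank vr mu <= rho k) -> rho k.+1 <= mon_rank vr mu.
Proof.
move=> k1 /rank_rho[s [s1 <-]]; rewrite -ltNge => /(rho_lt_inj k1 s1) ks.
exact: rho_mono.
Qed.

Definition low_monoms : seq (monom m) :=
  [seq nu s p | s <- iota 1 k, p <- iota 0 (kappa s)].

Lemma mem_low_monoms mu : (1 <= k)%N ->
  mu \in low_monoms <-> mu <> mset0 /\ mon_rank vr mu <= rho k.
Proof.
move=> k1; split=> [/allpairsPdep[s [p [+ + ->]]]|[mu0 hk]].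
  rewrite !mem_iota add1n ltnS /= => /andP[s1 sk] pk.
  have [|nu0 ->] := (nuP hrank (nu s p) s1).2; first by exists p.
  by split=> //; exact: rho_mono.
have [s [s1 es]] := rank_rho mu0.
have [|p [pk ep]] := (nuP hrank mu s1).1; first by split.
apply/allpairsPdep; exists s, p; split; rewrite ?mem_iota ?add1n//.
rewrite s1 ltnS /= leqNgt; apply/negP => /(rho_incr hrank k1).
by rewrite es ltNge hk.
Qed.

Lemma nu_rank s p : (1 <= s)%N -> (p < kappa s)%N ->
  nu s p <> mset0 /\ mon_rank vr (nu s p) = rho s.
Proof. by move=> s1 pk; apply/(nuP hrank _ s1); exists p. Qed.

Lemma uniq_low_monoms : uniq low_monoms.
Proof.
apply: allpairs_uniq_dep; first exact: iota_uniq.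
  by move=> s _; exact: iota_uniq.
move=> [s p] [s' p'] /allpairsPdep[a [b [+ + [-> ->]]]] /allpairsPdep[a' [b' [+ + [-> ->]]]] /=.
rewrite !mem_iota !add0n /= => /andP[a1 _] bk /andP[a'1 _] b'k e.
have aa' : a = a'.
  have [_ ra] := nu_rank a1 bk; have [_ ra'] := nu_rank a'1 b'k.
  move: ra'; rewrite -e ra => raa'.
  by case: (ltngtP a a') => // /(rho_incr hrank) => /(_ ltac:(assumption)); rewrite raa' ltxx.
rewrite -aa' in e b'k *.
by rewrite (nu_inj hrank a1 bk b'k e).
Qed.

Lemma sum_low_monoms (V : nmodType) (F : monom m -> V) :
  \sum_(1 <= s < k.+1) \sum_(0 <= p < kappa s) F (nu s p) = \sum_(mu <- low_monoms) F mu.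
Proof.
rewrite big_allpairs_dep /index_iota subSS subn0.
by apply: eq_bigr => s _; rewrite subn0.
Qed.

End RankEnumeration.

(** * Formal series graded by the rank *)

Section FormalSeries.
Context {R : realType} {m : nat}.
Variables (vr : 'I_m.+1 -> R).
Hypothesis vr_gt0 : forall l, 0 < vr l.
Implicit Types (a b : fseries R m) (mu : monom m).

Lemma mon_rank_le_l mu1 mu2 mu : mu1 `+` mu2 = mu -> mon_rank vr mu1 <= mon_rank vr mu.
Proof. by move=> <-; rewrite mon_rankD lerDl mon_rank_ge0. Qed.

Lemma mon_rank_le_r mu1 mu2 mu : mu1 `+` mu2 = mu -> mon_rank vr mu2 <= mon_rank vr mu.
Proof. by move=> <-; rewrite mon_rankD lerDr mon_rank_ge0. Qed.

Lemma fs_mul_ext a a' b b' mu :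
  (forall nu, mon_rank vr nu <= mon_rank vr mu -> a nu = a' nu) ->
  (forall nu, mon_rank vr nu <= mon_rank vr mu -> b nu = b' nu) ->
  fs_mul a b mu = fs_mul a' b' mu.
Proof.
move=> ha hb; apply: eq_fsbigr => -[x y]; rewrite inE /= => xy.
by rewrite ha ?hb//; [exact: mon_rank_le_r xy|exact: mon_rank_le_l xy].
Qed.

(** The inequality is strict because [eps l] itself has positive rank; this makes the recursion for
    the coefficients well founded. *)
Lemma fs_eps_mul_ext l b b' mu :
  (forall nu, mon_rank vr nu < mon_rank vr mu -> b nu = b' nu) ->
  fs_mul (fs_eps R l) b mu = fs_mul (fs_eps R l) b' mu.
Proof.
move=> hb; apply: eq_fsbigr => -[x y]; rewrite inE /= => xy.
rewrite /fs_eps; case: eqP => [xl|_]; last by rewrite !mul0r.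
rewrite hb// -xy mon_rankD xl /mon_eps mon_rank1 ltrDr ltr_pwDl//.
Qed.

Lemma fs_mexp_ext n (a a' : 'I_n -> fseries R m) (w : midx n) (c : R) :
  (forall j nu, mon_rank vr nu < c -> a j nu = a' j nu) ->
  forall mu, mon_rank vr mu < c -> fs_mexp a w mu = fs_mexp a' w mu.
Proof.
move=> h; rewrite /fs_mexp.
apply: (big_rec2 (fun x y : fseries R m => forall mu, mon_rank vr mu < c -> x mu = y mu)) => //.
move=> j x y _ hxy mu hmu; apply: fs_mul_ext => nu' hnu; last by rewrite hxy// (le_lt_trans hnu).
elim: (w j) nu' hnu => [//|i IH] nu' hnu /=; apply: fs_mul_ext => nu2 h2.
  by rewrite h// (le_lt_trans h2)// (le_lt_trans hnu).
by rewrite IH// (le_trans h2).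
Qed.

Definition fs_ord (c : R) a : Prop := forall mu, mon_rank vr mu < c -> a mu = 0.

Lemma fs_ord_mul c d a b : fs_ord c a -> fs_ord d b -> fs_ord (c + d) (fs_mul a b).
Proof.
move=> ha hb mu hmu; apply: fsbig1 => -[x y] /= xy.
have [xc|xc] := ltP (mon_rank vr x) c; first by rewrite ha// mul0r.
rewrite [b y]hb ?mulr0//; move: hmu; rewrite -xy mon_rankD; lra.
Qed.

Lemma fs_ord_one : fs_ord 0 (@fs_one R m).
Proof. by move=> mu; rewrite ltNge mon_rank_ge0. Qed.

Lemma fs_ord_eps l : fs_ord (vr l) (fs_eps R l).
Proof.
move=> mu; rewrite /fs_eps; case: eqP => // -> /=.
by rewrite mon_rank1 addr0 ltxx.
Qed.

Lemma fs_ord_mexp n (a : 'I_n -> fseries R m) (w : midx n) (c : R) :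
  (forall j, fs_ord c (a j)) -> fs_ord ((msize w)%:R * c) (fs_mexp a w).
Proof.
move=> h; rewrite /fs_mexp /msize.
apply: (big_rec2 (fun (x : nat) (y : fseries R m) => fs_ord (x%:R * c) y)).
  by rewrite mul0r; exact: fs_ord_one.
move=> j x y _ hxy; rewrite natrD mulrDl; apply: fs_ord_mul => //.
elim: (w j) => [|i IH] /=; first by rewrite mul0r; exact: fs_ord_one.
by rewrite -add1n natrD mulrDl mul1r; exact: fs_ord_mul.
Qed.

(** Ranks are nonnegative and additive, so both factors of a monomial of rank at most [c] are again
    in [S]. The product becomes a finite double sum that can be exchanged with other sums. *)
Lemma fs_mul_low (S : seq (monom m)) (c : R) a b mu : uniq S ->
  (forall nu, mon_rank vr nu <= c -> nu \in S) -> mon_rank vr mu <= c ->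
  fs_mul a b mu = \sum_(x <- S) \sum_(y <- S) (x `+` y == mu)%:R * (a x * b y).
Proof.
move=> uS hS hmu; rewrite /fs_mul.
rewrite (fsbigE [seq p <- [seq (x, y) | x <- S, y <- S] | p.1 `+` p.2 == mu]).
- rewrite big_filter_cond big_mkcond big_allpairs; apply: eq_bigr => x _.
  apply: eq_bigr => y _ /=; case: (eqVneq (x `+` y) mu) => [xy|_]; last by rewrite mul0r.
  by rewrite mul1r mem_set.
- by rewrite filter_uniq// allpairs_uniq// => -[? ?] [? ?].
- by move=> p /=; rewrite mem_filter => /andP[/eqP].
move=> [x y] /= xy; rewrite mem_filter xy eqxx /= => /negP[].
apply/allpairsP; exists (x, y) => /=; split=> //; apply: hS; apply: le_trans hmu.
  exact: mon_rank_le_l xy.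
exact: mon_rank_le_r xy.
Qed.

End FormalSeries.

(** * Orders of magnitude *)

Section BigOh.
Context {R : realType}.

(** Explicit constants, so that bounds can be added and multiplied; [C >= 0] also allows [W] to be
    enlarged. *)
Definition is_bigO (V : normedModType R) (f : R -> V) (W : R -> R) : Prop :=
  exists C T, 0 <= C /\ forall t, T <= t -> `|f t| <= C * W t.

Lemma is_bigO_ext (V : normedModType R) (f g : R -> V) W T :
  (forall t, T <= t -> f t = g t) -> is_bigO f W -> is_bigO g W.
Proof.
move=> fg [C [T' [C0 h]]]; exists C, (Num.max T T'); split=> // t.
by rewrite ge_max => /andP[Tt T't]; rewrite -fg// h.
Qed.

Lemma is_bigO_add (V : normedModType R) (f g : R -> V) W :
  is_bigO f W -> is_bigO g W -> is_bigO (fun t => f t + g t) W.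
Proof.
move=> [C [T [C0 h]]] [C' [T' [C'0 h']]]; exists (C + C'), (Num.max T T').
split; first exact: addr_ge0.
move=> t; rewrite ge_max => /andP[Tt T't]; rewrite mulrDl.
by rewrite (le_trans (ler_normD _ _))// lerD ?h ?h'.
Qed.

Lemma is_bigO_opp (V : normedModType R) (f : R -> V) W :
  is_bigO f W -> is_bigO (fun t => - f t) W.
Proof. by move=> [C [T [C0 h]]]; exists C, T; split=> // t Tt; rewrite normrN h. Qed.

Lemma is_bigO0 (V : normedModType R) W : is_bigO (fun=> 0 : V) W.
Proof. by exists 0, 0; split=> // t _; rewrite normr0 mul0r. Qed.

Lemma is_bigO_sum (V : normedModType R) (T : eqType) (r : seq T) (f : T -> R -> V) W :
  (forall i, i \in r -> is_bigO (f i) W) -> is_bigO (fun t => \sum_(i <- r) f i t) W.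
Proof.
elim: r => [_|x r IH h].
  by under eq_fun do rewrite big_nil; exact: is_bigO0.
under eq_fun do rewrite big_cons; apply: is_bigO_add; first exact: h (mem_head _ _).
by apply: IH => i ir; apply: h; rewrite inE ir orbT.
Qed.

Lemma is_bigO_scale (V : normedModType R) (g : R -> R) (f : R -> V) W W' :
  is_bigO g W -> is_bigO f W' -> is_bigO (fun t => g t *: f t) (fun t => W t * W' t).
Proof.
move=> [C [T [C0 h]]] [C' [T' [C'0 h']]]; exists (C * C'), (Num.max T T').
split; first exact: mulr_ge0.
move=> t; rewrite ge_max => /andP[Tt T't]; rewrite normrZ mulrACA.
by rewrite ler_pM ?h ?h'.
Qed.

Lemma is_bigO_mono (V : normedModType R) (f : R -> V) W W' T :
  (forall t, T <= t -> W t <= W' t) -> is_bigO f W -> is_bigO f W'.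
Proof.
move=> WW' [C [T' [C0 h]]]; exists C, (Num.max T T'); split=> // t.
rewrite ge_max => /andP[Tt T't]; rewrite (le_trans (h t T't))// ler_wpM2l//.
exact: WW'.
Qed.

Lemma is_bigO_bounded_scale (V : normedModType R) (g : R -> R) (f : R -> V) W :
  is_bigO g (fun=> 1) -> is_bigO f W -> is_bigO (fun t => g t *: f t) W.
Proof.
move=> hg hf; apply: (is_bigO_mono (T := 0)) (is_bigO_scale hg hf) => t _.
by rewrite mul1r.
Qed.

Lemma is_bigO_scale_bounded (V : normedModType R) (g : R -> R) (f : R -> V) W :
  is_bigO g W -> is_bigO f (fun=> 1) -> is_bigO (fun t => g t *: f t) W.
Proof.
move=> hg hf; apply: (is_bigO_mono (T := 0)) (is_bigO_scale hg hf) => t _.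
by rewrite mulr1.
Qed.

Lemma is_bigO_cst (c : R) : is_bigO (fun=> c) (fun=> 1 : R).
Proof. by exists `|c|, 0; split=> // t _; rewrite mulr1. Qed.

Lemma eqO_pinftyP (V : normedModType R) (f : R -> V) (W : R -> R) T :
  (forall t, T <= t -> 0 <= W t) -> f =O_ (pinfty_nbhs R) W <-> is_bigO f W.
Proof.
move=> W0; rewrite eqO_exP; split=> [[C [C0 [M [Mr h]]]]|[C [T' [C0 h]]]].
  exists C, (Num.max (M + 1) T); split; first exact: ltW.
  move=> t; rewrite ge_max => /andP[Mt Tt].
  have := h t; rewrite (ger0_norm (W0 t Tt)); apply.
  by rewrite (lt_le_trans _ Mt)// ltrDl.
exists (C + 1); first by rewrite ltr_wpDl.
exists (Num.max T T'); split; first exact: num_real.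
move=> t; rewrite gt_max => /andP[/ltW Tt /ltW T't].
rewrite (ger0_norm (W0 t Tt)) (le_trans (h t T't))//.
by rewrite ler_wpM2r ?W0// lerDl.
Qed.

End BigOh.

(** * Asymptotic size of monomials and tracking of formal series *)

Section Scale.
Context {R : realType} {m : nat}.
Variables (t0 : R) (vr : 'I_m.+1 -> R) (rho : nat -> R) (kappa : nat -> nat)
  (nu : nat -> nat -> monom m) (k : nat) (eps : 'I_m.+1 -> R -> R) (p_ : 'I_m.+1 -> nat).
Hypothesis vr_gt0 : forall l, 0 < vr l.
Hypothesis vr_min : forall l, vr ord0 <= vr l.
Hypothesis hrank : rank_enum vr rho kappa nu.
Hypothesis k_gt0 : (1 <= k)%N.
Hypothesis p_E : forall l, (p_ l)%:Z = Num.max 0 (Num.floor (rho k - vr l) + 1).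
Hypothesis eps_gt0 : forall t, t0 <= t -> 0 < eps ord0 t.
Hypothesis eps_small : forall d : R, 0 < d -> exists T, forall t, T <= t -> eps ord0 t <= d.

Local Notation I := (`[t0, +oo[%classic).

(** The size of a monomial of rank [x]; addition of ranks becomes multiplication of sizes. *)
Definition epow (x t : R) : R := eps ord0 t `^ (x / vr ord0).

Hypothesis eps_bigO : forall l r, (r <= p_ l)%N ->
  is_bigO (derivn_in I r (eps l)) (epow (vr l + r%:R)).

Local Notation S := (low_monoms kappa nu k).
Local Notation W := (epow (rho k.+1)).
Local Notation ev := (mon_eval I eps).

Lemma epow_ge0 x t : 0 <= epow x t. Proof. exact: powR_ge0. Qed.

Lemma epow_gt0 x t : t0 <= t -> 0 < epow x t.
Proof. by move=> tt; rewrite powR_gt0// eps_gt0. Qed.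

Lemma epowD x y t : t0 <= t -> epow (x + y) t = epow x t * epow y t.
Proof.
move=> tt; rewrite /epow mulrDl powRD//; apply/implyP => _.
by rewrite gt_eqF// eps_gt0.
Qed.

Lemma epow_anti x y : x <= y -> exists T, forall t, T <= t -> epow y t <= epow x t.
Proof.
move=> xy; have [T hT] := eps_small ltr01; exists (Num.max t0 T) => t.
rewrite ge_max => /andP[tt Tt]; apply: ger_powR; first by rewrite eps_gt0// hT.
by rewrite ler_pM2r// invr_gt0.
Qed.

Lemma epow_le1 x : 0 <= x -> exists T, forall t, T <= t -> epow x t <= 1.
Proof.
move=> /epow_anti[T hT]; exists T => t Tt.
by have := hT t Tt; rewrite {2}/epow mul0r powRr0.
Qed.

Lemma is_bigO_epow (V : normedModType R) (f : R -> V) x y : x <= y ->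
  is_bigO f (epow y) -> is_bigO f (epow x).
Proof. by move=> /epow_anti[T hT]; exact: is_bigO_mono hT. Qed.

Lemma is_bigO_epow_bounded (V : normedModType R) (f : R -> V) x : 0 <= x ->
  is_bigO f (epow x) -> is_bigO f (fun=> 1).
Proof. by move=> /epow_le1[T hT]; exact: is_bigO_mono hT. Qed.

Lemma is_bigO_epowM (V : normedModType R) (g : R -> R) (f : R -> V) x y :
  is_bigO g (epow x) -> is_bigO f (epow y) -> is_bigO (fun t => g t *: f t) (epow (x + y)).
Proof.
move=> hg hf; apply: (is_bigO_mono (T := t0)) (is_bigO_scale hg hf) => t tt.
by rewrite epowD.
Qed.

(* p_ l is the order up to which the derivatives of eps l are assumed to exist
   and to be controlled. *)
Definition mon_ok (mu : monom m) : Prop := forall x, x \in mu -> (x.2 <= p_ x.1)%N.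

Lemma mon_bigO mu : mon_ok mu -> is_bigO (ev mu) (epow (mon_rank vr mu)).
Proof.
elim/(@mset_ind m): mu => [_|x mu IH h].
  apply: (is_bigO_ext (T := 0) (f := fun=> 1 : R)); first by move=> t _; rewrite mon_eval0.
  apply: (is_bigO_mono (T := 0)) (is_bigO_cst 1) => t _.
  by rewrite mon_rank0 /epow mul0r powRr0.
apply: (is_bigO_ext (T := 0) (f := fun t => ev [mset x] t *: ev mu t)).
  by move=> t _; rewrite mon_evalD.
rewrite mon_rankD mon_rank1; apply: is_bigO_epowM.
  apply: (is_bigO_ext (T := 0) (f := derivn_in I x.2 (eps x.1))).
    by move=> t _; rewrite mon_eval1.
  exact/eps_bigO/h/mset1D1.
by apply: IH => y ymu; apply/h/mset1Dr.
Qed.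

(** The [+ 1] in [p_] shows here: a derivative occurring in a monomial of rank at most [rho k] can
    be differentiated once more within the assumed regularity. *)
Lemma p_gt x mu : x \in mu -> mon_rank vr mu <= rho k -> (x.2 < p_ x.1)%N.
Proof.
move=> /(mon_rank_ge vr_gt0) h1 h2.
have : (Posz x.2 <= Num.floor (rho k - vr x.1)) by rewrite floor_ge_int -pmulrn; lra.
move=> h3; rewrite -(ler_nat int) !natz p_E le_max; apply/orP; right.
by rewrite -addn1 PoszD lerD2r.
Qed.

Lemma low_mon_ok mu : mon_rank vr mu <= rho k -> mon_ok mu.
Proof. by move=> hmu x xmu; rewrite ltnW// (p_gt xmu). Qed.

Lemma mon_okD mu1 mu2 : mon_ok mu1 -> mon_ok mu2 -> mon_ok (mu1 `+` mu2).
Proof. by move=> h1 h2 x; rewrite in_msetD => /orP[/h1|/h2]. Qed.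

Lemma mon_ok_diff mu x : mon_rank vr mu <= rho k -> x \in mu -> mon_ok (mon_diff mu x).
Proof.
move=> hmu xmu; apply: mon_okD.
  move=> y; rewrite in_msetB1 => /andP[_ ymu]; exact: low_mon_ok hmu _ ymu.
by move=> y; rewrite in_mset1 => /eqP -> /=; exact: p_gt xmu hmu.
Qed.

Lemma rho_k_ge0 : 0 <= rho k.
Proof.
have [mu [_ <-]] := (rhoP hrank (rho k)).2 (ex_intro _ k (conj k_gt0 erefl)).
exact: mon_rank_ge0.
Qed.

Lemma rho_kS_ge : rho k <= rho k.+1.
Proof. by rewrite ltW// (rho_incr hrank). Qed.

Lemma rho_kS_ge0 : 0 <= rho k.+1.
Proof. exact: le_trans rho_k_ge0 rho_kS_ge. Qed.

Lemma mem_low0 mu : mon_rank vr mu <= rho k <-> mu \in mset0 :: S.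
Proof.
rewrite inE; split=> [h|/orP[/eqP ->|/(mem_low_monoms hrank _ k_gt0)[]//]].
  by case: eqVneq => //= /eqP mu0; apply/(mem_low_monoms hrank _ k_gt0).
by rewrite mon_rank0 rho_k_ge0.
Qed.

Lemma uniq_low0 : uniq (mset0 :: S).
Proof.
rewrite /= (uniq_low_monoms k hrank) andbT; apply/negP.
by move=> /(mem_low_monoms hrank _ k_gt0)[].
Qed.

Lemma high_bigO mu : mon_ok mu -> mu \notin mset0 :: S -> is_bigO (ev mu) W.
Proof.
move=> hmu muS; apply: is_bigO_epow (mon_bigO hmu); apply: (rank_gap hrank k_gt0).
  by move=> mu0; move: muS; rewrite mu0 mem_head.
by apply/negP => /mem_low0; apply/negP.
Qed.

(* The formal series a, truncated after rank rho_k, represents the function x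
   up to an error of the order of the remainder. *)
Definition tracks (x : R -> R) (a : R -> fseries R m) : Prop :=
  (forall mu, mu \in mset0 :: S -> is_bigO (fun t => a t mu) (fun=> 1 : R)) /\
  is_bigO (fun t => x t - \sum_(mu <- mset0 :: S) a t mu * ev mu t) W.

Lemma low_bounded mu : mu \in mset0 :: S -> is_bigO (ev mu) (fun=> 1).
Proof.
move=> /mem_low0 h; apply: is_bigO_epow_bounded (mon_bigO (low_mon_ok h)).
exact: mon_rank_ge0.
Qed.

Lemma is_bigO_M (f g : R -> R) W' :
  is_bigO f (fun=> 1) -> is_bigO g W' -> is_bigO (fun t => f t * g t) W'.
Proof. exact: is_bigO_bounded_scale. Qed.

Lemma is_bigO_Mr (f g : R -> R) W' :
  is_bigO f W' -> is_bigO g (fun=> 1) -> is_bigO (fun t => f t * g t) W'.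
Proof. exact: is_bigO_scale_bounded. Qed.

Lemma tracks_bounded x a : tracks x a -> is_bigO x (fun=> 1).
Proof.
move=> [ha hx].
apply: (is_bigO_ext (T := 0) (f := fun t => (x t - \sum_(mu <- mset0 :: S) a t mu * ev mu t) +
   \sum_(mu <- mset0 :: S) a t mu * ev mu t)); first by move=> t _; rewrite subrK.
apply: is_bigO_add; first by apply: is_bigO_epow_bounded hx; exact: rho_kS_ge0.
apply: is_bigO_sum => mu muS; apply: is_bigO_M; first exact: ha.
exact: low_bounded.
Qed.

(** The error is [(x - X) y + X (y - Y) + Z]: two truncation errors times bounded functions, and in
    [Z] the products of two low monomials whose rank exceeds [rho k], which [high_bigO] bounds. *)
Lemma tracks_mul x y a b : tracks x a -> tracks y b ->
  tracks (fun t => x t * y t) (fun t => fs_mul (a t) (b t)).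
Proof.
move=> hx hy; have [ha xa] := hx; have [hb yb] := hy.
have low_mul mu : mu \in mset0 :: S -> forall t, fs_mul (a t) (b t) mu =
    \sum_(u <- mset0 :: S) \sum_(v <- mset0 :: S) (u `+` v == mu)%:R * (a t u * b t v).
  move=> /mem_low0 hmu t; apply: (fs_mul_low vr_gt0 _ _ uniq_low0 _ hmu) => v.
  by move/mem_low0.
split=> [mu muS|].
  under eq_fun do rewrite low_mul//.
  apply: is_bigO_sum => u uS; apply: is_bigO_sum => v vS.
  apply: is_bigO_M; first exact: is_bigO_cst.
  by apply: is_bigO_M; [exact: ha|exact: hb].
pose X t := \sum_(u <- mset0 :: S) a t u * ev u t.
pose Y t := \sum_(v <- mset0 :: S) b t v * ev v t.
have Xb : is_bigO X (fun=> 1).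
  by apply: is_bigO_sum => u uS; apply: is_bigO_M; [exact: ha|exact: low_bounded].
pose Z t := \sum_(u <- mset0 :: S) \sum_(v <- mset0 :: S)
  (u `+` v \notin mset0 :: S)%:R * (a t u * b t v * ev (u `+` v) t).
apply: (is_bigO_ext (T := 0) (f := fun t => (x t - X t) * y t + X t * (y t - Y t) + Z t)).
  move=> t _.
  have E : \sum_(mu <- mset0 :: S) fs_mul (a t) (b t) mu * ev mu t =
      \sum_(u <- mset0 :: S) \sum_(v <- mset0 :: S)
        (u `+` v \in mset0 :: S)%:R * (a t u * b t v * ev (u `+` v) t).
    rewrite big_seq_cond; under eq_bigr => mu /andP[muS _] do rewrite low_mul// mulr_suml.
    rewrite -big_seq_cond exchange_big /=; apply: eq_bigr => u _.
    under eq_bigr do rewrite mulr_suml.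
    rewrite exchange_big /=; apply: eq_bigr => v _.
    have [uvS|uvS] := boolP (u `+` v \in mset0 :: S).
      rewrite (bigD1_seq _ uvS uniq_low0) /= eqxx !mul1r big1 ?addr0// => mu muv.
      by rewrite eq_sym (negPf muv) !mul0r.
    rewrite mul0r big_seq_cond big1// => mu /andP[muS _].
    case: eqP => [e|_]; last by rewrite !mul0r.
    by rewrite e muS in uvS.
  have XY : X t * Y t = \sum_(mu <- mset0 :: S) fs_mul (a t) (b t) mu * ev mu t + Z t.
    rewrite E /X /Y big_distrlr /Z -big_split; apply: eq_bigr => u _ /=.
    rewrite -big_split; apply: eq_bigr => v _ /=; rewrite mon_evalD.
    by case: (_ \in _) => /=; ring.
  by rewrite -(addrK (Z t) (\sum_(mu <- _) _)) -XY; ring.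
apply: is_bigO_add; first apply: is_bigO_add.
- by apply: is_bigO_Mr xa _; exact: tracks_bounded hy.
- exact: is_bigO_M.
apply: is_bigO_sum => u uS; apply: is_bigO_sum => v vS.
have [uvS|uvS] := boolP (u `+` v \in mset0 :: S).
  by under eq_fun do rewrite mul0r; exact: is_bigO0.
apply: is_bigO_M; first exact: is_bigO_cst.
apply: is_bigO_M; first by apply: is_bigO_M; [exact: ha|exact: hb].
apply: high_bigO => //; apply: mon_okD; apply: low_mon_ok; exact/mem_low0.
Qed.

Lemma tracks_one : tracks (fun=> 1) (fun=> @fs_one R m).
Proof.
split=> [mu _|]; first exact: is_bigO_cst.
apply: (is_bigO_ext (T := 0) (f := fun=> 0)); last exact: is_bigO0.
move=> t _; rewrite big_cons /fs_one eqxx mul1r mon_eval0 big1_seq ?addr0 ?subrr//.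
move=> mu /andP[_ /(mem_low_monoms hrank _ k_gt0)[/eqP mu0 _]].
by rewrite (negPf mu0) mul0r.
Qed.

Lemma tracks_eps l : tracks (eps l) (fun=> fs_eps R l).
Proof.
split=> [mu _|]; first exact: is_bigO_cst.
have eE t : ev (mon_eps l) t = eps l t by rewrite mon_eval1.
have [lS|lS] := boolP (mon_eps l \in mset0 :: S).
  apply: (is_bigO_ext (T := 0) (f := fun=> 0)); last exact: is_bigO0.
  move=> t _; rewrite (bigD1_seq _ lS uniq_low0) /= /fs_eps eqxx mul1r eE.
  by rewrite big1 ?addr0 ?subrr// => mu /negPf ->; rewrite mul0r.
apply: (is_bigO_ext (T := 0) (f := ev (mon_eps l))).
  move=> t _; rewrite big1_seq ?subr0 ?eE// => mu /andP[_ muS].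
  rewrite /fs_eps; case: eqP => [e|_]; last by rewrite mul0r.
  by move: lS; rewrite -e muS.
apply: high_bigO => // x; rewrite in_mset1 => /eqP -> /=; exact: leq0n.
Qed.

Lemma tracks_mexp n (x : 'I_n -> R -> R) (a : 'I_n -> R -> fseries R m) (w : midx n) :
  (forall j, tracks (x j) (a j)) ->
  tracks (fun t => \prod_j x j t ^+ w j) (fun t => fs_mexp (fun j => a j t) w).
Proof.
move=> h; rewrite /fs_mexp.
have : forall r : seq 'I_n, tracks (fun t => \prod_(j <- r) x j t ^+ w j)
    (fun t => \big[@fs_mul R m/@fs_one R m]_(j <- r) fs_exp (a j t) (w j)).
  elim=> [|j r IH].
    under [X in tracks X]eq_fun do rewrite big_nil.
    by under [X in tracks _ X]eq_fun do rewrite big_nil; exact: tracks_one.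
  under [X in tracks X]eq_fun do rewrite big_cons.
  under [X in tracks _ X]eq_fun do rewrite big_cons.
  apply: tracks_mul => //; elim: (w j) => [|i IHi].
    by under eq_fun do rewrite expr0; exact: tracks_one.
  by under eq_fun do rewrite exprS; exact: tracks_mul.
exact.
Qed.

End Scale.

(** * The coefficients as finite sums *)

Section Coefficients.
Context {R : realType} {n m : nat}.
Variables (vr : 'I_m.+1 -> R) (rho : nat -> R) (kappa : nat -> nat)
  (nu : nat -> nat -> monom m) (k : nat) (q_ : 'I_m.+1 -> int).
Hypothesis vr_gt0 : forall l, 0 < vr l.
Hypothesis vr_min : forall l, vr ord0 <= vr l.
Hypothesis hrank : rank_enum vr rho kappa nu.
Hypothesis k_gt0 : (1 <= k)%N.
Hypothesis q_E : forall l, q_ l = Num.floor ((rho k - vr l) / vr ord0).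
Implicit Types (phi : monom m -> R -> 'cV[R]_n) (w : midx n).

Local Notation S := (low_monoms kappa nu k).

(** A negative [q_ l] means that [eps l] alone already has rank above [rho k]; expansion to order 0
    is then enough. *)
Definition taylor_order (l : 'I_m.+1) : nat := if 0 <= q_ l then `|q_ l|%N else 0%N.

Definition term_coef phi (t : R) (l : 'I_m.+1) w : fseries R m :=
  fs_mul (fs_eps R l) (fs_mexp (fs_delta phi t) w).

Lemma fs_ord_delta phi t j : fs_ord vr (vr ord0) (fs_delta phi t j).
Proof.
move=> mu hmu; rewrite /fs_delta; case: eqP => // /mset_neq0_mem[x xmu].
have := mon_rank_ge vr_gt0 xmu; have := vr_min x.1; have := ler0n R x.2; lra.
Qed.

Lemma term_coef_eq0 phi t l w mu :
  mon_rank vr mu < vr l + (msize w)%:R * vr ord0 -> term_coef phi t l w mu = 0.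
Proof.
apply: fs_ord_mul; first exact: fs_ord_eps.
by apply: (fs_ord_mexp vr_gt0) => j; exact: fs_ord_delta.
Qed.

(** Every monomial of delta has rank at least [vr ord0], so those of [eps_l * delta^w] have rank at
    least [vr l + |w| * vr ord0]. Solving for [|w|] gives the floor that defines [q_]. *)
Lemma term_coef_neq0 phi t l w mu : mon_rank vr mu <= rho k ->
  term_coef phi t l w mu != 0 -> vr l <= rho k /\ (msize w)%:Z <= q_ l.
Proof.
move=> hmu h; have hw : vr l + (msize w)%:R * vr ord0 <= rho k.
  rewrite leNgt; apply: contra_neqN h => h; apply: term_coef_eq0.
  exact: le_lt_trans hmu h.
split; first by apply: le_trans hw; rewrite lerDl mulr_ge0// ltW.
by rewrite q_E floor_ge_int -pmulrn ler_pdivlMr// lerBrDl.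
Qed.

Lemma term_coef_mset0 phi t l w : term_coef phi t l w mset0 = 0.
Proof.
by apply: term_coef_eq0; rewrite mon_rank0 ltr_pwDl// mulr_ge0// ltW.
Qed.

Lemma taylor_order_ge l w : (msize w)%:Z <= q_ l -> (msize w <= taylor_order l)%N.
Proof.
move=> h; have q0 : 0 <= q_ l by apply: le_trans h.
by rewrite /taylor_order q0 -lez_nat gez0_abs.
Qed.

(** The right-hand side is the rank of an actual monomial, [eps_l * eps_1 ^ (N + 1)] with [N] the
    Taylor order; it exceeds [rho k], so [rank_gap] applies. *)
Lemma rank_remainder l : rho k.+1 <= vr l + (taylor_order l).+1%:R * vr ord0.
Proof.
pose mu := mon_eps l `+` iter (taylor_order l).+1 (msetD (mon_eps ord0)) mset0 : monom m.
have rmu : mon_rank vr mu = vr l + (taylor_order l).+1%:R * vr ord0.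
  rewrite mon_rankD mon_rank1 addr0; congr (_ + _).
  elim: (taylor_order l).+1 => [|i IH] /=; first by rewrite mon_rank0 mul0r.
  by rewrite mon_rankD mon_rank1 IH -natr1 addr0 mulrDl mul1r addrC.
rewrite -rmu; apply: (rank_gap hrank k_gt0).
  by move=> mu0; move: rmu; rewrite mu0 mon_rank0 => /eqP; rewrite lt_eqF// ltr_pwDl// mulr_ge0// ltW.
rewrite rmu -ltNge -ltrBlDl -ltr_pdivrMr//.
have := floorD1_gt ((rho k - vr l) / vr ord0); rewrite -q_E => /lt_le_trans; apply.
rewrite -natr1 intrD lerD2r (pmulrn 1 (taylor_order l)) ler_int /taylor_order.
by case: (leP 0 (q_ l)) => [q0|/ltW //]; rewrite gez0_abs.
Qed.

Lemma mon_dcoef_neq0 mu' mu : mon_dcoef mu' mu != 0%N ->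
  mu' <> mset0 /\ mon_rank vr mu = mon_rank vr mu' + 1.
Proof.
rewrite mon_dcoefE => h.
have [x xmu e] : exists2 x, x \in mu' & mu = mon_diff mu' x.
  have /hasP[x xmu /eqP e] : has (fun x => mu == mon_diff mu' x) (enum_mset mu').
    apply: contra_neqT h => /hasPn h; rewrite big1_seq// => x /andP[_ xmu].
    by rewrite (negPf (h x xmu)).
  by exists x.
by split; [move=> e0; rewrite e0 in_mset0 in xmu|rewrite e mon_rank_diff].
Qed.

(** Only finitely many terms matter: differentiation raises the rank by one, which keeps [mu'] low,
    and [term_coef_neq0] bounds the size of [w]. *)
Lemma gcoefE D (phi0 : R -> 'cV[R]_n) (fl : 'I_m.+1 -> R -> 'cV[R]_n -> 'cV[R]_n) phi mu t :
  mon_rank vr mu <= rho k ->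
  gcoef D phi0 fl phi mu t = - \sum_(mu' <- S) (mon_dcoef mu' mu)%:R *: phi mu' t +
    \sum_(l < m.+1) \sum_(w <- midx_upto (taylor_order l) (enum 'I_n))
      ((mfact w)%:R^-1 * term_coef phi t l w mu) *: mderiv D w (fl l) t (phi0 t).
Proof.
move=> hmu; rewrite /gcoef; congr (- _ + _).
  rewrite (fsbigE S).
  - rewrite big_seq_cond [RHS]big_seq_cond; apply: eq_bigl => mu'.
    case: (boolP (mu' \in S)) => //= /(mem_low_monoms hrank _ k_gt0)[mu'0 _].
    by rewrite mem_set.
  - exact: uniq_low_monoms hrank.
  - by move=> mu' /(mem_low_monoms hrank _ k_gt0)[].
  move=> mu' mu'0; have [->|/mon_dcoef_neq0[_ e]] := eqVneq (mon_dcoef mu' mu) 0%N.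
    by rewrite scale0r.
  move=> /negP[]; apply/(mem_low_monoms hrank _ k_gt0); split=> //; lra.
apply: eq_bigr => l _; rewrite (fsbigE (midx_upto (taylor_order l) (enum 'I_n))).
- by under eq_bigl do rewrite in_setT.
- exact/uniq_midx_upto/enum_uniq.
- by [].
move=> w _ hw; apply/eqP; apply: contraR hw; rewrite scaler_eq0 negb_or => /andP[+ _].
rewrite mulf_eq0 negb_or => /andP[_ /(term_coef_neq0 hmu)[_ /taylor_order_ge h]].
rewrite mem_midx_upto ?enum_uniq// h; apply/forallP => i.
by rewrite mem_enum.
Qed.

End Coefficients.

(** * Existence of the coefficients *)

Lemma within_continuous_ext (R : realType) (V : normedModType R) (I : set R) (f g : R -> V) :
  (forall t, I t -> f t = g t) -> {within I, continuous f} -> {within I, continuous g}.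
Proof.
move=> fg /within_continuousP h; apply/within_continuousP => t It e e0.
have [d d0 hd] := h t It e e0; exists d => // u Iu ut.
by rewrite -!fg// hd.
Qed.

Lemma Cn_in1 (R : realType) (V : normedModType R) (t0 : R) (f df : R -> V) :
  (forall t, t0 <= t -> has_deriv_in `[t0, +oo[ f t (df t)) ->
  {within `[t0, +oo[, continuous df} -> Cn_in `[t0, +oo[ 1 f.
Proof.
move=> hf cdf; split=> [[|//] t _ /itvcyP tt|[|[|//]] _].
- by exists (df t); exact: hf.
- by apply: has_deriv_in_continuous => t /itvcyP; exact: hf.
by apply: within_continuous_ext cdf => t /itvcyP tt; rewrite /= (deriv_inE tt (hf t tt)).
Qed.

Lemma Cn_in1_deriv (R : realType) (V : normedModType R) (t0 : R) (f df : R -> V) :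
  Cn_in `[t0, +oo[ 1 f -> (forall t, t0 <= t -> has_deriv_in `[t0, +oo[ f t (df t)) ->
  {within `[t0, +oo[, continuous df}.
Proof.
move=> [_ /(_ 1%N isT) h] hf; apply: within_continuous_ext h => t /itvcyP tt /=.
exact: deriv_inE (hf t tt).
Qed.

Section ClassK.
Context {R : realType} {n : nat}.
Variables (t0 : R) (A : 'M[R]_n) (K : set (R -> R)).
Hypothesis hK : classK1 t0 A K.

Lemma class0 : K (fun=> 0).
Proof.
have [f /(@class_scale _ _ _ _ _ hK 0)] := class_nonempty hK.
by under eq_fun do rewrite mul0r.
Qed.

Lemma class_sum (T : Type) (r : seq T) (f : T -> R -> R) :
  (forall i, K (f i)) -> K (fun t => \sum_(i <- r) f i t).
Proof.
move=> h; elim: r => [|x r IH].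
  by under eq_fun do rewrite big_nil; exact: class0.
by under eq_fun do rewrite big_cons; exact: (class_add hK).
Qed.

Lemma class_opp f : K f -> K (fun t => - f t).
Proof. by move=> /(@class_scale _ _ _ _ _ hK (-1)); under eq_fun do rewrite mulN1r. Qed.

Lemma class_sub f g : K f -> K g -> K (fun t => f t - g t).
Proof. by move=> Kf /class_opp; exact: (class_add hK). Qed.

Definition cclass (g : R -> R[i]) : Prop :=
  K (fun t => complex.Re (g t)) /\ K (fun t => complex.Im (g t)).

Lemma cclassD g h : cclass g -> cclass h -> cclass (fun t => g t + h t).
Proof.
move=> [g1 g2] [h1 h2]; split.
  by under eq_fun do rewrite ReD; exact: (class_add hK).
by under eq_fun do rewrite ImD; exact: (class_add hK).
Qed.

Lemma cclassZ c g : cclass g -> cclass (fun t => c * g t).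
Proof.
move=> [g1 g2]; split.
  by under eq_fun do rewrite ReM; apply: class_sub; exact: (class_scale hK).
by under eq_fun do rewrite ImM; apply: (class_add hK); exact: (class_scale hK).
Qed.

Lemma classK1v_bounded (v : R -> 'cV[R]_n) : classK1v K v -> is_bigO v (fun=> 1).
Proof.
move=> Kv; have /choice[M hM] i := class_bounded hK (Kv i).
exists (\sum_i `|M i|), t0; split; first by rewrite sumr_ge0.
move=> t tt; rewrite mulr1; apply/cV_norm_le; first by rewrite sumr_ge0.
move=> i; rewrite (le_trans (hM i t tt))// (le_trans (ler_norm _))//.
by rewrite (bigD1 i)//= lerDl sumr_ge0.
Qed.

Lemma classK1v_continuous (v : R -> 'cV[R]_n) : classK1v K v ->
  {within `[t0, +oo[, continuous v}.
Proof. by move=> Kv; apply/within_continuous_cV => i; exact: class_continuous hK _ (Kv i). Qed.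

Variable lam : 'I_n -> R[i].
Hypothesis charA : char_poly (map_mx (real_complex R) A) = \prod_(j < n) ('X - (lam j)%:P).
Hypothesis n_gt0 : (0 < n)%N.

(** The choice runs over pairs [(j, g)]; outside the range of [j] or the class nothing is claimed,
    and the zero function is a sufficient witness. *)
Lemma class_solver : exists S : nat -> (R -> R[i]) -> (R -> R[i]),
  forall j g, (j < n)%N -> cclass g -> cclass (S j g) /\
    forall t, t0 <= t -> has_cderiv_in `[t0, +oo[ (S j g) t
      ((sorted_spectrum lam)`_j * S j g t + g t).
Proof.
have h (p : nat * (R -> R[i])) : exists y : R -> R[i], (p.1 < n)%N -> cclass p.2 ->
    cclass y /\ forall t, t0 <= t -> has_cderiv_in `[t0, +oo[ y t
      ((sorted_spectrum lam)`_p.1 * y t + p.2 t).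
  have [[jn [Kr Ki]]|H] := pselect ((p.1 < n)%N /\ cclass p.2); last first.
    by exists (fun=> 0) => jn Kp; case: H.
  have [i ei] := sorted_spectrum_codom lam jn.
  have ev : eigenvalue (map_mx (real_complex R) A) (sorted_spectrum lam)`_p.1.
    rewrite eigenvalue_root_char charA ei /root horner_prod (bigD1 i)//=.
    by rewrite hornerXsubC subrr mul0r.
  by have [y [Ky _ _ hy]] := class_solve hK ev Kr Ki; exists y.
have [S hS] := choice h.
by exists (fun j g => S (j, g)) => j g; exact: (hS (j, g)).
Qed.

Lemma class_linear_solution (g : R -> 'cV[R]_n) : classK1v K g ->
  exists phi, classK1v K phi /\
    forall t, t0 <= t -> has_deriv_in `[t0, +oo[ phi t (A *m phi t + g t).
Proof.
move=> Kg; have [S hS] := class_solver.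
have nE : n.-1.+1 = n by rewrite prednK.
(* The bound is a dummy: with all constants 0, only membership in the class is propagated through
   Putzer's formula. *)
pose Kc (_ : R) := cclass.
have S_class j M h : (j <= n.-1)%N -> Kc M h -> Kc (0 * M) (S j h).
  by rewrite -ltnS nE => jn Kh; case: (hS j h jn Kh).
have S_sol j M h : (j <= n.-1)%N -> Kc M h -> forall t, t0 <= t ->
    has_cderiv_in `[t0, +oo[ (S j h) t ((sorted_spectrum lam)`_j * S j h t + h t).
  by rewrite -ltnS nE => jn Kh; case: (hS j h jn Kh).
have KG : Kcv Kc 0 (fun t => cplx_mx (g t)).
  move=> i; split; under eq_fun do rewrite mxE /=; [exact: Kg|exact: class0].
pose z := putzer_sol A (nth 0 (sorted_spectrum lam)) S n.-1 (fun t => cplx_mx (g t)).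
exists (fun t => Re_mx (z t)); split.
  move=> i; under eq_fun do rewrite mxE.
  have [] := putzer_sol_class A (nth 0 (sorted_spectrum lam)) (Kc := Kc) (cst := fun=> 0)
    (fun _ _ g h => @cclassD g h) (fun _ g c => @cclassZ c g) (conj class0 class0) S_class KG i.
  by [].
move=> t tt.
have P0 : putzer_mx A (nth 0 (sorted_spectrum lam)) n.-1.+1 = 0.
  by rewrite nE; exact: putzer_mx_full.
have := cv_deriv_in_Re (putzer_sol_deriv (A := A) S_class S_sol KG tt P0).
rewrite Re_mxD Re_mx_mul; congr (has_deriv_in _ _ _ (_ + _)).
by apply/matrixP => i j; rewrite !mxE.
Qed.

End ClassK.

Section Existence.
Context {R : realType} {n m : nat}.
Variables (t0 a : R) (A : 'M[R]_n) (K : set (R -> R)) (lam : 'I_n -> R[i]).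
Hypothesis hK : classK1 t0 A K.
Hypothesis charA : char_poly (map_mx (real_complex R) A) = \prod_(j < n) ('X - (lam j)%:P).
Hypothesis n_gt0 : (0 < n)%N.
Variables (vr : 'I_m.+1 -> R) (rho : nat -> R) (kappa : nat -> nat)
  (nu : nat -> nat -> monom m) (k : nat) (q_ : 'I_m.+1 -> int).
Hypothesis vr_gt0 : forall l, 0 < vr l.
Hypothesis vr_min : forall l, vr ord0 <= vr l.
Hypothesis hrank : rank_enum vr rho kappa nu.
Hypothesis k_gt0 : (1 <= k)%N.
Hypothesis q_E : forall l, q_ l = Num.floor ((rho k - vr l) / vr ord0).
Variables (phi0 : R -> 'cV[R]_n) (fl : 'I_m.+1 -> R -> 'cV[R]_n -> 'cV[R]_n).
Local Notation D := (tube t0 a phi0).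
Hypothesis fl_class : forall l (w : midx n), vr l <= rho k -> (msize w)%:Z <= q_ l ->
  classK1v K (fun t => mderiv D w (fl l) t (phi0 t)).
Local Notation S := (low_monoms kappa nu k).

(** Differentiation adds 1 to the rank and [eps l] has positive rank, so the value at [mu] sees
    strictly lower ranks only. *)
Lemma gcoef_ext phi phi' mu t : mon_rank vr mu <= rho k ->
  (forall mu', mon_rank vr mu' < mon_rank vr mu -> phi mu' t = phi' mu' t) ->
  gcoef D phi0 fl phi mu t = gcoef D phi0 fl phi' mu t.
Proof.
move=> hmu h; rewrite !(gcoefE vr_gt0 vr_min hrank k_gt0 q_E)//; congr (- _ + _).
  apply: eq_bigr => mu' _; have [->|] := eqVneq (mon_dcoef mu' mu) 0%N; first by rewrite !scale0r.
  by move=> /(mon_dcoef_neq0 vr)[_ e]; rewrite h// e ltrDl.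
apply: eq_bigr => l _; apply: eq_bigr => w _; congr (_ * _ *: _).
apply: fs_eps_mul_ext => // mu' hmu'; apply: (@fs_mexp_ext _ _ _ vr_gt0 _ _ _ _ (mon_rank vr mu)) => // j x hx.
by rewrite /fs_delta h.
Qed.

(* Functions of the form c + h with h in K: the coefficients of the formal
   powers of the series may have constant terms, but K need not contain the
   constants. *)
Definition class_cst (g : R -> R) : Prop := exists c h, K h /\ forall t, g t = c + h t.

Lemma class_cst_cst c : class_cst (fun=> c).
Proof. by exists c, (fun=> 0); split=> [|t]; [exact: class0 hK|rewrite addr0]. Qed.

Lemma class_cst_class g : K g -> class_cst g.
Proof. by move=> Kg; exists 0, g; split=> // t; rewrite add0r. Qed.

Lemma class_cstD f g : class_cst f -> class_cst g -> class_cst (fun t => f t + g t).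
Proof.
move=> [c [h [Kh e]]] [c' [h' [Kh' e']]]; exists (c + c'), (fun t => h t + h' t).
by split=> [|t]; [exact: (class_add hK)|rewrite e e' addrACA].
Qed.

Lemma class_cst_mul f g : class_cst f -> K g -> K (fun t => f t * g t).
Proof.
move=> [c [h [Kh e]]] Kg; under eq_fun do rewrite e mulrDl.
by apply: (class_add hK); [exact: (class_scale hK)|exact: (class_mul hK)].
Qed.

Lemma class_cstM f g : class_cst f -> class_cst g -> class_cst (fun t => f t * g t).
Proof.
move=> hf [c [h [Kh e]]]; under [X in class_cst X]eq_fun do rewrite e mulrDr.
apply: class_cstD; last exact/class_cst_class/class_cst_mul.
have [c' [h' [Kh' e']]] := hf; exists (c * c'), (fun t => c * h' t).
by split=> [|t]; [exact: (class_scale hK)|rewrite e'; ring].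
Qed.

Lemma class_cst_sum (T : eqType) (r : seq T) (f : T -> R -> R) :
  (forall i, i \in r -> class_cst (f i)) -> class_cst (fun t => \sum_(i <- r) f i t).
Proof.
elim: r => [_|x r IH h].
  by under [X in class_cst X]eq_fun do rewrite big_nil; exact: class_cst_cst.
under [X in class_cst X]eq_fun do rewrite big_cons.
apply: class_cstD; first exact: h (mem_head _ _).
by apply: IH => i ir; apply: h; rewrite inE ir orbT.
Qed.

Lemma class_cst_fs_mul (x y : R -> fseries R m) :
  (forall mu, mon_rank vr mu <= rho k -> class_cst (fun t => x t mu)) ->
  (forall mu, mon_rank vr mu <= rho k -> class_cst (fun t => y t mu)) ->
  forall mu, mon_rank vr mu <= rho k -> class_cst (fun t => fs_mul (x t) (y t) mu).
Proof.
move=> hx hy mu hmu.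
have hS mu' : mon_rank vr mu' <= rho k -> mu' \in mset0 :: S.
  by move=> /(mem_low0 vr_gt0 hrank k_gt0).
under [X in class_cst X]eq_fun do
  rewrite (fs_mul_low vr_gt0 _ _ (uniq_low0 hrank k_gt0) hS hmu).
apply: class_cst_sum => u /(mem_low0 vr_gt0 hrank k_gt0) uS.
apply: class_cst_sum => v /(mem_low0 vr_gt0 hrank k_gt0) vS.
apply: class_cstM; first exact: class_cst_cst.
by apply: class_cstM; [exact: hx|exact: hy].
Qed.

Lemma class_cst_fs_mexp (x : 'I_n -> R -> fseries R m) (w : midx n) :
  (forall j mu, mon_rank vr mu <= rho k -> class_cst (fun t => x j t mu)) ->
  forall mu, mon_rank vr mu <= rho k ->
    class_cst (fun t => fs_mexp (fun j => x j t) w mu).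
Proof.
move=> h; rewrite /fs_mexp; elim: (index_enum _) => [|j r IH] mu hmu.
  by under [X in class_cst X]eq_fun do rewrite big_nil; exact: class_cst_cst.
under [X in class_cst X]eq_fun do rewrite big_cons.
apply: class_cst_fs_mul hmu => //; elim: (w j) => [|i IHi] mu' hmu'.
  exact: class_cst_cst.
by apply: class_cst_fs_mul hmu' => // mu2; exact: h.
Qed.

(** In the terms with [fl], a [class_cst] function multiplies a derivative along [phi0] that lies in
    [K], and the product lands in [K]. For indices outside the assumed range the scalar factor is
    zero. *)
Lemma gcoef_class phi mu : (forall mu', classK1v K (phi mu')) -> mon_rank vr mu <= rho k ->
  classK1v K (gcoef D phi0 fl phi mu).
Proof.
move=> Kphi hmu i.
under eq_fun do rewrite (gcoefE vr_gt0 vr_min hrank k_gt0 q_E)// !mxE !summxE.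
apply: (class_add hK).
  apply/(class_opp hK)/(class_sum hK) => mu'; under eq_fun do rewrite mxE.
  exact/(class_scale hK)/Kphi.
apply: (class_sum hK) => l; under eq_fun do rewrite summxE.
apply: (class_sum hK) => w; under eq_fun do rewrite mxE.
have [[hl hw]|H] := pselect (vr l <= rho k /\ (msize w)%:Z <= q_ l); last first.
  have z t : term_coef phi t l w mu = 0.
    apply/eqP; apply: contra_notT H.
    exact: (term_coef_neq0 vr_gt0 vr_min q_E hmu).
  by under eq_fun do rewrite z mulr0 mul0r; exact: class0 hK.
apply: class_cst_mul; last exact: fl_class.
apply: class_cstM; first exact: class_cst_cst.
apply: class_cst_fs_mul hmu => [mu' _|]; first exact: class_cst_cst.
apply: class_cst_fs_mexp => j mu' _; rewrite /fs_delta.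
by case: eqP => _; [exact: class_cst_cst|exact/class_cst_class/Kphi].
Qed.

(** Induction over rank levels. All of [phi] is kept in [K], also where no equation is required yet,
    so that [gcoef_class] applies; level [s.+1] is then overwritten, which by [gcoef_ext] leaves
    [gcoef] unchanged up to that level. *)
Lemma coefs_exist_upto s : (s <= k)%N -> exists phi : monom m -> R -> 'cV[R]_n,
  (forall mu, classK1v K (phi mu)) /\
  forall s' mu, (1 <= s' <= s)%N -> mon_rank vr mu = rho s' -> forall t, t0 <= t ->
    has_deriv_in `[t0, +oo[ (phi mu) t (A *m phi mu t + gcoef D phi0 fl phi mu t).
Proof.
elim: s => [_|s IH sk].
  exists (fun _ _ => 0); split=> [mu i|[|s'] mu //].
  by under eq_fun do rewrite mxE; exact: class0 hK.
have [phi [Kphi hphi]] := IH (ltnW sk).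
have rs s' : (1 <= s' <= s.+1)%N -> rho s' <= rho k.
  by move=> /andP[s1 ss]; apply: (rho_mono hrank) => //; exact: leq_trans sk.
have /choice[psi hpsi] mu : exists y, classK1v K y /\ (mon_rank vr mu = rho s.+1 ->
    forall t, t0 <= t -> has_deriv_in `[t0, +oo[ y t (A *m y t + gcoef D phi0 fl phi mu t)).
  have [e|e] := pselect (mon_rank vr mu = rho s.+1); last by exists (phi mu); split.
  have Kg : classK1v K (gcoef D phi0 fl phi mu) by apply: gcoef_class => //; rewrite e rs//=.
  by have [y [Ky hy]] := class_linear_solution hK charA n_gt0 Kg; exists y.
pose phi' mu := if mon_rank vr mu == rho s.+1 then psi mu else phi mu.
have e' mu t : mon_rank vr mu <= rho s.+1 ->
    gcoef D phi0 fl phi' mu t = gcoef D phi0 fl phi mu t.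
  move=> hmu; apply: gcoef_ext; first by apply: le_trans hmu _; rewrite rs/=.
  by move=> mu' hmu'; rewrite /phi' lt_eqF// (lt_le_trans hmu').
exists phi'; split=> [mu|s' mu hs' hmu t tt].
  by rewrite /phi'; case: ifP => _; [case: (hpsi mu)|exact: Kphi].
have hle : mon_rank vr mu <= rho s.+1.
  by rewrite hmu; move: hs' => /andP[s1 ss]; exact: (rho_mono hrank).
rewrite e'// /phi'; case: ifPn => [/eqP e|ne]; first by case: (hpsi mu) => _; exact.
have ss' : s' != s.+1 by apply: contraNneq ne => <-; rewrite hmu.
apply: hphi hmu _ tt; move: hs' => /andP[-> /=].
by rewrite leq_eqVlt (negPf ss').
Qed.

Lemma coefs_exist : exists phi, is_coefs t0 a A K phi0 fl kappa nu k phi.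
Proof.
have [phi [Kphi hphi]] := coefs_exist_upto (leqnn k).
exists phi => s p sk pk; have [_ e] := nu_rank hrank (andP sk).1 pk.
have h := hphi _ _ sk e; split=> //; apply: Cn_in1 h _.
apply: classK1v_continuous hK _ _ => i; under eq_fun do rewrite mxE.
apply: (class_add hK).
  by under eq_fun do rewrite mxE; apply: (class_sum hK) => j; exact/(class_scale hK)/Kphi.
apply: gcoef_class => //; rewrite e; apply: (rho_mono hrank) => //; by case/andP: sk.
Qed.

End Existence.

(** * The residual of the partial sum *)

Lemma within_continuousZ (R : realType) (n : nat) (J : set R) (e : R -> R) (y : R -> 'cV[R]_n) :
  {within J, continuous e} -> {within J, continuous y} ->
  {within J, continuous (fun t => e t *: y t)}.
Proof.
move=> /subspace_continuousP he /subspace_continuousP hy.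
by apply/subspace_continuousP => t Jt; apply: cvgZ; [exact: he|exact: hy].
Qed.

Lemma within_continuous_sum (R : realType) (V : normedModType R) (T : eqType) (J : set R)
    (r : seq T) (y : T -> R -> V) :
  (forall i, i \in r -> {within J, continuous (y i)}) ->
  {within J, continuous (fun t => \sum_(i <- r) y i t)}.
Proof.
elim: r => [_|i r IH hy].
  rewrite (_ : (fun t => _) = fun=> 0); last by apply/funext => t; rewrite big_nil.
  exact/continuous_subspaceT/cst_continuous.
rewrite (_ : (fun t => _) = fun t => y i t + \sum_(j <- r) y j t).
  apply: within_continuousD; first exact: hy (mem_head _ _).
  by apply: IH => j jr; apply: hy; rewrite inE jr orbT.
by apply/funext => t; rewrite big_cons.
Qed.

Lemma within_continuous_mulmx (R : realType) (n : nat) (A : 'M[R]_n) (J : set R)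
    (y : R -> 'cV[R]_n) :
  {within J, continuous y} -> {within J, continuous (fun t => A *m y t)}.
Proof.
move=> /within_continuous_cV hy; apply/within_continuous_cV => i.
rewrite (_ : (fun t => _) = fun t => \sum_j A i j * y t j 0).
  by apply: within_continuous_sum => j _; exact: within_continuous_scale.
by apply/funext => t; rewrite mxE.
Qed.

Lemma C0q_le (R : realType) (n : nat) (D : set (R * 'cV[R]_n)) (q q' : nat) g :
  (q <= q')%N -> C0q D q' g -> C0q D q g.
Proof.
move=> qq [h1 h2]; split=> [js j t y sz|js sz]; last exact/h2/(leq_trans sz).
by apply: h1; exact: leq_trans sz qq.
Qed.

Lemma mderiv_uniform_bound (R : realType) (n : nat) (D : set (R * 'cV[R]_n)) (q : nat) g :
  (forall w : midx n, msize w = q ->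
     exists M : R, forall t y, D (t, y) -> `|mderiv D w g t y| <= M) ->
  exists2 M, 0 <= M & forall w : midx n, msize w = q -> forall t y, D (t, y) ->
    `|mderiv D w g t y| <= M.
Proof.
move=> h; pose L := midx_upto q (enum 'I_n).
have /choice[M hM] (w : midx n) : exists M : R, msize w = q -> forall t y, D (t, y) ->
    `|mderiv D w g t y| <= M.
  have [wq|wq] := pselect (msize w = q); last by exists 0.
  by have [M hM] := h w wq; exists M.
exists (\sum_(w <- L) `|M w|) => [|w wq t y Dy]; first exact: sumr_ge0.
apply: (le_trans (hM w wq t y Dy)).
have wL : w \in L.
  rewrite mem_midx_upto ?enum_uniq// wq leqnn; apply/forallP => i.
  by rewrite mem_enum.
rewrite (big_rem _ wL) /= (le_trans (ler_norm _))// lerDl; exact: sumr_ge0.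
Qed.

Section Residual.
Context {R : realType} {n m : nat}.
Variables (t0 a : R) (A : 'M[R]_n) (K : set (R -> R)).
Hypothesis hK : classK1 t0 A K.
Variables (f phi0 : R -> 'cV[R]_n) (eps : 'I_m.+1 -> R -> R)
  (fl : 'I_m.+1 -> R -> 'cV[R]_n -> 'cV[R]_n).
Hypothesis f_class : classK1v K f.
Hypothesis phi0_class : classK1v K phi0.
Hypothesis phi0_deriv : forall t, t0 <= t ->
  has_deriv_in `[t0, +oo[ phi0 t (A *m phi0 t + f t).
Hypothesis a_gt0 : 0 < a.
Variables (vr : 'I_m.+1 -> R) (rho : nat -> R) (kappa : nat -> nat)
  (nu : nat -> nat -> monom m) (k : nat) (p_ : 'I_m.+1 -> nat) (q_ : 'I_m.+1 -> int)
  (Q_ : 'I_m.+1 -> nat).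
Hypothesis vr_gt0 : forall l, 0 < vr l.
Hypothesis vr_min : forall l, vr ord0 <= vr l.
Hypothesis hrank : rank_enum vr rho kappa nu.
Hypothesis k_gt0 : (1 <= k)%N.
Hypothesis p_E : forall l, (p_ l)%:Z = Num.max 0 (Num.floor (rho k - vr l) + 1).
Hypothesis q_E : forall l, q_ l = Num.floor ((rho k - vr l) / vr ord0).
Hypothesis Q_E : forall l, (Q_ l)%:Z = Num.max 2 (q_ l + 1).
Hypothesis eps_C : forall l, Cn_in `[t0, +oo[ (p_ l) (eps l).
Hypothesis eps_bigO : forall l r, (r <= p_ l)%N ->
  is_bigO (derivn_in `[t0, +oo[ r (eps l)) (epow vr eps (vr l + r%:R)).
Hypothesis eps_gt0 : forall t, t0 <= t -> 0 < eps ord0 t.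
Hypothesis eps_small : forall d : R, 0 < d -> exists T, forall t, T <= t -> eps ord0 t <= d.

Local Notation I := (`[t0, +oo[%classic).
Local Notation D := (tube t0 a phi0).
Hypothesis fl_C : forall l, C0q D (Q_ l) (fl l).
Hypothesis fl_bounded : forall l (w : midx n), (msize w <= Q_ l)%N ->
  exists M : R, forall t y, D (t, y) -> `|mderiv D w (fl l) t y| <= M.
Variable phi : monom m -> R -> 'cV[R]_n.
Hypothesis phi_coefs : is_coefs t0 a A K phi0 fl kappa nu k phi.

Local Notation S := (low_monoms kappa nu k).
Local Notation W := (epow vr eps (rho k.+1)).
Local Notation ev := (mon_eval I eps).
Local Notation s_ := (partial_sum t0 phi0 eps kappa nu k phi).
Local Notation N := (taylor_order q_).

Lemma low_monomsP mu : mu \in S ->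
  exists s p, [/\ (1 <= s <= k)%N, (p < kappa s)%N & mu = nu s p].
Proof.
move=> /allpairsPdep[s [p [+ + ->]]]; rewrite !mem_iota add1n ltnS /= => sk pk.
by exists s, p.
Qed.

Lemma phi_class mu : mu \in S -> classK1v K (phi mu).
Proof. by move=> /low_monomsP[s [p [sk pk ->]]]; case: (phi_coefs sk pk). Qed.

Lemma phi_deriv mu t : mu \in S -> t0 <= t ->
  has_deriv_in I (phi mu) t (A *m phi mu t + gcoef D phi0 fl phi mu t).
Proof. by move=> /low_monomsP[s [p [sk pk ->]]]; case: (phi_coefs sk pk) => _ _; exact. Qed.

Lemma phi_deriv_continuous mu : mu \in S ->
  {within I, continuous (fun t => A *m phi mu t + gcoef D phi0 fl phi mu t)}.
Proof.
move=> muS; apply: Cn_in1_deriv (fun t => phi_deriv muS (t := t)).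
by case: (low_monomsP muS) => s [p [sk pk ->]]; case: (phi_coefs sk pk).
Qed.

Lemma low_rank mu : mu \in S -> mon_rank vr mu <= rho k.
Proof. by case/(mem_low_monoms hrank _ k_gt0). Qed.

Definition delta (t : R) : 'cV[R]_n := \sum_(mu <- S) ev mu t *: phi mu t.

Lemma partial_sumE t : s_ t = phi0 t + delta t.
Proof. by rewrite /partial_sum (sum_low_monoms _ _ _ (fun mu => ev mu t *: phi mu t)). Qed.

Lemma phi_bounded mu : mu \in S -> is_bigO (phi mu) (fun=> 1).
Proof. by move/phi_class; exact: classK1v_bounded hK _. Qed.

Lemma low_rank_ge mu : mu \in S -> vr ord0 <= mon_rank vr mu.
Proof.
move=> /(mem_low_monoms hrank _ k_gt0)[/mset_neq0_mem[x xmu] _].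
by have := mon_rank_ge vr_gt0 xmu; have := vr_min x.1; have := ler0n R x.2; lra.
Qed.

Lemma low_ev_bigO mu : mu \in S -> is_bigO (ev mu) (epow vr eps (mon_rank vr mu)).
Proof.
move=> /low_rank hmu.
exact: (mon_bigO eps_gt0 eps_bigO) (low_mon_ok vr_gt0 p_E hmu).
Qed.

Lemma delta_bigO : is_bigO delta (epow vr eps (vr ord0)).
Proof.
apply: is_bigO_sum => mu muS; apply: is_bigO_scale_bounded; last exact: phi_bounded.
apply: (is_bigO_epow vr_gt0 eps_gt0 eps_small (low_rank_ge muS)).
exact: low_ev_bigO.
Qed.

Lemma delta_small (d : R) : 0 < d -> exists T, forall t, T <= t -> `|delta t| <= d.
Proof.
move=> d0; have [C [T [C0 hC]]] := delta_bigO.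
have [T' hT'] := eps_small (divr_gt0 d0 (ltr_wpDl C0 ltr01)).
exists (Num.max t0 (Num.max T T')) => t; rewrite !ge_max => /and3P[tt Tt T't].
apply: le_trans (hC t Tt) _.
rewrite /epow divff ?gt_eqF// powRr1; last by rewrite ltW// eps_gt0.
apply: le_trans (_ : (C + 1) * eps ord0 t <= d).
  by rewrite ler_wpM2r ?lerDl// ltW// eps_gt0.
by rewrite mulrC -ler_pdivlMr ?hT'// ltr_wpDl.
Qed.

Lemma tracks_delta j : tracks t0 vr rho kappa nu k eps (fun t => delta t j 0)
  (fun t => fs_delta phi t j).
Proof.
split=> [mu|].
  rewrite inE /fs_delta; case: eqP => [_ _|_ /= muS]; first exact: is_bigO_cst.
  have [C [T [C0 hC]]] := phi_bounded muS; exists C, T; split=> // t Tt.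
  exact: le_trans (cV_coord_le _ _) (hC t Tt).
apply: (is_bigO_ext (T := 0) (f := fun=> 0)); last exact: is_bigO0.
move=> t _; rewrite big_cons {1}/fs_delta eqxx mul0r add0r /delta summxE.
rewrite -sumrB big1_seq// => mu /andP[_ muS]; rewrite !mxE /fs_delta.
have /(mem_low_monoms hrank _ k_gt0)[/eqP/negPf -> _] := muS.
by rewrite mulrC subrr.
Qed.

Definition ev_deriv (mu : monom m) (t : R) : R := \sum_(x <- enum_mset mu) ev (mon_diff mu x) t.

Lemma eps_deriv x t : (x.2 < p_ x.1)%N -> t0 <= t ->
  has_deriv_in I (derivn_in I x.2 (eps x.1)) t (derivn_in I x.2.+1 (eps x.1) t).
Proof.
move=> xp tt; have [/(_ _ _ xp) h _] := eps_C x.1.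
have [|l hl] := h t; first exact/itvcyP.
by rewrite [derivn_in _ _.+1 _ _]/= (deriv_inE tt hl).
Qed.

Lemma ev_has_deriv mu t : mu \in S -> t0 <= t -> has_deriv_in I (ev mu) t (ev_deriv mu t).
Proof.
move=> /low_rank hmu tt; apply: mon_eval_deriv; first exact/itvcyP.
by move=> x xmu; apply: eps_deriv => //; exact: (p_gt vr_gt0 p_E xmu).
Qed.

(** The derivative of the partial sum with the equations of the coefficients inserted, so that its
    continuity is visible and the terms of [rhs] can be cancelled against it. *)
Definition sum_deriv (t : R) : 'cV[R]_n :=
  A *m phi0 t + f t + \sum_(mu <- S) (ev_deriv mu t *: phi mu t +
    ev mu t *: (A *m phi mu t + gcoef D phi0 fl phi mu t)).

Lemma sum_has_deriv t : t0 <= t -> has_deriv_in I s_ t (sum_deriv t).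
Proof.
move=> tt; rewrite (_ : s_ = fun u => phi0 u + delta u); last exact/funext/partial_sumE.
apply: has_deriv_inD; first exact: phi0_deriv.
rewrite big_seq_cond /delta.
under [X in has_deriv_in _ X]eq_fun do rewrite big_seq_cond.
apply: has_deriv_in_sum => mu /andP[muS _]; apply: has_deriv_in_cVZ.
- exact/itvcyP.
- exact: ev_has_deriv.
- exact: phi_deriv.
Qed.

(** [mon_dcoef] collects, for each low [mu], the derivatives of low monomials that equal [mu]; these
    cancel. What is left are derivatives whose rank exceeds [rho k], and [mon_ok_diff] keeps them
    within the assumed regularity. *)
Lemma diff_terms_bigO :
  is_bigO (fun t => \sum_(mu <- S) ev mu t *: (\sum_(mu' <- S) (mon_dcoef mu' mu)%:R *: phi mu' t)
    - \sum_(mu <- S) ev_deriv mu t *: phi mu t) W.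
Proof.
apply: (is_bigO_ext (T := 0) (f := fun t => - \sum_(mu' <- S) \sum_(x <- enum_mset mu')
   ((mon_diff mu' x \notin S)%:R * ev (mon_diff mu' x) t) *: phi mu' t)).
  move=> t _; set Z := \sum_(mu' <- S) _; set Y := \sum_(mu <- S) ev_deriv mu t *: _.
  rewrite [X in _ = X - Y](_ : _ = Y - Z); first by rewrite addrAC subrr add0r.
  under eq_bigr do rewrite scaler_sumr.
  rewrite exchange_big /Y /Z -sumrB /=; apply: eq_bigr => mu' _.
  under eq_bigr do rewrite scalerA; rewrite -!scaler_suml -scalerBl.
  congr (_ *: _); rewrite /ev_deriv -sumrB.
  under eq_bigr do rewrite mon_dcoefE natr_sum mulr_sumr.
  rewrite exchange_big /=; apply: eq_bigr => x _.
  have [xS|xS] := boolP (mon_diff mu' x \in S).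
    rewrite (bigD1_seq _ xS (uniq_low_monoms k hrank)) /= eqxx big1 ?mul0r ?addr0 ?subr0 ?mulr1//.
    by move=> mu /negPf ->; rewrite mulr0.
  rewrite mul1r subrr big1_seq// => mu /andP[_ muS]; case: eqP => [e|_]; last by rewrite mulr0.
  by rewrite -e muS in xS.
apply: is_bigO_opp; apply: is_bigO_sum => mu' muS; apply: is_bigO_sum => x xmu.
have [xS|xS] := boolP (mon_diff mu' x \in S).
  by under eq_fun do rewrite mul0r scale0r; exact: is_bigO0.
under eq_fun do rewrite mul1r.
apply: is_bigO_scale_bounded; last exact: phi_bounded.
apply: (high_bigO vr_gt0 hrank k_gt0 eps_gt0 eps_small eps_bigO).
  exact: (mon_ok_diff vr_gt0 p_E (low_rank muS)).
rewrite inE negb_or xS andbT; exact/eqP/mon_diff_neq0.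
Qed.

Lemma taylor_order_lt l : ((N l).+1 <= Q_ l)%N.
Proof.
rewrite -lez_nat Q_E /taylor_order le_max; case: (leP 0 (q_ l)) => q0 //.
by rewrite -addn1 PoszD gez0_abs// lexx orbT.
Qed.

Lemma phi0_tube t : t0 <= t -> D (t, phi0 t).
Proof. by move=> tt; split=> //=; rewrite subrr normr0 ltW. Qed.

(** Two errors: the Taylor remainder, of size [eps_l * |delta|^(N+1)], and the truncation of the
    formal series of [eps_l * delta^w], handled by [tracks]. The coefficient at [mset0] is zero, so
    the sums over [S] and over [mset0 :: S] agree. *)
Lemma taylor_terms_bigO l :
  is_bigO (fun t => eps l t *: fl l t (s_ t) -
    \sum_(mu <- S) ev mu t *: \sum_(w <- midx_upto (N l) (enum 'I_n))
      ((mfact w)%:R^-1 * term_coef phi t l w mu) *: mderiv D w (fl l) t (phi0 t)) W.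
Proof.
pose F w t := mderiv D w (fl l) t (phi0 t).
apply: (is_bigO_ext (T := 0) (f := fun t =>
  eps l t *: (fl l t (phi0 t + delta t) -
    \sum_(w <- midx_upto (N l) (enum 'I_n)) mterm (delta t) w *: F w t) +
  \sum_(w <- midx_upto (N l) (enum 'I_n)) ((mfact w)%:R^-1 *
    (eps l t * \prod_j delta t j 0 ^+ w j - \sum_(mu <- mset0 :: S) term_coef phi t l w mu * ev mu t))
      *: F w t)).
  move=> t _; rewrite partial_sumE scalerBr -addrA; congr (_ + _).
  under [X in _ = - X]eq_bigr do rewrite scaler_sumr.
  rewrite [X in _ = - X]exchange_big /= scaler_sumr -!sumrN -big_split /=; apply: eq_bigr => w _.
  rewrite big_cons (term_coef_mset0 vr_gt0 vr_min) mul0r add0r mtermE.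
  under [X in _ = - X]eq_bigr do rewrite scalerA.
  rewrite -scaler_suml scalerA -!scaleNr -scalerDl; congr (_ *: _).
  rewrite [in RHS](_ : \sum_(i <- S) _ = (mfact w)%:R^-1 *
      \sum_(mu <- S) term_coef phi t l w mu * ev mu t).
    by rewrite /GRing.scale /=; ring.
  by rewrite mulr_sumr; apply: eq_bigr => mu _; ring.
apply: is_bigO_add; last first.
  apply: is_bigO_sum => w wN; apply: is_bigO_scale_bounded.
    apply: is_bigO_M; first exact: is_bigO_cst.
    have h : tracks t0 vr rho kappa nu k eps (fun t => eps l t * \prod_j delta t j 0 ^+ w j)
        (fun t => term_coef phi t l w).
      apply: (tracks_mul vr_gt0 hrank k_gt0 p_E eps_gt0 eps_small eps_bigO).
        exact: (tracks_eps vr_gt0 hrank k_gt0 eps_gt0 eps_small eps_bigO).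
      apply: (tracks_mexp vr_gt0 hrank k_gt0 p_E eps_gt0 eps_small eps_bigO) => j.
      exact: tracks_delta.
    by case: h.
  have wQ : (msize w <= Q_ l)%N.
    move: wN; rewrite mem_midx_upto ?enum_uniq// => /andP[wN _].
    by apply: leq_trans wN (ltnW (taylor_order_lt l)).
  have [M hM] := fl_bounded wQ; exists `|M|, t0; split=> // t tt.
  by rewrite mulr1 (le_trans (hM _ _ (phi0_tube tt)))// ler_norm.
have [|M M0 hM] := @mderiv_uniform_bound R n D (N l).+1 (fl l).
  by move=> w wN; apply: fl_bounded; rewrite wN taylor_order_lt.
(* The bound is proved with the exponent [vr l + (N + 1) * vr ord0], which is at least
   [rho k.+1]. *)
apply: (is_bigO_epow vr_gt0 eps_gt0 eps_small (rank_remainder vr_gt0 hrank k_gt0 q_E l)).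
apply: (is_bigO_epowM eps_gt0).
  have := eps_bigO (leq0n (p_ l)); rewrite addr0; exact.
have [C [T [C0 hC]]] := delta_bigO; have [T' hT'] := delta_small a_gt0.
pose c : R := (\sum_(L <- [seq drop i (enum 'I_n) | i <- iota 1 n]) size (midx_upto (N l) L))%:R * M.
have c0 : 0 <= c by rewrite mulr_ge0.
exists (c * C ^+ (N l).+1), (Num.max t0 (Num.max T T')); split.
  by rewrite mulr_ge0// exprn_ge0.
move=> t; rewrite !ge_max => /and3P[tt Tt T't].
have Ds : D (t, phi0 t + delta t).
  by split=> //=; rewrite addrC addKr hT'.
have := taylor_tube (ltW a_gt0) M0 (C0q_le (taylor_order_lt l) (fl_C l))
  (fun w wN z => hM w wN t z) (phi0_tube tt) Ds.
move=> hT; suff h : `|delta t| ^+ (N l).+1 <=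
    C ^+ (N l).+1 * epow vr eps ((N l).+1%:R * vr ord0) t.
  by apply: (le_trans hT); rewrite -(mulrA c); exact: (ler_wpM2l c0 h).
have -> : epow vr eps ((N l).+1%:R * vr ord0) t = epow vr eps (vr ord0) t ^+ (N l).+1.
  rewrite /epow mulfK ?gt_eqF// divff ?gt_eqF// powRr1; last by rewrite ltW// eps_gt0.
  by rewrite powR_mulrn// ltW// eps_gt0.
rewrite -exprMn lerXn2r ?nnegrE//; last exact: hC.
by rewrite mulr_ge0// epow_ge0.
Qed.

(** The terms [A phi0], [f] and [A delta] cancel, and inserting [gcoefE] pairs what remains into the
    differences already bounded. *)
Lemma residual_bigO : is_bigO (fun t => rhs A f eps fl t (s_ t) - sum_deriv t) W.
Proof.
apply: (is_bigO_ext (T := t0)) (is_bigO_add diff_terms_bigO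
  (is_bigO_sum (r := index_enum 'I_m.+1) (fun l _ => taylor_terms_bigO l))) => t tt.
have e1 : A *m delta t = \sum_(mu <- S) ev mu t *: (A *m phi mu t).
  by rewrite /delta mulmx_sumr; apply: eq_bigr => mu _; rewrite -scalemxAr.
have e2 : \sum_(mu <- S) ev mu t *: gcoef D phi0 fl phi mu t =
    - \sum_(mu <- S) ev mu t *: (\sum_(mu' <- S) (mon_dcoef mu' mu)%:R *: phi mu' t) +
    \sum_l \sum_(mu <- S) ev mu t *: \sum_(w <- midx_upto (N l) (enum 'I_n))
      ((mfact w)%:R^-1 * term_coef phi t l w mu) *: mderiv D w (fl l) t (phi0 t).
  rewrite exchange_big /= -sumrN -big_split /= big_seq [RHS]big_seq.
  apply: eq_bigr => mu muS; rewrite (gcoefE vr_gt0 vr_min hrank k_gt0 q_E) ?low_rank//.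
  by rewrite scalerDr scalerN; congr (_ + _); exact: scaler_sumr.
rewrite /rhs /sum_deriv; under [X in _ = _ - (_ + X)]eq_bigr do rewrite scalerDr.
rewrite !big_split /= -e1 e2 [in A *m _]partial_sumE mulmxDr sumrN.
set X1 := \sum_(mu <- S) _; set X2 := \sum_(mu <- S) _; set X3 := \sum_l _; set X4 := \sum_l _.
move: (A *m phi0 t) (A *m delta t) (f t) X1 X2 X3 X4 => Y1 Y2 Y3 X1 X2 X3 X4.
by apply/matrixP => i j; rewrite !mxE; ring.
Qed.

Lemma ev_continuous mu : mon_ok p_ mu -> {within I, continuous (ev mu)}.
Proof.
elim/(@mset_ind m): mu => [_|x mu IH h].
  rewrite (_ : ev _ = fun=> 1); last by apply/funext => t; rewrite mon_eval0.
  exact/continuous_subspaceT/cst_continuous.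
rewrite (_ : ev _ = fun t => derivn_in I x.2 (eps x.1) t * ev mu t); last first.
  by apply/funext => t; rewrite mon_evalD mon_eval1.
have [_ /(_ _ (h x (mset1D1 _ _))) /subspace_continuousP hx] := eps_C x.1.
have /subspace_continuousP hmu := IH (fun y ymu => h y (mset1Dr _ ymu)).
by apply/subspace_continuousP => t It; apply: cvgM; [exact: hx|exact: hmu].
Qed.

Lemma sum_deriv_continuous : {within I, continuous sum_deriv}.
Proof.
apply: within_continuousD.
  apply: within_continuousD; last exact: classK1v_continuous hK _ f_class.
  exact/within_continuous_mulmx/(classK1v_continuous hK phi0_class).
apply: within_continuous_sum => mu muS; apply: within_continuousD.
  apply: within_continuousZ; last exact: classK1v_continuous hK _ (phi_class muS).
  apply: within_continuous_sum => x xmu; apply: ev_continuous.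
  exact: (mon_ok_diff vr_gt0 p_E (low_rank muS)).
apply: within_continuousZ; last exact: phi_deriv_continuous.
exact/ev_continuous/(low_mon_ok vr_gt0 p_E)/low_rank.
Qed.

Lemma epow_small x : 0 < x -> forall d : R, 0 < d ->
  exists T, forall t, T <= t -> epow vr eps x t <= d.
Proof.
move=> x0 d d0; have [T hT] := eps_small (powR_gt0 (vr ord0 / x) d0).
exists (Num.max t0 T) => t; rewrite ge_max => /andP[tt Tt]; rewrite /epow.
have xv : 0 < x / vr ord0 by rewrite divr_gt0.
apply: le_trans (ge0_ler_powR (ltW xv) _ _ (hT t Tt)) _; rewrite ?nnegrE ?powR_ge0//.
  by rewrite ltW// eps_gt0.
by rewrite -powRrM mulrA divfK ?gt_eqF// divff ?gt_eqF// powRr1// ltW.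
Qed.

Lemma eps_vanish l (d : R) : 0 < d -> exists T, forall t, T <= t -> `|eps l t| <= d.
Proof.
move=> d0; have [C [T [C0 hC]]] := eps_bigO (leq0n (p_ l)).
have [T' hT'] := epow_small (vr_gt0 l) (divr_gt0 d0 (ltr_wpDl C0 ltr01)).
exists (Num.max T T') => t; rewrite ge_max => /andP[Tt T't].
apply: le_trans (hC t Tt) _; rewrite addr0.
apply: le_trans (_ : (C + 1) * epow vr eps (vr l) t <= d).
  by rewrite ler_wpM2r ?lerDl// epow_ge0.
by rewrite mulrC -ler_pdivlMr ?hT'// ltr_wpDl.
Qed.

(** Every symbol has rank at least [vr ord0], hence so has [rho k]; so the first derivative of
    [eps ord0] is available, and with it that of the weight. *)
Lemma p0_gt0 : (0 < p_ ord0)%N.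
Proof.
have [mu [/mset_neq0_mem[x xmu] e]] := (rhoP hrank (rho k)).2 (ex_intro _ k (conj k_gt0 erefl)).
have h : vr ord0 <= rho k.
  by have := mon_rank_ge vr_gt0 xmu; have := vr_min x.1; have := ler0n R x.2; lra.
rewrite -ltz_nat p_E lt_max; apply/orP; right.
by rewrite ltr_wpDl// floor_ge0 subr_ge0.
Qed.

Definition epow_deriv (x t : R) : R :=
  x / vr ord0 * eps ord0 t `^ (x / vr ord0 - 1) * derivn_in I 1 (eps ord0) t.

(** The point is interior because the chain rule through the power takes a two-sided derivative. *)
Lemma epow_has_deriv x t : t0 < t -> has_deriv_in I (epow vr eps x) t (epow_deriv x t).
Proof.
move=> tt; have d0 : has_deriv_in I (eps ord0) t (derivn_in I 1 (eps ord0) t).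
  exact: (@eps_deriv (ord0, 0%N) _ p0_gt0 (ltW tt)).
apply: has_deriv_in_is_derive.
apply: (is_derive1_comp (f := (@powR R)^~ (x / vr ord0))).
  exact/is_derive1_powR/eps_gt0/ltW.
exact: is_derive_has_deriv_in (nbhs_itvcy tt) d0.
Qed.

(** The derivative of [eps_1] carries one more unit of rank than [eps_1], so the ratio of
    [epow_deriv] to [epow] is [O(eps_1 ^ (1 / vr ord0))] and tends to 0. This is the slowness of the
    weight that the linear solver requires. *)
Lemma epow_deriv_small x (d : R) : 0 < d ->
  exists T, forall t, T <= t -> `|epow_deriv x t| <= d * epow vr eps x t.
Proof.
move=> d0; have [C [T [C0 hC]]] := eps_bigO p0_gt0.
pose c := `|x / vr ord0| * C; have c0 : 0 <= c by rewrite mulr_ge0.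
have [T' hT'] := epow_small ltr01 (divr_gt0 d0 (ltr_wpDl c0 ltr01)).
exists (Num.max t0 (Num.max T T')) => t; rewrite !ge_max => /and3P[tt Tt T't].
have e0 := eps_gt0 tt.
rewrite /epow_deriv normrM normrM (ger0_norm (powR_ge0 _ _)).
apply: le_trans (ler_wpM2l _ (hC t Tt)) _; first by rewrite mulr_ge0// powR_ge0.
have E : eps ord0 t `^ (x / vr ord0 - 1) * epow vr eps (vr ord0 + 1%:R) t =
    epow vr eps x t * epow vr eps 1 t.
  rewrite /epow -!powRD ?(gt_eqF e0) ?implybT//; congr (_ `^ _).
  by field; rewrite gt_eqF.
rewrite mulrACA -/c E mulrCA (mulrC d); apply: ler_wpM2l; first exact: epow_ge0.
apply: le_trans (_ : (c + 1) * epow vr eps 1 t <= d).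
  by rewrite ler_wpM2r ?lerDl// epow_ge0.
by rewrite mulrC -ler_pdivlMr ?hT'// ltr_wpDl.
Qed.

End Residual.

(** * Solutions near an approximate solution *)

Lemma within_continuous_comp (R : realType) (n : nat) (D : set (R * 'cV[R]_n)) (J : set R)
    (g : R -> 'cV[R]_n -> 'cV[R]_n) (y : R -> 'cV[R]_n) :
  (forall t, J t -> D (t, y t)) ->
  {within D, continuous (fun ty => g ty.1 ty.2)} -> {within J, continuous y} ->
  {within J, continuous (fun t => g t (y t))}.
Proof.
move=> JD /subspace_continuousP hg /subspace_continuousP hy.
apply/subspace_continuousP => t Jt.
apply: (cvg_comp (fun t => (t, y t)) (fun ty => g ty.1 ty.2) _ (hg _ (JD t Jt))) => P hP.
have ct : u @[u --> within J (nbhs t)] --> t by exact: cvg_within.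
have := @cvg_pair _ _ _ (within J (nbhs t)) (nbhs t) (nbhs (y t))
  ltac:(exact _) ltac:(exact _) ltac:(exact _) id y ct (hy t Jt) _ hP.
by apply: filterS2 (withinT J _) => u Ju; apply; exact: JD.
Qed.

Lemma mulmx_norm_le (R : realType) (n : nat) (A : 'M[R]_n) (x : 'cV[R]_n) :
  `|A *m x| <= (\sum_i \sum_j `|A i j|) * `|x|.
Proof.
have A0 i : 0 <= \sum_j `|A i j| by exact: sumr_ge0.
apply/cV_norm_le; first by rewrite mulr_ge0// sumr_ge0.
move=> i; rewrite mxE (le_trans (ler_norm_sum _ _ _))//.
apply: le_trans (_ : (\sum_j `|A i j|) * `|x| <= _).
  by rewrite mulr_suml; apply: ler_sum => j _; rewrite normrM ler_wpM2l// cV_coord_le.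
by apply: ler_wpM2r => //; rewrite [leRHS](bigD1 i)//= lerDl sumr_ge0.
Qed.

Lemma midx_upto0 n (L : seq 'I_n) : midx_upto 0 L = [:: midx0].
Proof.
elim: L => [//|j L IH]; rewrite midx_upto_cons IH /=; congr [:: _].
by apply/ffunP => i; rewrite !ffunE; case: ifP.
Qed.

Lemma mderiv0 (R : realType) (n : nat) (D : set (R * 'cV[R]_n)) g :
  mderiv D midx0 g = g.
Proof.
rewrite /mderiv (_ : flatten _ = [::])//.
by elim: (enum 'I_n) => //= j r ->; rewrite ffunE.
Qed.

(** The Taylor expansion of order 0: [midx_upto 0] holds the zero index only, and the remainder is
    controlled by the first derivatives. *)
Lemma tube_lipschitz (R : realType) (n : nat) (t0 a : R) (phi0 : R -> 'cV[R]_n)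
    (g : R -> 'cV[R]_n -> 'cV[R]_n) :
  0 <= a -> C0q (tube t0 a phi0) 1 g ->
  (forall w : midx n, msize w = 1%N ->
     exists M : R, forall t y, tube t0 a phi0 (t, y) -> `|mderiv (tube t0 a phi0) w g t y| <= M) ->
  exists L, 0 <= L /\ forall t x y, tube t0 a phi0 (t, x) -> tube t0 a phi0 (t, y) ->
    `|g t x - g t y| <= L * `|x - y|.
Proof.
move=> a0 gC /mderiv_uniform_bound[M M0 hM].
exists ((\sum_(L <- [seq drop i (enum 'I_n) | i <- iota 1 n]) size (midx_upto 0 L))%:R * M).
split; first by rewrite mulr_ge0// ler0n.
move=> t x y Dx Dy; have Dx' : tube t0 a phi0 (t, y + (x - y)) by rewrite addrC subrK.
have := taylor_tube a0 M0 gC (fun w w1 z => hM w w1 t z) Dy Dx'.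
rewrite [y + _]addrC subrK midx_upto0 big_seq1 mderiv0 expr1 (_ : mterm _ _ = 1) ?scale1r//.
by rewrite /mterm big1// => i _; rewrite ffunE /tmon expr0 fact0 invr1 mulr1.
Qed.

Section Perturbation.
Context {R : realType} {n m : nat}.
Variables (t0 a : R) (A : 'M[R]_n) (lam : 'I_n -> R[i]).
Hypothesis charA : char_poly (cplx_mx A) = \prod_(j < n) ('X - (lam j)%:P).
Hypothesis hyp : forall j, complex.Re (lam j) != 0.
Hypothesis n_gt0 : (0 < n)%N.
Hypothesis a_gt0 : 0 < a.
Variables (f phi0 : R -> 'cV[R]_n) (eps : 'I_m.+1 -> R -> R)
  (fl : 'I_m.+1 -> R -> 'cV[R]_n -> 'cV[R]_n).
Local Notation I := (`[t0, +oo[%classic).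
Local Notation D := (tube t0 a phi0).
Hypothesis eps_cont : forall l, {within I, continuous (eps l)}.
Hypothesis eps_small : forall l (d : R), 0 < d -> exists T, forall t, T <= t -> `|eps l t| <= d.
Hypothesis fl_cont : forall l, {within D, continuous (fun ty => fl l ty.1 ty.2)}.
Hypothesis fl_lip : forall l, exists L, 0 <= L /\ forall t x y, D (t, x) -> D (t, y) ->
  `|fl l t x - fl l t y| <= L * `|x - y|.

Lemma forcing_lipschitz (d : R) : 0 < d -> exists T, forall t x y, T <= t ->
  D (t, x) -> D (t, y) ->
  `|\sum_l eps l t *: fl l t x - \sum_l eps l t *: fl l t y| <= d * `|x - y|.
Proof.
move=> d0; have /choice[L hL] := fl_lip.
have den l : 0 < m.+1%:R * (L l + 1) by rewrite mulr_gt0 ?ltr0n// ltr_wpDl//; case: (hL l).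
have /choice[T hT] l : exists T, forall t, T <= t -> `|eps l t| <= d / (m.+1%:R * (L l + 1)).
  by apply: eps_small; rewrite divr_gt0.
(* The sum of absolute values stands in for the maximum of the finitely many thresholds. *)
exists (\sum_l `|T l|) => t x y Tt Dx Dy.
rewrite -sumrB (le_trans (ler_norm_sum _ _ _))//.
have -> : d * `|x - y| = \sum_(l < m.+1) (d / m.+1%:R * `|x - y|).
  by rewrite sumr_const card_ord -[RHS]mulr_natl mulrA mulrCA divff ?mulr1// pnatr_eq0.
apply: ler_sum => l _; rewrite -scalerBr normrZ.
have [L0 /(_ t x y Dx Dy) hl] := hL l.
have el : `|eps l t| <= d / (m.+1%:R * (L l + 1)).
  apply: hT; apply: le_trans Tt; rewrite (le_trans (ler_norm _))// (bigD1 l)//=.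
  by rewrite lerDl sumr_ge0.
apply: le_trans (ler_pM _ _ el hl) _ => //; rewrite mulrA ler_wpM2r//.
rewrite invfM (mulrA d) -(mulrA (d / m.+1%:R)); apply: ler_piMr.
  by rewrite divr_ge0 ?(ltW d0)// ler0n.
by rewrite mulrC ler_pdivrMr ?mul1r ?lerDl// ltr_wpDl.
Qed.

Section Existence.
Variables (s sd : R -> 'cV[R]_n) (w dw : R -> R) (C : R).
Hypothesis f_cont : {within I, continuous f}.
Hypothesis s_deriv : forall t, t0 <= t -> has_deriv_in I s t (sd t).
Hypothesis sd_cont : {within I, continuous sd}.
Hypothesis w_gt0 : forall t, t0 <= t -> 0 < w t.
Hypothesis w_deriv : forall t, t0 < t -> has_deriv_in I w t (dw t).
Hypothesis w_small : forall d : R, 0 < d -> exists T, forall t, T <= t -> w t <= d.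
Hypothesis dw_small : forall d : R, 0 < d -> exists T, forall t, T <= t -> `|dw t| <= d * w t.
Hypothesis s_near : forall d : R, 0 < d -> exists T, forall t, T <= t -> `|s t - phi0 t| <= d.
Hypothesis C_ge0 : 0 <= C.
Hypothesis residual_le : exists T, forall t, T <= t -> `|rhs A f eps fl t (s t) - sd t| <= C * w t.

Theorem perturbed_family : exists T0 B, t0 <= T0 /\ forall T, T0 <= T ->
  exists r : 'cV_#|[pred j | stable_root (lam j)]| -> R -> 'cV[R]_n,
  [/\ forall c, is_solution D A f eps fl T (fun t => s t + r c t),
      forall c t, T <= t -> `|r c t| <= B * w t &
      parameter_family setT (fun=> T) r].
Proof.
(* [B] and [L] are dictated by the hypotheses [M_small] and [L_small] of the iteration:
   [h * C <= B / 4] and [h * L <= 1 / 2]. *)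
pose h := hyperbolic_cst A lam; pose B := 4 * (`|h| * C) + 1.
have hC0 : 0 <= `|h| * C by rewrite mulr_ge0.
have B0 : 0 < B by rewrite ltr_wpDl// mulr_ge0.
pose L := (2 * (`|h| + 1))^-1.
have h1 : 0 < 2 * (`|h| + 1) by rewrite mulr_gt0// ltr_wpDl.
have L0 : 0 < L by rewrite invr_gt0.
have a20 : 0 < a / 2 by rewrite divr_gt0.
have /choice[T1 hT1] (j : 'I_n) : exists T, forall t, T <= t ->
    `|dw t| <= `|complex.Re (lam j)| / 2 * w t.
  by apply: dw_small; rewrite divr_gt0// normr_gt0.
have [T2 hT2] := s_near a20.
have [T3 hT3] := w_small (divr_gt0 a20 B0).
have [T4 hT4] := forcing_lipschitz L0.
have [T5 hT5] := residual_le.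
(* [t0 + 1] puts [T] strictly beyond [t0], where the weight is differentiable; the other thresholds
   make the weight slow, keep [|s - phi0|] and [B * w] within [a / 2] each, and ensure the Lipschitz
   constant [L] and the residual bound. *)
exists (Num.max (t0 + 1) (Num.max (\sum_j `|T1 j|) (Num.max T2 (Num.max T3 (Num.max T4 T5))))), B.
split; first by rewrite le_max lerDl ler01.
move=> T; rewrite !ge_max => /andP[tT /andP[T1T /andP[T2T /andP[T3T /andP[T4T T5T]]]]].
have t0T : t0 < T by apply: lt_le_trans tT; rewrite ltrDl.
have t0t t : T <= t -> t0 <= t by move=> /(lt_le_trans t0T)/ltW.
(* The equation for [r = y - s] is [r' = A r + F t r]; at [x = 0] the forcing is the residual of
   [s]. *)
pose F t x := \sum_l eps l t *: fl l t (s t + x) + (A *m s t + f t - sd t).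
have Bw t : T <= t -> B * w t <= a / 2.
  by move=> Tt; rewrite mulrC -ler_pdivlMr//; apply: hT3; exact: le_trans Tt.
have inD t x : T <= t -> `|x| <= B * w t -> D (t, s t + x).
  move=> Tt hx; split=> /=; first exact: t0t.
  rewrite addrAC (le_trans (ler_normD _ _))// [leRHS](splitr a) lerD//.
    by apply: hT2; exact: le_trans Tt.
  exact: le_trans hx (Bw t Tt).
have sub : (`[T, +oo[ `<=` I)%classic by apply: itvcy_sub; exact: ltW.
have TI (V : normedModType R) (g : R -> V) : {within I, continuous g} -> {within `[T, +oo[, continuous g}.
  exact: continuous_subspaceW.
have s_cont : {within I, continuous s}.
  by apply: (has_deriv_in_continuous (df := sd)) => t /itvcyP; exact: s_deriv.
have [] := @lyapunov_perron R n A lam charA hyp n_gt0 T w dw _ _ _ F B C L B0 (ltW L0).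
- by move=> t Tt; apply/w_gt0/t0t.
- by move=> t Tt; apply: has_deriv_in_sub sub _; apply: w_deriv; exact: lt_le_trans Tt.
- move=> j t Tt; apply: hT1; apply: le_trans Tt; apply: le_trans T1T.
  by rewrite (le_trans (ler_norm _))// (bigD1 j)//= lerDl sumr_ge0.
- move=> r [rc rb].
  have src : {within `[T, +oo[, continuous (fun t => s t + r t)}.
    by apply: within_continuousD => //; exact: TI.
  apply: within_continuousD.
    apply: within_continuous_sum => l _; apply: within_continuousZ; first exact: TI.
    have := @within_continuous_comp R n D `[T, +oo[%classic (fl l) _ _ (@fl_cont l) src.
    apply => t /itvcyP Tt.
    by apply: inD => //; exact: rb.
  apply: TI; apply: within_continuousB => //.
  by apply: within_continuousD => //; exact: within_continuous_mulmx.
- move=> t Tt; rewrite /F addr0; have := hT5 t (le_trans T5T Tt); congr (`|_| <= _).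
  rewrite /rhs; move: (\sum_l _) (A *m s t) => X1 X2.
  by apply/matrixP => i j; rewrite !mxE; ring.
- move=> t x y Tt hx hy; rewrite /F opprD addrACA subrr addr0.
  apply: le_trans (hT4 t _ _ (le_trans T4T Tt) (inD _ _ Tt hx) (inD _ _ Tt hy)) _.
  by rewrite opprD addrACA subrr add0r.
- rewrite /B -/h; apply: le_trans (_ : `|h| * C <= _); first by rewrite ler_wpM2r// ler_norm.
  by lra.
- rewrite -/h /L; apply: le_trans (_ : `|h| / (2 * (`|h| + 1)) <= _).
    by rewrite ler_wpM2r ?ler_norm// invr_ge0 ltW.
  by rewrite ler_pdivrMr// mulrA mulVf// mul1r lerDl.
move=> r [hr rb fam]; exists r; split=> // c t Tt; split.
  by apply: inD => //; exact: rb.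
have := has_deriv_inD (has_deriv_in_sub sub (s_deriv (t0t t Tt))) (hr c t Tt).
congr (has_deriv_in _ _ _ _); rewrite /F /rhs mulmxDr.
move: (\sum_l _) (A *m s t) (A *m r c t) => X1 X2 X3.
by apply/matrixP => i j; rewrite !mxE; ring.
Qed.

End Existence.

(** * Dependence on the value at T and the family of all solutions *)

Section Uniqueness.
Variables (T Lc : R).
Hypothesis t0T : t0 <= T.
Hypothesis Lc_ge0 : 0 <= Lc.
Hypothesis rhs_lip : forall t x y, T <= t -> D (t, x) -> D (t, y) ->
  `|rhs A f eps fl t x - rhs A f eps fl t y| <= Lc * `|x - y|.

Local Notation sol := (is_solution D A f eps fl T).

(* Gronwall's inequality for the Euclidean norm. *)
Lemma solution_dependence y1 y2 t : sol y1 -> sol y2 -> T <= t ->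
  `|y1 t - y2 t| ^+ 2 <= n%:R * expR (2 * n%:R * Lc * (t - T)) * `|y1 T - y2 T| ^+ 2.
Proof.
move=> h1 h2 Tt; pose d u := y1 u - y2 u; pose e u := \sum_i d u i 0 ^+ 2.
pose dd u := rhs A f eps fl u (y1 u) - rhs A f eps fl u (y2 u).
have d_deriv u : T <= u -> has_deriv_in `[T, +oo[ d u (dd u).
  by move=> Tu; apply: has_deriv_inB; [case: (h1 u Tu)|case: (h2 u Tu)].
have e_deriv u : T <= u -> has_deriv_in `[T, +oo[ e u (\sum_i 2 * (dd u i 0 * d u i 0)).
  move=> Tu; apply: has_deriv_in_sum => i _.
  have hi := (has_deriv_in_cV _ _ _ _).1 (d_deriv u Tu) i.
  have := has_deriv_inM ((itvcyP T u).2 Tu) hi hi.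
  by rewrite (_ : _ + _ = 2 * (dd u i 0 * d u i 0)); last by ring.
have d_le u : `|d u| ^+ 2 <= e u.
  have e0 : 0 <= e u by apply: sumr_ge0 => i _; exact: sqr_ge0.
  rewrite -[leRHS]sqr_sqrtr// lerXn2r ?nnegrE ?sqrtr_ge0//.
  apply/cV_norm_le; first exact: sqrtr_ge0.
  move=> i; rewrite -sqrtr_sqr ler_wsqrtr// /e (bigD1 i)//= lerDl.
  by apply: sumr_ge0 => j _; exact: sqr_ge0.
have e_le u : e u <= n%:R * `|d u| ^+ 2.
  apply: le_trans (_ : \sum_(i < n) `|d u| ^+ 2 <= _).
    apply: ler_sum => i _; rewrite -real_normK ?num_real// lerXn2r ?nnegrE//.
    exact: cV_coord_le.
  by rewrite sumr_const card_ord mulr_natl.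
pose c := 2 * n%:R * Lc.
have de_le u : T <= u -> \sum_i 2 * (dd u i 0 * d u i 0) <= c * e u.
  move=> Tu; have [[D1 _] [D2 _]] := (h1 u Tu, h2 u Tu).
  have hdd := rhs_lip Tu D1 D2.
  apply: le_trans (_ : \sum_(i < n) 2 * (Lc * `|d u| ^+ 2) <= _).
    apply: ler_sum => i _; rewrite ler_wpM2l// (le_trans (ler_norm _))// normrM expr2 mulrA.
    rewrite ler_pM ?normr_ge0 ?cV_coord_le//.
    exact: le_trans (cV_coord_le _ _) hdd.
  rewrite sumr_const card_ord -[leLHS]mulr_natl /c.
  have -> : n%:R * (2 * (Lc * `|d u| ^+ 2)) = 2 * n%:R * Lc * `|d u| ^+ 2 by ring.
  by rewrite ler_wpM2l// !mulr_ge0// ler0n.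
pose g u := - (e u * expR (- c * (u - T))).
have g_deriv u : T <= u -> has_deriv_in `[T, +oo[ g u
    (- ((\sum_i 2 * (dd u i 0 * d u i 0)) * expR (- c * (u - T)) + e u * (- c * expR (- c * (u - T))))).
  move=> Tu; apply: has_deriv_inN; apply: has_deriv_inM; first exact/itvcyP.
    exact: e_deriv.
  exact: has_deriv_in_expR.
have : g T <= g t.
  apply: (has_deriv_in_ge0 Tt _ (fun u hu => g_deriv u _)) => [u /andP[Tu _]||u /andP[/ltW Tu _]].
  - exact/itvcyP.
  - by move=> u /andP[].
  rewrite oppr_ge0 mulrA [e u * - c]mulrC -mulrDl mulNr.
  by rewrite pmulr_lle0 ?expR_gt0// subr_le0 de_le.
rewrite lerN2 => hg; apply: le_trans (d_le t) _.
have : e t <= e T * expR (c * (t - T)).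
  rewrite -(ler_pM2r (expR_gt0 (- c * (t - T)))) (le_trans hg)// subrr mulr0 expR0 mulr1.
  by rewrite -mulrA -expRD mulNr subrr expR0 mulr1.
move=> /le_trans; apply; rewrite -/c [leRHS]mulrAC; apply: ler_wpM2r; first exact: expR_ge0.
exact: e_le.
Qed.

(** The value at [T] serves as the parameter, and [E] is the set of values that occur. [Y] picks one
    solution for each; by [solution_dependence] it is unique on [[T, +oo[] and depends continuously
    on the value. *)
Lemma solution_family (form : (R -> 'cV[R]_n) -> Prop) : (forall y, form y -> sol y) ->
  exists (E : set 'cV[R]_n) (Y : 'cV[R]_n -> R -> 'cV[R]_n),
   [/\ forall c, E c -> form (Y c) /\ Y c T = c,
       forall y, form y -> exists2 c, E c & forall t, T <= t -> y t = Y c t &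
       parameter_family E (fun _ => T) Y].
Proof.
move=> hform.
have /choice[Y hY] (c : 'cV[R]_n) : exists y, (exists y', form y' /\ y' T = c) -> form y /\ y T = c.
  have [[y hy]|h] := pselect (exists y', form y' /\ y' T = c); first by exists y.
  by exists (fun=> 0) => h'; case: h.
exists [set c | exists y', form y' /\ y' T = c], Y; split=> [c /hY//|y fy|].
  have Ey : exists y', form y' /\ y' T = y T by exists y.
  exists (y T) => // t Tt; have [/hform sY eY] := hY _ Ey.
  have := solution_dependence (hform _ fy) sY Tt.
  rewrite eY subrr normr0 expr0n mulr0 => h; apply/eqP; rewrite -subr_eq0 -normr_eq0 -sqrf_eq0.
  by rewrite eq_le h sqr_ge0.
split=> [c t Ec Tt|c c' Ec Ec' h]; last first.
  by rewrite -(hY _ Ec).2 -(hY _ Ec').2 h.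
split; first by apply: nearW => c'; exact: ltW.
(* The [+ 1] gives [k >= 1], hence [k * (e / k) ^ 2 = e ^ 2 / k <= e ^ 2]. *)
pose k := n%:R * expR (2 * n%:R * Lc * (t - T)) + 1.
have k0 : 0 < k by rewrite ltr_wpDl// mulr_ge0 ?ler0n ?expR_ge0.
apply/cvgrPdist_le => e e0; rewrite near_withinE.
have /cvgrPdist_le/(_ _ (divr_gt0 e0 k0)) : (c' @[c' --> c]) --> c by exact: cvg_id.
apply: filterS => c' hc Ec'.
have [[/hform s1 e1] [/hform s2 e2]] := (hY _ Ec, hY _ Ec').
have := solution_dependence s1 s2 (ltW Tt); rewrite e1 e2 => hd.
rewrite -(@ler_pXn2r _ 2) ?nnegrE ?(ltW e0)//; apply: le_trans hd _.
apply: le_trans (_ : k * (e / k) ^+ 2 <= _).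
  rewrite ler_pM ?mulr_ge0 ?ler0n ?expR_ge0 ?sqr_ge0 ?lerDl//.
  by rewrite lerXn2r ?nnegrE// divr_ge0 ?(ltW e0) ?(ltW k0).
have -> : k * (e / k) ^+ 2 = e ^+ 2 / k by field; rewrite gt_eqF.
rewrite ler_pdivrMr// ler_peMr ?sqr_ge0// /k lerDr mulr_ge0 ?ler0n ?expR_ge0//.
Qed.

End Uniqueness.

End Perturbation.

Lemma rho_gt0 (R : realType) (m : nat) (vr : 'I_m.+1 -> R) rho kappa nu s :
  (forall l, 0 < vr l) -> rank_enum vr rho kappa nu -> (0 < s)%N -> 0 < rho s.
Proof.
move=> vr0 hr s0.
have [mu [/mset_neq0_mem[x xmu] <-]] := (rhoP hr (rho s)).2 (ex_intro _ s (conj s0 erefl)).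
by apply: lt_le_trans (mon_rank_ge vr0 xmu); rewrite ltr_wpDr.
Qed.

Theorem mainTheorem2 (R : realType) (n m : nat) (hn : (2 <= n)%N)
  (t0 : R) (A : 'M[R]_n)
  (lam : 'I_n -> R[i])
  (hlam : char_poly (map_mx (real_complex R) A) = \prod_(j < n) ('X - (lam j)%:P))
  (K : set (R -> R)) (hK : classK1 t0 A K)
  (f : R -> 'cV[R]_n) (hf : classK1v K f)
  (phi0 : R -> 'cV[R]_n)
  (hphi0K : classK1v K phi0) (hphi0C : Cn_in `[t0, +oo[ 1 phi0)
  (hphi0 : forall t, t0 <= t ->
     has_deriv_in `[t0, +oo[ phi0 t (A *m phi0 t + f t))
  (a : R) (ha : 0 < a)
  (eps : 'I_m.+1 -> R -> R)
  (fl : 'I_m.+1 -> R -> 'cV[R]_n -> 'cV[R]_n)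
  (vr : 'I_m.+1 -> R) (hvr_pos : forall l, 0 < vr l)
  (hvr : forall l l' : 'I_m.+1, (l <= l')%N -> vr l <= vr l')
  (rho : nat -> R) (kappa : nat -> nat) (nu : nat -> nat -> monom m)
  (hrank : rank_enum vr rho kappa nu)
  (k : nat) (hk : (1 <= k)%N)
  (p_ : 'I_m.+1 -> nat)
  (hp : forall l, (p_ l)%:Z = Num.max 0 (Num.floor (rho k - vr l) + 1))
  (q_ : 'I_m.+1 -> int)
  (hq : forall l, q_ l = Num.floor ((rho k - vr l) / vr ord0))
  (Q_ : 'I_m.+1 -> nat)
  (hQ : forall l, (Q_ l)%:Z = Num.max 2 (q_ l + 1))
  (heps_C : forall l, Cn_in `[t0, +oo[ (p_ l) (eps l))
  (heps_O : forall l r, (r <= p_ l)%N ->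
     derivn_in `[t0, +oo[ r (eps l) =O_ (pinfty_nbhs R)
       (fun t => eps ord0 t `^ ((vr l + r%:R) / vr ord0)))
  (heps_ge0 : forall t, t0 <= t -> 0 <= eps ord0 t)
  (heps_o : eps ord0 =o_ (pinfty_nbhs R) (fun=> 1 : R))
  (hfl_C : forall l, C0q (tube t0 a phi0) (Q_ l) (fl l))
  (hfl_bounded : forall l (w : midx n), (msize w <= Q_ l)%N ->
     exists M : R, forall t y, tube t0 a phi0 (t, y) ->
       `|mderiv (tube t0 a phi0) w (fl l) t y| <= M)
  (hfl_K : forall l (w : midx n), vr l <= rho k -> (msize w)%:Z <= q_ l ->
     classK1v K (fun t => mderiv (tube t0 a phi0) w (fl l) t (phi0 t)))
  (hhyp : forall j, complex.Re (lam j) != 0)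
  (heps_gt0 : forall t, t0 <= t -> 0 < eps ord0 t) :
  let s_ := partial_sum t0 phi0 eps kappa nu k in
  let coefs := is_coefs t0 a A K phi0 fl kappa nu k in
  let sol := is_solution (tube t0 a phi0) A f eps fl in
  let error (r : R -> 'cV[R]_n) :=
    r =O_ (pinfty_nbhs R) (fun t => eps ord0 t `^ (rho k.+1 / vr ord0)) in
  (exists phi, coefs phi) /\
  forall phi, coefs phi ->
    (* the residual of s is not identically zero *)
    (exists t, t0 <= t /\
       - deriv_in `[t0, +oo[ (s_ phi) t + rhs A f eps fl t (s_ phi t) != 0) ->
    exists T0, t0 <= T0 /\ forall t0', T0 <= t0' ->
      [/\ (exists r, sol t0' (fun t => s_ phi t + r t) /\ error r),
          (* as many constants in r as eigenvalues with negative real part *)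
          (let d := #|[pred j | complex.Re (lam j) < 0]| in
           exists (t1 : 'cV[R]_d -> R) (r : 'cV[R]_d -> R -> 'cV[R]_n),
             (forall c, [/\ t0' <= t1 c,
                sol (t1 c) (fun t => s_ phi t + r c t) & error (r c)]) /\
             parameter_family setT t1 r) &
          (* solutions y = s + r, for all choices of the coefficients, form a
             family with at most the n scalar parameters y(T) *)
          (forall T, t0' <= T ->
           let form (y : R -> 'cV[R]_n) := sol T y /\
             exists phi', coefs phi' /\ error (fun t => y t - s_ phi' t) in
           exists (E : set 'cV[R]_n) (Y : 'cV[R]_n -> R -> 'cV[R]_n),
             [/\ forall c, E c -> form (Y c) /\ Y c T = c,
                 forall y, form y ->
                   exists2 c, E c & forall t, T <= t -> y t = Y c t &
                 parameter_family E (fun _ => T) Y])].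
Proof.
move=> s_ coefs sol error; set I := `[t0, +oo[%classic.
have n_gt0 : (0 < n)%N by exact: leq_trans hn.
have vr_min l : vr ord0 <= vr l by apply: hvr.
have eps_bigO l r : (r <= p_ l)%N -> is_bigO (derivn_in I r (eps l)) (epow vr eps (vr l + r%:R)).
  move=> rp; apply/(@eqO_pinftyP R _ _ _ t0); last exact: heps_O.
  by move=> t _; exact: powR_ge0.
have eps_small (d : R) : 0 < d -> exists T, forall t, T <= t -> eps ord0 t <= d.
  move=> d0; have /eqoP/(_ d d0)[M [_ hM]] := heps_o.
  exists (M + 1) => t Mt; have := hM t; rewrite normr1 mulr1 => h.
  by rewrite (le_trans (ler_norm _))// h// (lt_le_trans _ Mt)// ltrDl.
split; first exact: (coefs_exist hK hlam n_gt0 hvr_pos vr_min hrank hk hq hfl_K).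
move=> phi hphi _; pose W := epow vr eps (rho k.+1).
have [C [TC [C0 hC]]] : is_bigO (fun t => rhs A f eps fl t (s_ phi t) -
    sum_deriv t0 a A f phi0 eps fl kappa nu k phi t) W.
  exact: (residual_bigO hK f ha hvr_pos vr_min hrank hk hp hq hQ eps_bigO heps_gt0 eps_small
    hfl_C hfl_bounded hphi).
have eps_cont l : {within I, continuous (eps l)} by have [_ /(_ 0%N isT)] := heps_C l.
have eps_van := eps_vanish hvr_pos eps_bigO heps_gt0 eps_small.
have fl_cont l : {within tube t0 a phi0, continuous (fun ty => fl l ty.1 ty.2)}.
  by have [_ /(_ [::] isT)] := hfl_C l.
have Q2 l : (1 < Q_ l)%N by rewrite -ltz_nat hQ lt_max.
have fl_lip l := tube_lipschitz (ltW ha) (C0q_le (ltnW (Q2 l)) (hfl_C l))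
  (fun w w1 => hfl_bounded l w (leq_trans (eq_leq w1) (ltnW (Q2 l)))).
have s_near (d : R) : 0 < d -> exists T, forall t, T <= t -> `|s_ phi t - phi0 t| <= d.
  move=> /(delta_small hK hvr_pos vr_min hrank hk hp eps_bigO heps_gt0 eps_small hphi)[T hT].
  by exists T => t Tt; rewrite /s_ partial_sumE addrC addKr hT.
have [T1 [B [tT1 hT1]]] := @perturbed_family R n m t0 a A lam hlam hhyp n_gt0 ha f phi0 eps fl
  eps_cont eps_van fl_cont fl_lip (s_ phi) (sum_deriv t0 a A f phi0 eps fl kappa nu k phi)
  W (epow_deriv t0 eps vr (rho k.+1)) C
  (classK1v_continuous hK hf)
  (sum_has_deriv hphi0 hvr_pos hrank hk hp heps_C hphi)
  (sum_deriv_continuous hK hf hphi0K hvr_pos hrank hk hp heps_C hphi)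
  (fun t => @epow_gt0 _ _ t0 vr eps heps_gt0 (rho k.+1) t)
  (fun t => @epow_has_deriv _ _ t0 eps vr rho kappa nu k p_ hvr_pos vr_min hrank hk hp heps_C
     heps_gt0 (rho k.+1) t)
  (epow_small hvr_pos heps_gt0 eps_small (rho_gt0 hvr_pos hrank (ltn0Sn k)))
  (epow_deriv_small hvr_pos vr_min hrank hk hp eps_bigO heps_gt0 eps_small (rho k.+1))
  s_near C0 (ex_intro _ TC hC).
(* Beyond [T2] the perturbation has Lipschitz constant 1, so the whole right-hand side is Lipschitz
   with the constant used for uniqueness below. *)
have [T2 hT2] := forcing_lipschitz eps_van fl_lip ltr01.
exists (Num.max T1 T2); split; first by rewrite le_max tT1.
move=> T; rewrite ge_max => /andP[T1T T2T].
have [r [r_sol r_le r_fam]] := hT1 T T1T.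
have r_err c : error (r c).
  apply/(@eqO_pinftyP R _ _ _ t0); first by move=> t _; exact: powR_ge0.
  exists `|B|, T; split=> // t Tt; apply: le_trans (r_le c t Tt) _.
  by rewrite ler_wpM2r ?powR_ge0// ler_norm.
split; first by exists (r 0); split; [exact: r_sol|exact: r_err].
  (* Thanks to [squash] every choice of the constants is admissible from the same [T] on, so [t1]
     can be taken constant. *)
  by exists (fun=> T), r; split=> // c; split=> //; exact: r_sol.
move=> T' TT'; apply: (@solution_family R n m t0 a A f phi0 eps fl T'
  (\sum_i \sum_j `|A i j| + 1)).
- by rewrite addr_ge0// sumr_ge0// => i _; rewrite sumr_ge0.
- move=> t x y T't Dx Dy; have -> : rhs A f eps fl t x - rhs A f eps fl t y =
      A *m (x - y) + (\sum_l eps l t *: fl l t x - \sum_l eps l t *: fl l t y).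
    rewrite /rhs mulmxBr opprD addrACA; congr (_ + _).
    by rewrite opprD addrACA subrr addr0.
  rewrite (le_trans (ler_normD _ _))// mulrDl lerD ?mulmx_norm_le//.
  by apply: hT2 => //; apply: le_trans T't; exact: le_trans TT'.
by move=> y [].
Qed.
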